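(* Let $n\ge 1$ and let $\varrho_1,\varrho_2$ be two proximate orders for positive orders $\rho_1>0$ and $\rho_2>0$ respectively, satisfying $r^{\varrho_1(r)}=O(r^{\varrho_2(r)})$ as $r\to\infty$. (i) Let $P=\sum_{\alpha\in\mathbb{N}^n}a_\alpha(z)\partial_z^\alpha$ belong to $\boldsymbol{D}_{\varrho_1\to\varrho_2,0}$. For every entire function $f\in A_{\varrho_1,+0}$, the series $Pf:=\sum_{\alpha\in\mathbb{N}^n}a_\alpha(z)\partial_z^\alpha f$ converges in $A_{\varrho_2,+0}$, so that $Pf\in A_{\varrho_2,+0}$. Moreover, $f\mapsto Pf$ defines a continuous homomorphism $P:A_{\varrho_1,+0}\to A_{\varrho_2,+0}$. (ii) Let $F:A_{\varrho_1,+0}\to A_{\varrho_2,+0}$ be a continuous homomorphism. Then there is a unique $P\in\boldsymbol{D}_{\varrho_1\to\varrho_2,0}$ such that $Ff=Pf$ holds for every $f\in A_{\varrho_1,+0}$, where $Pf$ is defined by the series in (i).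
   Context: $\mathbb{N}=\{0,1,2,\dots\}$. For $\alpha\in\mathbb{N}^n$: $|\alpha|=\alpha_1+\dots+\alpha_n$, $\alpha!=\alpha_1!\cdots\alpha_n!$, $\partial_z^\alpha=\partial^{|\alpha|}/\partial z_1^{\alpha_1}\cdots\partial z_n^{\alpha_n}$. For $z\in\mathbb{C}^n$, $|z|=\sqrt{|z_1|^2+\dots+|z_n|^2}$. $\mathcal{O}(\mathbb{C}^n)$ is the space of entire functions. ''Continuous homomorphism'' means continuous $\mathbb{C}$-linear map. Proximate order: a differentiable function $\varrho(r)\ge 0$ defined for $r\ge 0$ is a proximate order for the order $\rho\ge 0$ if $\lim_{r\to+\infty}\varrho(r)=\rho$ and $\lim_{r\to+\infty}\varrho'(r)\,r\ln r=0$. Normalization: if $\varrho$ is a proximate order for a positive order $\rho>0$, a normalization of $\varrho$ is a proximate order $\hat\varrho$ such that there is $r_1>0$ with $\hat\varrho(r)=\varrho(r)$ for all $r\ge r_1$, and $r\mapsto r^{\hat\varrho(r)}$ is strictly increasing on $r>0$ and maps $(0,\infty)$ onto $(0,\infty)$. Such a normalization always exists. Given $\hat\varrho$, let $r=\varphi(t)$ $(t>0)$ be the inverse function of $t=r^{\hat\varrho(r)}$ $(r>0)$, and set $G_{\hat\varrho,q}:=\varphi(q)^q/(e\rho)^{q/\rho}$ for $q\in\mathbb{N}$ (with $G_{\hat\varrho,0}=1$). Spaces: for a proximate order $\varrho$ for a positive order and $\sigma>0$, $A_{\varrho,\sigma}$ is the Banach space of $f\in\mathcal{O}(\mathbb{C}^n)$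 with $\|f\|_{\varrho,\sigma}:=\sup_{z\in\mathbb{C}^n}|f(z)|\exp(-\sigma|z|^{\varrho(|z|)})<\infty$. $A_{\varrho,+0}:=\varprojlim_{\varepsilon>0}A_{\varrho,\varepsilon}$ (the intersection over $\varepsilon>0$ with the projective limit topology, i.e. the topology defined by the norms $\|\cdot\|_{\varrho,\varepsilon}$, $\varepsilon>0$). $A_\varrho:=\varinjlim_{\sigma>0}A_{\varrho,\sigma}$ (the union over $\sigma>0$). Operators: fix a normalization $\hat\varrho_1$ of $\varrho_1$. $\boldsymbol{D}_{\varrho_1\to\varrho_2,0}$ is the set of all formal differential operators $P=\sum_{\alpha\in\mathbb{N}^n}a_\alpha(z)\partial_z^\alpha$ (identified with the multisequence $(a_\alpha)_{\alpha\in\mathbb{N}^n}$ of coefficients), with $(a_\alpha)_{\alpha}\subset A_{\varrho_2}$ satisfying $$\forall\sigma>0,\ \exists\lambda>0,\ \exists C>0,\ \forall\alpha\in\mathbb{N}^n,\quad \|a_\alpha\|_{\varrho_2,\sigma}\le C\,\frac{G_{\hat\varrho_1,|\alpha|}}{\alpha!}\lambda^{|\alpha|}.$$ (In particular each $a_\alpha$ belongs to $A_{\varrho_2,+0}$.) This set does not depend on the choice of the normalization $\hat\varrho_1$. Convergence of a series indexed by $\mathbb{N}^n$ means convergence of the net of its finite partial sums. *)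

(* Defs.v *)
From HB Require Import structures.
From mathcomp Require Import all_boot all_order all_algebra.
From mathcomp Require Import complex.
From mathcomp Require Import all_classical all_reals all_analysis.
From mathcomp Require Import showcase.summability.

Set Implicit Arguments.
Unset Strict Implicit.
Unset Printing Implicit Defensive.

Import Order.TTheory GRing.Theory Num.Theory.
Import numFieldNormedType.Exports.
Import Normc.

Local Open Scope classical_set_scope.
Local Open Scope ring_scope.
Local Open Scope complex_scope.

Section MultiIndex.
Variable n : nat.

Definition midx := {ffun 'I_n -> nat}.
Definition mdeg (alpha : midx) : nat := (\sum_i alpha i)%N.
Definition mfact (alpha : midx) : nat := (\prod_i (alpha i)`!)%N.

End MultiIndex.

Section ProximateOrder.
Variable R : realType.
Implicit Types (rho : R) (prho phat : R -> R).

(* A function on [0, +oo) is represented by a function on R whose values at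
   negative arguments are irrelevant; differentiability at 0 is one-sided. *)
Definition proximate_order rho prho : Prop :=
  [/\ forall r, 0 <= r -> 0 <= prho r,
      forall r, 0 < r -> derivable prho r 1,
      cvg ((fun h => h^-1 * (prho h - prho 0)) @ 0^'+),
      prho r @[r --> +oo] --> rho
    & derive1 prho r * (r * ln r) @[r --> +oo] --> 0].

Definition normalization rho prho phat : Prop :=
  [/\ proximate_order rho phat,
      exists2 r1, 0 < r1 & forall r, r1 <= r -> phat r = prho r,
      forall r s, 0 < r -> r < s -> r `^ phat r < s `^ phat s
    & [set r `^ phat r | r in [set r | 0 < r]] = [set t | 0 < t]].

(* The inverse on (0, +oo) of r |-> r `^ phat r; junk value 0 elsewhere. *)
Definition phi phat (t : R) : R :=
  xget 0 [set r | 0 < r /\ r `^ phat r = t].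

(* For q = 0 both powers are 1, so that Gcoef rho phat 0 = 1. *)
Definition Gcoef rho phat (q : nat) : R :=
  phi phat q%:R ^+ q / (expR 1 * rho) `^ (q%:R / rho).

End ProximateOrder.

(* The regular module R[i]^o carries the normed module structure of R[i]. *)
Notation cfun R n := ('rV[R[i]]_n -> R[i]^o).

Section Functions.
Variables (R : realType) (n : nat).
Implicit Types (f g : cfun R n) (prho : R -> R) (sigma : R).

(* The norm provided by the library on 'rV[R[i]]_n is the sup norm; it defines
   the topology of C^n, but growth is measured by the Euclidean norm. *)
Definition enorm (z : 'rV[R[i]]_n) : R := Num.sqrt (\sum_i normc (z 0 i) ^+ 2).

Definition entire f : Prop := forall z, differentiable f z.

Definition pderiv (i : 'I_n) f : cfun R n := fun z => 'D_(delta_mx 0 i) f z.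

Definition mderiv (alpha : midx n) f : cfun R n :=
  foldr (fun i g => iter (alpha i) (pderiv i) g) f (enum 'I_n).

Definition wnorm prho sigma f : \bar R :=
  ereal_sup [set (normc (f z) * expR (- sigma * enorm z `^ prho (enorm z)))%:E
            | z in [set: 'rV[R[i]]_n]].

Definition Asigma prho sigma : set (cfun R n) :=
  [set f | entire f /\ (wnorm prho sigma f < +oo)%E].

Definition Aunion prho : set (cfun R n) :=
  [set f | exists2 sigma, 0 < sigma & Asigma prho sigma f].

Definition Azero_set prho : set (cfun R n) :=
  [set f | forall sigma, 0 < sigma -> Asigma prho sigma f].

Lemma normc_ge0 (x : R[i]) : 0 <= normc x.
Proof. by case: x => a b; exact: sqrtr_ge0. Qed.

Lemma wnorm_le prho sigma f (M : \bar R) :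
  (forall z, (normc (f z) * expR (- sigma * enorm z `^ prho (enorm z)))%:E
    <= M)%E -> (wnorm prho sigma f <= M)%E.
Proof. by move=> fM; apply: ge_ereal_sup => _ [z _ <-]. Qed.

Lemma le_wnorm prho sigma f z :
  ((normc (f z) * expR (- sigma * enorm z `^ prho (enorm z)))%:E
    <= wnorm prho sigma f)%E.
Proof. by apply: ereal_sup_ubound; exists z. Qed.

Lemma wnorm_ge0 prho sigma f : (0 <= wnorm prho sigma f)%E.
Proof.
apply: le_trans (le_wnorm prho sigma f 0).
by rewrite lee_fin mulr_ge0 ?expR_ge0 ?normc_ge0.
Qed.

Lemma wnormD prho sigma f g :
  (wnorm prho sigma (f + g)%R <= wnorm prho sigma f + wnorm prho sigma g)%E.
Proof.
apply: wnorm_le => z.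
apply: le_trans (leeD (le_wnorm prho sigma f z) (le_wnorm prho sigma g z)).
by rewrite -EFinD lee_fin -mulrDl ler_wpM2r ?expR_ge0 ?le_normcD.
Qed.

Lemma wnormZ_lty prho sigma (a : R[i]) f :
  (wnorm prho sigma f < +oo)%E -> (wnorm prho sigma (a *: f)%R < +oo)%E.
Proof.
move=> fy; apply: (@le_lt_trans _ _ ((normc a)%:E * wnorm prho sigma f)%E).
  apply: wnorm_le => z; rewrite [normc _]normcM -mulrA EFinM.
  by rewrite lee_wpmul2l ?lee_fin ?normc_ge0 ?le_wnorm.
by rewrite lte_mul_pinfty ?lee_fin ?normc_ge0.
Qed.

Lemma wnorm0 prho sigma : wnorm prho sigma 0 = 0%E.
Proof.
apply/eqP; rewrite eq_le wnorm_ge0 andbT; apply: wnorm_le => z.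
by rewrite [normc _]normc0 mul0r.
Qed.

Lemma wnorm_anti prho sigma tau f : sigma <= tau ->
  (wnorm prho tau f <= wnorm prho sigma f)%E.
Proof.
move=> st; apply: wnorm_le => z; apply: le_trans (le_wnorm _ _ _ z).
rewrite lee_fin ler_wpM2l ?normc_ge0 // ler_expR !mulNr lerN2.
by rewrite ler_wpM2r ?powR_ge0.
Qed.

End Functions.

Section Azero.
Variables (R : realType) (n : nat) (prho : R -> R).

Definition Azero_pred : {pred cfun R n} := mem (Azero_set prho).

Record Azero := MkAzero {
  Azero_fun :> cfun R n;
  _ : Azero_fun \in Azero_pred }.

HB.instance Definition _ := [isSub for Azero_fun].
HB.instance Definition _ := [Choice of Azero by <:].

Lemma Azero_submod_closed : submod_closed Azero_pred.
Proof.
split=> [|a f g /set_mem fA /set_mem gA]; apply/mem_set => sigma sigma0.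
  by split; [move=> z; exact: differentiable_cst | rewrite wnorm0 ltry].
have [df fy] := fA _ sigma0; have [dg gy] := gA _ sigma0.
split; first by move=> z; apply: differentiableD; [exact: differentiableZ|].
apply: le_lt_trans (wnormD _ _ _ _) _.
by rewrite lte_add_pinfty ?wnormZ_lty.
Qed.

HB.instance Definition _ :=
  GRing.isSubmodClosed.Build _ _ Azero_pred Azero_submod_closed.
HB.instance Definition _ := [SubChoice_isSubLmodule of Azero by <:].

Definition Azero_ball (f : Azero) (ed : R * R) : set Azero :=
  [set g | (wnorm prho ed.1 (g - f : Azero)%R < ed.2%:E)%E].

(* The topology defined by the norms wnorm prho e, e > 0. As these decrease
   with e, balls for a single norm already form bases of neighbourhoods. *)
Definition Azero_nbhs (f : Azero) : set_system Azero :=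
  filter_from [set ed | 0 < ed.1 /\ 0 < ed.2] (Azero_ball f).

HB.instance Definition _ := hasNbhs.Build Azero Azero_nbhs.

Lemma Azero_ball_center f ed : 0 < ed.2 -> Azero_ball f ed f.
Proof. by rewrite /Azero_ball /= subrr wnorm0 lte_fin. Qed.

Lemma Azero_nbhs_filter f : ProperFilter (Azero_nbhs f).
Proof.
apply: filter_from_proper; last first.
  by move=> ed [_ d0]; exists f; exact: Azero_ball_center.
apply: filter_from_filter; first by exists (1, 1); split=> /=.
move=> [e d] [e' d'] [/= e0 d0] [/= e0' d0'].
exists (Num.min e e', Num.min d d') => /=.
  by rewrite !lt_min e0 e0' d0 d0'.
move=> g; rewrite /Azero_ball /= EFin_min lt_min => /andP[gd gd'].
by split; [apply: le_lt_trans gd | apply: le_lt_trans gd'];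
  apply: wnorm_anti; rewrite ge_min lexx ?orbT.
Qed.

Lemma Azero_nbhs_singleton f (U : set Azero) : Azero_nbhs f U -> U f.
Proof. by move=> [ed [_ d0]]; apply; exact: Azero_ball_center. Qed.

Lemma Azero_nbhs_nbhs f (U : set Azero) :
  Azero_nbhs f U -> Azero_nbhs f (Azero_nbhs^~ U).
Proof.
move=> [[e d] [/= e0 d0] fU]; exists (e, d) => // g gf.
have gfE : wnorm prho e (g - f : Azero)%R \is a fin_num.
  by rewrite ge0_fin_numE ?wnorm_ge0 ?(lt_trans gf) ?ltry.
exists (e, d - fine (wnorm prho e (g - f : Azero)%R)).
  by split=> //=; rewrite subr_gt0 -lte_fin fineK.
move=> h hg; apply: fU; rewrite /Azero_ball /mkset.
have -> : h - f = (h - g) + (g - f) by rewrite addrA subrK.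
apply: le_lt_trans (wnormD _ _ _ _) _.
by move: hg; rewrite /Azero_ball /= EFinB fineK // lteBrDr.
Qed.

HB.instance Definition _ := Nbhs_isNbhsTopological.Build Azero
  Azero_nbhs_filter Azero_nbhs_singleton Azero_nbhs_nbhs.

End Azero.

Section Operators.
Variables (R : realType) (n : nat).

(* The formal operator is its multisequence of coefficients. *)
Definition formal_op := midx n -> cfun R n.

Definition Dzero (rho1 : R) (phat1 prho2 : R -> R) : set formal_op :=
  [set a | (forall alpha, Aunion prho2 (a alpha)) /\
    forall sigma, 0 < sigma -> exists lambda, 0 < lambda /\
      exists C, 0 < C /\ forall alpha,
        (wnorm prho2 sigma (a alpha) <=
          (C * (Gcoef rho1 phat1 (mdeg alpha) / (mfact alpha)%:R)
             * lambda ^+ mdeg alpha)%:E)%E].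

(* The terms a_alpha d^alpha f all lie in A_{prho2,+0}, and the net of their
   finite partial sums converges to g in that space. *)
Definition op_sum (prho1 prho2 : R -> R) (a : formal_op)
    (f : Azero n prho1) (g : Azero n prho2) : Prop :=
  exists2 t : midx n -> Azero n prho2,
    (forall alpha z, t alpha z = a alpha z * mderiv alpha f z) &
    partial_sum t @ totally --> g.

End Operators.

(* Main.v *)
Require Import Defs.
From HB Require Import structures.
From mathcomp Require Import all_boot all_order all_algebra.
From mathcomp Require Import complex.
From mathcomp Require Import all_classical all_reals all_analysis.
From mathcomp Require Import finmap showcase.summability.
From mathcomp Require Import ring lra.
Set Implicit Arguments.
Unset Strict Implicit.
Unset Printing Implicit Defensive.
Import Order.TTheory GRing.Theory Num.Theory.
Import numFieldNormedType.Exports.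
Import Normc.
Local Open Scope classical_set_scope.
Local Open Scope ring_scope.
Local Open Scope complex_scope.
(** Everything is read off from power series. Write V1(r) and V2(r) for r to the
    power prho1(r) and prho2(r), phi for the inverse of the normalized V1, and
    phi_pow q for phi(q)^q; up to a factor kappa^q this is the weight G_q of the
    theorem. Two estimates, dual to each other, describe the growth of V1 by the
    numbers phi_pow q.
    - [pow_le_growth]: r^q <= lam^q * phi_pow q * exp(eps * V1(r)), with lam
      depending on eps only. Hence monomials have finite norms of the right size.
    - [coef_decay]: if |f| <= M * exp(eps * V1) with eps small enough, depending
      on be, then the Taylor coefficients of f satisfy
      |c_al| <= K * M * be^|al| / phi_pow |al|, and be may be as small as desired.
    Both come from [regular_variation]: the derivative of ln V1 with respect to
    ln r is prho1'(r) * r * ln r + prho1(r), which tends to rho1 > 0, so that V1 is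
    squeezed between two powers of r. Since phi is nondecreasing,
    phi_pow p * phi_pow q <= phi_pow (p + q).

    Part (i). Differentiating the Taylor series of f term by term and multiplying
    the two estimates gives [mderiv_growth]: the derivative of order ga of f is at
    most K * M * ga! * th^|ga| / phi_pow |ga| * exp(eps * V1), with th as small as
    desired. The bound on a_ga in the definition of the space of operators is of
    the form C * phi_pow |ga| / ga! * (kappa * lam)^|ga|, so the product of the two
    is at most 2^-|ga| times a constant times M ([op_term_growth]). Hence the series
    converges in every norm, with a sum that depends continuously on f
    ([operator_continuous]); V1 = O(V2) converts the remaining exponential.

    Part (ii). Apply a would-be operator to the function w |-> (w - z)^ga and
    evaluate at w = z: only the term of index ga survives. So the coefficients can
    only be a_ga(z) = F((w - z)^ga)(z) / ga!, which settles uniqueness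
    ([symbol_unique]). The continuity of F and [pow_le_growth] show that these
    coefficients satisfy the required bounds ([symbol_growth]), and the binomial
    formula shows that they are entire. By part (i) they define a continuous
    operator; it agrees with F on monomials, by the Taylor formula for polynomials
    ([symbol_mono]), and polynomials are dense because Taylor series converge in
    every norm ([taylor_growth]).

    Complex analysis. The function theory needed (Taylor expansion with Cauchy's
    inequalities up to a factor 8^|al|, termwise differentiation, limits of entire
    functions) rests on one integral theorem, Goursat's theorem for rectangles. In
    logarithmic coordinates it yields |g'(a)| <= 4 * M / r when |g| <= M on the disc
    of radius r ([cauchy_estimate]). Applied to increments of g this inequality
    controls the second order remainder ([holomorphic_taylor2]), uniformly enough
    to pass to pointwise limits of locally bounded sequences ([holomorphic_limit]).
    Derivatives, as limits of difference quotients, and divided differences, as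
    limits of Riemann sums of derivatives, are then entire again, and iterated
    divided differences at 0 are the Taylor coefficients. In several variables one
    restricts to complex lines. *)

Local Notation cRe := (@complex.Re _).
Local Notation cIm := (@complex.Im _).

(** * The modulus of complex numbers *)

Section ComplexNorm.
Variable R : realType.
Implicit Types (x y : R[i]) (t : R).

Lemma ncD x y : normc (x + y) <= normc x + normc y.
Proof. exact: (@le_normcD R x y). Qed.

Lemma ncN x : normc (- x) = normc x.
Proof. exact: (@normcN R x). Qed.

Lemma ncB x y : normc (x - y) <= normc x + normc y.
Proof. by rewrite -(ncN y) ncD. Qed.

Lemma nc_dist x y : normc (x - y) = normc (y - x).
Proof. by rewrite -ncN opprB. Qed.

Lemma nc_real t : normc t%:C = `|t|.
Proof. by rewrite /= expr0n /= addr0 sqrtr_sqr. Qed.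

Lemma ncX x k : normc (x ^+ k) = normc x ^+ k.
Proof. by elim: k => [|k IH]; rewrite ?expr0 ?normc1 // !exprS normcM IH. Qed.

Lemma nc_nat k : normc (k%:R : R[i]) = k%:R.
Proof.
have -> : (k%:R : R[i]) = (k%:R : R)%:C by rewrite rmorph_nat.
by rewrite nc_real ger0_norm.
Qed.

Lemma nc_sum (I : Type) (r : seq I) (P : pred I) (F : I -> R[i]) :
  normc (\sum_(i <- r | P i) F i) <= \sum_(i <- r | P i) normc (F i).
Proof.
elim/big_rec2: _ => [|i y1 y2 _ le12]; first by rewrite normc0.
by apply: le_trans (ncD _ _) _; rewrite lerD2l.
Qed.

Lemma nc_prod (I : Type) (r : seq I) (P : pred I) (F : I -> R[i]) :
  normc (\prod_(i <- r | P i) F i) = \prod_(i <- r | P i) normc (F i).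
Proof.
elim/big_rec2: _ => [|i y1 y2 _ <-]; first by rewrite normc1.
by rewrite normcM.
Qed.

Lemma Re_le_nc x : `|cRe x| <= normc x.
Proof.
case: x => a b /=; rewrite -sqrtr_sqr ler_wsqrtr //.
by rewrite lerDl sqr_ge0.
Qed.

Lemma Im_le_nc x : `|cIm x| <= normc x.
Proof.
case: x => a b /=; rewrite -sqrtr_sqr ler_wsqrtr //.
by rewrite lerDr sqr_ge0.
Qed.

Lemma nc_le_ReIm x : normc x <= `|cRe x| + `|cIm x|.
Proof.
have {1}-> : x = (cRe x)%:C + 'i%C * (cIm x)%:C by rewrite -complexE.
apply: le_trans (ncD _ _) _.
have i1 : normc ('i%C : R[i]) = 1 by rewrite /= expr0n expr1n add0r sqrtr1.
by rewrite normcM !nc_real i1 mul1r.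
Qed.

Lemma halfr_gt0 (e : R) : 0 < e -> 0 < e / 2.
Proof. by move=> e0; rewrite divr_gt0. Qed.

Lemma ReB x y : cRe (x - y) = cRe x - cRe y. Proof. by case: x; case: y. Qed.
Lemma ImB x y : cIm (x - y) = cIm x - cIm y. Proof. by case: x; case: y. Qed.

Lemma nc_eq0 x : (forall e, 0 < e -> normc x <= e) -> x = 0.
Proof.
move=> xe; apply: eq0_normc; apply/eqP; rewrite eq_le normc_ge0 andbT.
by apply/ler_addgt0Pr => e /xe; rewrite add0r.
Qed.

End ComplexNorm.

(** * Complex derivatives of functions of one variable *)

Section ComplexDerivative.
Variable R : realType.
Local Notation C := R[i].
Implicit Types (f g : C -> C) (a d : C).

(** An epsilon-delta form with the real-valued modulus, since all later estimates
    are inequalities between real numbers. *)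
Definition is_cderiv g a d := forall e : R, 0 < e -> exists2 del : R, 0 < del &
  forall h, normc h < del -> normc (g (a + h) - g a - d * h) <= e * normc h.

Definition holomorphic g := forall a, exists d, is_cderiv g a d.

Definition cderiv g a : C := xget 0 [set d | is_cderiv g a d].

Lemma holomorphic_cderiv g a : holomorphic g -> is_cderiv g a (cderiv g a).
Proof. by move=> /(_ a) [d gd]; apply: (@xgetPex _ 0 [set d | is_cderiv g a d]); exists d. Qed.

Lemma is_cderiv_uniq g a d d' : is_cderiv g a d -> is_cderiv g a d' -> d = d'.
Proof.
move=> gd gd'; apply/eqP; rewrite -subr_eq0; apply/eqP/nc_eq0 => e e0.
have [r r0 rP] := gd (e / 2) (halfr_gt0 e0).
have [s s0 sP] := gd' (e / 2) (halfr_gt0 e0).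
pose t := Num.min r s / 2.
have t0 : 0 < t by rewrite divr_gt0 // lt_min r0 s0.
have nt : normc (t%:C : C) = t by rewrite nc_real gtr0_norm.
have tm : t < Num.min r s by rewrite ltr_pdivrMr // ltr_pMr ?ltr1n // lt_min r0 s0.
have /rP H1 : normc (t%:C : C) < r by rewrite nt; move: tm; rewrite lt_min => /andP[].
have /sP H2 : normc (t%:C : C) < s by rewrite nt; move: tm; rewrite lt_min => /andP[].
rewrite nt in H1 H2.
rewrite -(ler_pM2r t0) -{1}nt -normcM.
have -> : (d - d') * t%:C = (g (a + t%:C) - g a - d' * t%:C) -
   (g (a + t%:C) - g a - d * t%:C) by ring.
apply: le_trans (ncB _ _) _; apply: le_trans (lerD H2 H1) _.
by rewrite -mulrDl -splitr.
Qed.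

Lemma cderivE g a d : is_cderiv g a d -> cderiv g a = d.
Proof.
move=> gd; suff H : is_cderiv g a (cderiv g a) by exact: is_cderiv_uniq H gd.
by apply: (@xgetPex _ 0 [set d | is_cderiv g a d]); exists d.
Qed.

Lemma is_cderiv_cont g a d e : is_cderiv g a d -> 0 < e ->
  exists2 del : R, 0 < del & forall h, normc h < del -> normc (g (a + h) - g a) <= e.
Proof.
move=> gd e0; have [r r0 rP] := gd 1 ltr01.
have k0 : 0 < 1 + normc d by rewrite ltr_pwDl // normc_ge0.
exists (Num.min r (e / (1 + normc d))).
  by rewrite lt_min r0 divr_gt0.
move=> h; rewrite lt_min => /andP[/rP H1 H2].
have -> : g (a + h) - g a = (g (a + h) - g a - d * h) + d * h by ring.
apply: le_trans (ncD _ _) _; rewrite normcM.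
apply: le_trans (lerD H1 (lexx _)) _; rewrite -mulrDl mulrC.
by rewrite -ler_pdivlMr // ltW.
Qed.

Lemma is_cderiv_cst c a : is_cderiv (fun=> c) a 0.
Proof.
move=> e e0; exists 1 => // h _.
by rewrite subrr mul0r subr0 normc0 mulr_ge0 ?normc_ge0 // ltW.
Qed.

Lemma is_cderiv_id a : is_cderiv id a 1.
Proof.
move=> e e0; exists 1 => // h _.
have -> : id (a + h) - id a - 1 * h = 0 by rewrite /=; ring.
by rewrite normc0 mulr_ge0 ?normc_ge0 // ltW.
Qed.

Lemma is_cderivD f g a d d' : is_cderiv f a d -> is_cderiv g a d' -> is_cderiv (fun x => f x + g x) a (d + d').
Proof.
move=> fd gd e e0.
have [r r0 rP] := fd (e / 2) (halfr_gt0 e0).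
have [s s0 sP] := gd (e / 2) (halfr_gt0 e0).
exists (Num.min r s); first by rewrite lt_min r0 s0.
move=> h; rewrite lt_min => /andP[/rP H1 /sP H2].
have -> : f (a + h) + g (a + h) - (f a + g a) - (d + d') * h =
  (f (a + h) - f a - d * h) + (g (a + h) - g a - d' * h) by ring.
apply: le_trans (ncD _ _) _; apply: le_trans (lerD H1 H2) _.
by rewrite -mulrDl -splitr.
Qed.

Lemma is_cderivM f g a d d' : is_cderiv f a d -> is_cderiv g a d' ->
  is_cderiv (fun x => f x * g x) a (d * g a + f a * d').
Proof.
move=> fd gd e e0.
have [c c0 cP] := is_cderiv_cont gd ltr01.
pose k := 1 + normc (g a) + normc (f a) + normc d.
have k0 : 0 < k by rewrite /k -!addrA ltr_pwDl // !addr_ge0 ?normc_ge0.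
have e3 : 0 < e / 3 / k by rewrite !divr_gt0.
have [r r0 rP] := fd _ e3.
have [s s0 sP] := gd _ e3.
have [u u0 uP] := is_cderiv_cont gd e3.
exists (Num.min (Num.min r s) (Num.min c u)).
  by rewrite !lt_min r0 s0 c0 u0.
move=> h; rewrite !lt_min => /andP[/andP[/rP H1 /sP H2] /andP[/cP H3 /uP H4]].
have -> : f (a + h) * g (a + h) - f a * g a - (d * g a + f a * d') * h =
  (f (a + h) - f a - d * h) * (g (a + h) - g a + g a) + f a * (g (a + h) - g a - d' * h) +
  d * h * (g (a + h) - g a) by ring.
have q1 : normc (g (a + h) - g a + g a) <= k.
  apply: le_trans (ncD _ _) _; apply: le_trans (lerD H3 (lexx _)) _.
  by rewrite /k -!addrA lerD2l lerDl addr_ge0 ?normc_ge0.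
have q2 : normc (f a) <= k by rewrite /k; have := normc_ge0 d; have := normc_ge0 (g a); lra.
have q3 : normc d <= k by rewrite /k; have := normc_ge0 (f a); have := normc_ge0 (g a); lra.
have eE : e = (e / 3 / k * k) * 3 by field; rewrite gt_eqF.
have n0 := normc_ge0 h.
apply: le_trans (ncD _ _) _; rewrite [e in leRHS]eE.
set w := e / 3 / k in H1 H2 H4 e3 *.
have w0 := ltW e3.
have -> : w * k * 3 * normc h = w * normc h * k + k * (w * normc h) + k * normc h * w by ring.
apply: lerD; first (apply: le_trans (ncD _ _) _; apply: lerD).
- by rewrite normcM ler_pM ?normc_ge0.
- by rewrite normcM ler_pM ?normc_ge0.
- rewrite !normcM ler_pM ?normc_ge0 ?mulr_ge0 ?normc_ge0 //.
  by rewrite ler_wpM2r.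
Qed.

Lemma is_cderiv_comp f g a d d' : is_cderiv g a d -> is_cderiv f (g a) d' ->
  is_cderiv (fun x => f (g x)) a (d' * d).
Proof.
move=> gd fd e e0.
pose k := 1 + normc d + normc d'.
have k0 : 0 < k by rewrite /k -!addrA ltr_pwDl // !addr_ge0 ?normc_ge0.
have e1 : 0 < e / 2 / k by rewrite !divr_gt0.
have [r r0 rP] := fd _ e1.
have [s s0 sP] := gd _ e1.
have [s' s'0 s'P] := gd _ ltr01.
have [u u0 uP] := is_cderiv_cont gd (halfr_gt0 r0).
exists (Num.min (Num.min s s') u); first by rewrite !lt_min s0 s'0 u0.
move=> h; rewrite !lt_min => /andP[/andP[/sP H1 /s'P H2] /uP H3].
set w := g (a + h) - g a in H1 H2 H3 *.
have wr : normc w < r by apply: le_lt_trans H3 _; rewrite ltr_pdivrMr // ltr_pMr ?ltr1n.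
have := rP w wr; rewrite {1}/w subrKC => H4.
have wk : normc w <= k * normc h.
  have -> : w = (w - d * h) + d * h by ring.
  apply: le_trans (ncD _ _) _; rewrite [normc (d * _)]normcM.
  apply: le_trans (lerD H2 (lexx _)) _; rewrite -mulrDl ler_wpM2r ?normc_ge0 //.
  by rewrite /k lerDl normc_ge0.
have -> : f (g (a + h)) - f (g a) - d' * d * h =
   (f (g (a + h)) - f (g a) - d' * w) + d' * (w - d * h) by ring.
have eE : e * normc h = (e / 2 / k) * (k * normc h) + k * ((e / 2 / k) * normc h).
  by field; rewrite gt_eqF.
rewrite eE; apply: le_trans (ncD _ _) _; apply: lerD.
  by apply: le_trans H4 _; rewrite ler_wpM2l // ltW.
rewrite normcM ler_pM ?normc_ge0 //.
by rewrite /k; have := normc_ge0 d; lra.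
Qed.

Lemma is_cderiv_shift f a b d : is_cderiv f (a + b) d -> is_cderiv (fun x => f (x + b)) a d.
Proof.
move=> H e e0; have [r r0 rP] := H e e0; exists r => // h /rP.
by rewrite (addrAC a b h).
Qed.

End ComplexDerivative.

(** * Primitives and mean value inequalities along real lines *)

Section RealLine.
Variable R : realType.
Local Notation C := R[i].

Lemma antiderivative (v : R -> R) (A : R) : continuous v ->
  exists U : R -> R, forall t, A < t -> is_derive t (1 : R) U (v t).
Proof.
move=> cv; exists (fun x => \int[lebesgue_measure]_(t in `[A, x]) v t)%R => t At.
have := @continuous_FTC1_closed R v A t (t + 1) _ _ At (cv t).
case.
- by rewrite ltrDl.
- apply: continuous_compact_integrable; first exact: segment_compact.
  exact: continuous_subspaceT.
- move=> dU <-; rewrite derive1E; exact: derivableP.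
Qed.

Lemma is_derive_of_eps (f : R -> R) (x l : R) :
  (forall e, 0 < e -> exists2 del : R, 0 < del &
     forall h, `|h| < del -> `|f (x + h) - f x - l * h| <= e * `|h|) ->
  is_derive x (1 : R) f l.
Proof.
move=> H.
have cl : (fun h => h^-1 *: (f (h *: 1 + x) - f x)) @ 0^' --> (l : R).
  apply/cvgrPdist_le => e e0; have [del del0 dP] := H e e0.
  near=> h.
  have h0 : h != 0 by near: h; exact: nbhs_dnbhs_neq.
  have hd : `|h| < del.
    near: h; apply: dnbhs0_lt => //.
  have := dP h hd; rewrite /GRing.scale /= mulr1 (addrC h x).
  have -> : l - h^-1 * (f (x + h) - f x) = - (h^-1 * (f (x + h) - f x - l * h)) by field.
  by move=> H'; rewrite normrN normrM normfV ler_pdivrMl ?normr_gt0 // (mulrC _ e).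
split; first by apply/cvg_ex; exists l.
exact: cvg_lim cl.
Unshelve. all: by end_near. Qed.

(** Componentwise, so that the real mean value theorem applies. *)
Definition is_rderiv (F : R -> C) (t : R) (d : C) :=
  is_derive t (1 : R) (fun s => cRe (F s)) (cRe d) /\
  is_derive t (1 : R) (fun s => cIm (F s)) (cIm d).

Lemma is_rderiv_line (Q : C -> C) (p v d : C) (t : R) :
  is_cderiv Q (p + t%:C * v) d -> is_rderiv (fun s => Q (p + s%:C * v)) t (d * v).
Proof.
move=> Qd.
have H e : 0 < e -> exists2 del : R, 0 < del & forall h, `|h| < del ->
    normc (Q (p + (t + h)%:C * v) - Q (p + t%:C * v) - h%:C * (d * v)) <= e * `|h|.
  move=> e0; pose k := normc v + 1.
  have k0 : 0 < k by rewrite ltr_wpDl ?normc_ge0.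
  have [r r0 rP] := Qd (e / k) (divr_gt0 e0 k0).
  exists (r / k) => [|h hr]; first by rewrite divr_gt0.
  have vh : normc (h%:C * v) <= k * `|h|.
    by rewrite normcM nc_real mulrC ler_wpM2r // lerDl.
  have /rP : normc (h%:C * v) < r.
    by apply: le_lt_trans vh _; rewrite mulrC -ltr_pdivlMr.
  have -> : p + t%:C * v + h%:C * v = p + (t + h)%:C * v by rewrite rmorphD /=; ring.
  have -> : d * (h%:C * v) = h%:C * (d * v) by ring.
  move=> H; apply: le_trans H _.
  have -> : e * `|h| = e / k * (k * `|h|) by field; rewrite gt_eqF.
  by rewrite ler_wpM2l // ltW // divr_gt0.
have ReR (h : R) (x : C) : cRe (h%:C * x) = cRe x * h.
  by case: x => a b /=; rewrite mul0r subr0 mulrC.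
have ImR (h : R) (x : C) : cIm (h%:C * x) = cIm x * h.
  by case: x => a b /=; rewrite mul0r addr0 mulrC.
split; apply: is_derive_of_eps => e /H [r r0 rP]; exists r => // h /rP; apply: le_trans.
  by rewrite -ReR -!ReB Re_le_nc.
by rewrite -ImR -!ImB Im_le_nc.
Qed.

Lemma is_rderivB F G t d d' : is_rderiv F t d -> is_rderiv G t d' -> is_rderiv (fun s => F s - G s) t (d - d').
Proof.
move=> [F1 F2] [G1 G2]; split.
  have -> : (fun s => cRe (F s - G s)) = (fun s => cRe (F s)) - (fun s => cRe (G s)).
    by apply/funext => s; rewrite ReB.
  by rewrite ReB; apply: is_deriveB.
have -> : (fun s => cIm (F s - G s)) = (fun s => cIm (F s)) - (fun s => cIm (G s)).
  by apply/funext => s; rewrite ImB.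
by rewrite ImB; apply: is_deriveB.
Qed.

Lemma mvt_real (f df : R -> R) (a b M : R) : a <= b ->
  (forall t, a <= t <= b -> is_derive t (1 : R) f (df t)) ->
  (forall t, a <= t <= b -> `|df t| <= M) -> `|f b - f a| <= M * (b - a).
Proof.
move=> ab fd dM.
have [| |c cab ->] := @MVT_segment R f df a b ab.
- by move=> x; rewrite in_itv /= => /andP[ax xb]; apply: fd; rewrite !ltW.
- apply: derivable_within_continuous => x; rewrite in_itv /= => xab.
  by have [] := fd x xab.
rewrite normrM (ger0_norm (x := b - a)) ?subr_ge0 // ler_wpM2r ?subr_ge0 //.
by apply: dM; move: cab; rewrite in_itv.
Qed.

(** The factor 2 comes from estimating real and imaginary parts separately; the
    values of constants are immaterial in what follows. *)
Lemma mvt_complex (F dF : R -> C) (a b M : R) : a <= b ->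
  (forall t, a <= t <= b -> is_rderiv F t (dF t)) ->
  (forall t, a <= t <= b -> normc (dF t) <= M) ->
  normc (F b - F a) <= 2 * M * (b - a).
Proof.
move=> ab Fd dM; apply: le_trans (nc_le_ReIm _) _; rewrite ReB ImB.
have -> : 2 * M * (b - a) = M * (b - a) + M * (b - a) by ring.
apply: lerD.
  apply: (@mvt_real (fun s => cRe (F s)) (fun s => cRe (dF s))) => // t tab.
    by have [] := Fd t tab.
  exact: le_trans (Re_le_nc _) (dM t tab).
apply: (@mvt_real (fun s => cIm (F s)) (fun s => cIm (dF s))) => // t tab.
  by have [] := Fd t tab.
exact: le_trans (Im_le_nc _) (dM t tab).
Qed.

(** Integrals along a line are represented by increments of a primitive: additivity
    is then an identity between sums, and the bound by the length of the path is
    the mean value inequality. *)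
Lemma complex_antiderivative (u : C -> C) (p v : C) (A : R) : holomorphic u ->
  exists F : R -> C, forall t, A < t -> is_rderiv F t (u (p + t%:C * v) * v).
Proof.
move=> hu.
have cuE (pr : C -> R) : (forall x y, pr (x - y) = pr x - pr y) ->
    (forall x, `|pr x| <= normc x) -> continuous (fun t : R => pr (u (p + t%:C * v) * v)).
  move=> prB prle t; apply/cvgrPdist_le => e e0.
  pose k := normc v + 1.
  have k0 : 0 < k by rewrite ltr_wpDl ?normc_ge0.
  have [r r0 rP] := is_cderiv_cont (holomorphic_cderiv (p + t%:C * v) hu) (divr_gt0 e0 k0).
  have rk : 0 < r / k by rewrite divr_gt0.
  near=> s.
  have st : `|s - t| < r / k by near: s; apply: cvgr_distC_lt => //; exact: cvg_id.
  have /rP : normc ((s - t)%:C * v) < r.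
    rewrite normcM nc_real; apply: (@le_lt_trans _ _ (`|s - t| * k)).
      by rewrite ler_wpM2l // lerDl.
    by rewrite -ltr_pdivlMr.
  have -> : p + t%:C * v + (s - t)%:C * v = p + s%:C * v by rewrite rmorphB /=; ring.
  move=> H; rewrite distrC -prB; apply: le_trans (prle _) _.
  rewrite -mulrBl normcM.
  have -> : e = e / k * k by field; rewrite gt_eqF.
  apply: ler_pM => //; rewrite ?normc_ge0 //.
  by rewrite lerDl.
have [U UP] := antiderivative A (cuE _ (@ReB R) (@Re_le_nc R)).
have [W WP] := antiderivative A (cuE _ (@ImB R) (@Im_le_nc R)).
by exists (fun t => U t +i* W t) => t At; split; [exact: UP|exact: WP].
Unshelve. all: by end_near. Qed.

End RealLine.

(** * Goursat's theorem for rectangles *)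

Section Goursat.
Variable R : realType.
Local Notation C := R[i].

Lemma nested_intervals (x w : nat -> R) :
  (forall k, 0 <= w k) -> (forall k, x k <= x k.+1) ->
  (forall k, x k.+1 + w k.+1 <= x k + w k) ->
  exists X, forall k, x k <= X <= x k + w k.
Proof.
move=> w0 xle wle.
have xmono : {homo x : i j / (i <= j)%N >-> i <= j}.
  by apply: homo_leq => // ? ? ?; apply: le_trans.
have wmono : {homo (fun k => x k + w k) : i j / (i <= j)%N >-> j <= i}.
  by apply: homo_leq => // a b c ba cb; apply: le_trans cb ba.
have ubk k : ubound (range x) (x k + w k).
  move=> _ [j _ <-]; have [jk|kj] := leqP j k.
    by apply: le_trans (xmono _ _ jk) _; rewrite lerDl.
  by apply: le_trans (wmono _ _ (ltnW kj)); rewrite lerDl.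
exists (sup (range x)) => k; apply/andP; split.
  by apply: ub_le_sup; [exists (x 0 + w 0); exact: ubk|exists k].
by apply: ge_sup; [exists (x 0); exists 0|exact: ubk].
Qed.

(** The integral of u along the boundary of a rectangle, when H y and V x are
    primitives of u along the horizontal line at height y and the vertical line
    at abscissa x. *)
Definition rect_int (H V : R -> R -> C) (x0 x1 y0 y1 : R) : C :=
  (H y0 x1 - H y0 x0) + (V x1 y1 - V x1 y0)
  - (H y1 x1 - H y1 x0) - (V x0 y1 - V x0 y0).

(** Increments along inner edges cancel, so the integral is the sum of the integrals
    over the four quarters. *)
Lemma rect_int_quarter H V (x y a b : R) : exists p : R * R,
  [/\ p.1 = x \/ p.1 = x + a / 2, p.2 = y \/ p.2 = y + b / 2 &
   normc (rect_int H V x (x + a) y (y + b)) <=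
   4 * normc (rect_int H V p.1 (p.1 + a / 2) p.2 (p.2 + b / 2))].
Proof.
set E := normc _.
pose q1 := (x, y); pose q2 := (x + a / 2, y).
pose q3 := (x, y + b / 2); pose q4 := (x + a / 2, y + b / 2).
pose L (p : R * R) := rect_int H V p.1 (p.1 + a / 2) p.2 (p.2 + b / 2).
have LE : rect_int H V x (x + a) y (y + b) = L q1 + L q2 + L q3 + L q4.
  rewrite /L /= /rect_int.
  have -> : x + a / 2 + a / 2 = x + a by field.
  have -> : y + b / 2 + b / 2 = y + b by field.
  ring.
have [h1|h1] := leP E (4 * normc (L q1)); first by exists q1; split; [left|left|].
have [h2|h2] := leP E (4 * normc (L q2)); first by exists q2; split; [right|left|].
have [h3|h3] := leP E (4 * normc (L q3)); first by exists q3; split; [left|right|].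
have [h4|h4] := leP E (4 * normc (L q4)); first by exists q4; split; [right|right|].
have : E <= normc (L q1) + normc (L q2) + normc (L q3) + normc (L q4).
  rewrite /E LE; apply: le_trans (ncD _ _) _; rewrite lerD2r.
  by apply: le_trans (ncD _ _) _; rewrite lerD2r; exact: ncD.
lra.
Qed.

Variables (u : C -> C) (A : R) (H V : R -> R -> C).
Hypothesis hu : holomorphic u.
Hypothesis HP : forall y t, A < t -> is_rderiv (H y) t (u (t +i* y)).
Hypothesis VP : forall x t, A < t -> is_rderiv (V x) t (u (x +i* t) * 'i).

(** The affine approximation of u at X + iY has a holomorphic primitive Q, whose
    increments around the rectangle add up to zero. Subtracting them leaves
    increments of primitives of the remainder, which is at most e * (w + h). *)
Lemma rect_int_small (X Y x y w h del e : R) :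
  A < x -> A < y -> 0 <= e -> 0 <= w -> 0 <= h ->
  x <= X <= x + w -> y <= Y <= y + h -> w + h < del ->
  (forall k, normc k < del -> normc (u (X +i* Y + k) - u (X +i* Y)
      - cderiv u (X +i* Y) * k) <= e * normc k) ->
  normc (rect_int H V x (x + w) y (y + h)) <= 4 * e * (w + h) ^+ 2.
Proof.
move=> Ax Ay e0 w0 h0 Xx Yy whd uP.
pose p := X +i* Y; pose d := cderiv u p; pose al := u p.
pose Q z := al * z + d * ((z - p) * (z - p)) / 2.
have QD z : is_cderiv Q z (al + d * (z - p)).
  have Dz : is_cderiv (fun z => z - p) z 1 by have := is_cderivD (is_cderiv_id z) (is_cderiv_cst (- p) z); rewrite addr0.
  have := is_cderivD (is_cderivM (is_cderiv_cst al z) (is_cderiv_id z))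
     (is_cderivM (is_cderivM (is_cderiv_cst d z) (is_cderivM Dz Dz)) (is_cderiv_cst 2^-1 z)).
  have -> : al + d * (z - p) = 0 * id z + al * 1 +
    ((0 * ((z - p) * (z - p)) + d * (1 * (z - p) + (z - p) * 1)) * 2^-1 +
     d * ((z - p) * (z - p)) * 0) by rewrite /=; field.
  by [].
have hE (s t : R) : (0 +i* t) + s%:C * 1 = s +i* t by simpc.
have vE (s t : R) : s%:C + t%:C * 'i = s +i* t by simpc.
have Qh s t : is_rderiv (fun s => Q (s +i* t)) s (al + d * ((s +i* t) - p)).
  have := @is_rderiv_line R Q (0 +i* t) 1 _ s (QD _).
  by rewrite mulr1 hE; congr is_rderiv; apply/funext => r; rewrite hE.
have Qv s t : is_rderiv (fun t => Q (s +i* t)) t ((al + d * ((s +i* t) - p)) * 'i).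
  have := @is_rderiv_line R Q (s%:C) 'i _ t (QD _).
  by rewrite vE; congr is_rderiv; apply/funext => r; rewrite vE.
have dist s t : x <= s <= x + w -> y <= t <= y + h -> normc ((s +i* t) - p) <= w + h.
  move=> sx ty; apply: le_trans (nc_le_ReIm _) _; rewrite ReB ImB /=.
  by apply: lerD; rewrite ler_norml; apply/andP; split; lra.
have rem s t : x <= s <= x + w -> y <= t <= y + h ->
    normc (u (s +i* t) - (al + d * ((s +i* t) - p))) <= e * (w + h).
  move=> sx ty; have le1 := dist s t sx ty.
  have := uP ((s +i* t) - p) (le_lt_trans le1 whd).
  rewrite subrKC opprD addrA => le2; apply: le_trans le2 _.
  by rewrite ler_wpM2l.
have xw : x <= x + w by rewrite lerDl.
have yh : y <= y + h by rewrite lerDl.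
have hb t : y <= t <= y + h -> normc ((H t (x + w) - Q ((x + w) +i* t)) - (H t x - Q (x +i* t))) <=
    2 * (e * (w + h)) * w.
  move=> ty; have -> : 2 * (e * (w + h)) * w = 2 * (e * (w + h)) * (x + w - x) by ring.
  apply: (@mvt_complex R (fun s => H t s - Q (s +i* t))
    (fun s => u (s +i* t) - (al + d * ((s +i* t) - p)))) => // s sx.
    by apply: is_rderivB (Qh _ _); apply: HP; lra.
  exact: rem.
have vb s : x <= s <= x + w -> normc ((V s (y + h) - Q (s +i* (y + h))) - (V s y - Q (s +i* y))) <=
    2 * (e * (w + h)) * h.
  move=> sx; have -> : 2 * (e * (w + h)) * h = 2 * (e * (w + h)) * (y + h - y) by ring.
  apply: (@mvt_complex R (fun t => V s t - Q (s +i* t))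
    (fun t => u (s +i* t) * 'i - (al + d * ((s +i* t) - p)) * 'i)) => // t ty.
    by apply: is_rderivB (Qv _ _); apply: VP; lra.
  have i1 : normc ('i : C) = 1 by rewrite /= expr0n expr1n add0r sqrtr1.
  by rewrite -mulrBl normcM i1 mulr1; exact: rem.
have -> : rect_int H V x (x + w) y (y + h) =
  ((H y (x + w) - Q ((x + w) +i* y)) - (H y x - Q (x +i* y))) +
  ((V (x + w) (y + h) - Q ((x + w) +i* (y + h))) - (V (x + w) y - Q ((x + w) +i* y))) -
  ((H (y + h) (x + w) - Q ((x + w) +i* (y + h))) - (H (y + h) x - Q (x +i* (y + h)))) -
  ((V x (y + h) - Q (x +i* (y + h))) - (V x y - Q (x +i* y))).
  by rewrite /rect_int; ring.
have xx : x <= x <= x + w by rewrite lexx.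
have yy : y <= y <= y + h by rewrite lexx.
have xx' : x <= x + w <= x + w by rewrite lexx xw.
have yy' : y <= y + h <= y + h by rewrite lexx yh.
have := lerD (lerD (lerD (hb y yy) (vb (x + w) xx')) (hb (y + h) yy')) (vb x xx).
move=> le1; apply: (@le_trans _ _ (2 * (e * (w + h)) * w + 2 * (e * (w + h)) * h +
  2 * (e * (w + h)) * w + 2 * (e * (w + h)) * h)); last first.
  by rewrite le_eqVlt; apply/orP; left; apply/eqP; ring.
apply: le_trans le1.
apply: le_trans (ncB _ _) _; rewrite lerD2r.
apply: le_trans (ncB _ _) _; rewrite lerD2r.
exact: ncD.
Qed.

(** Quartering again and again, the integral over the k-th rectangle is at least 4^-k
    times the original one, whereas differentiability at the limit point makes it
    o(4^-k). *)
Lemma goursat (x y a b : R) : A < x -> A < y -> 0 <= a -> 0 <= b ->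
  rect_int H V x (x + a) y (y + b) = 0.
Proof.
move=> Ax Ay a0 b0.
pose T := ((R * R) * (R * R))%type.
have [step stepP] := choice (fun t : T =>
  rect_int_quarter H V t.1.1 t.1.2 t.2.1 t.2.2).
pose nxt (t : T) : T := (step t, (t.2.1 / 2, t.2.2 / 2)).
pose t0 : T := ((x, y), (a, b)).
pose t k := iter k nxt t0.
have tS k : t k.+1 = nxt (t k) by [].
have w1 k : (t k).2 = (a / 2 ^+ k, b / 2 ^+ k).
  elim: k => [|k IH]; first by rewrite expr0 !divr1.
  by rewrite tS /= IH /= exprS; congr pair; field; rewrite expf_neq0.
have p2 k : (0 : R) < 2 ^+ k by rewrite exprn_gt0.
have wa k : 0 <= (t k).2.1 by rewrite w1 /= divr_ge0 // ltW.
have wb k : 0 <= (t k).2.2 by rewrite w1 /= divr_ge0 // ltW.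
have [X XP] : exists X, forall k, (t k).1.1 <= X <= (t k).1.1 + (t k).2.1.
  apply: (nested_intervals (x := fun k => (t k).1.1) (w := fun k => (t k).2.1)) => k //.
    by have [[] + _ _] := stepP (t k); rewrite tS /= => ->; have := wa k; lra.
  by have [[] + _ _] := stepP (t k); rewrite tS /= => ->; have := wa k; lra.
have [Y YP] : exists X, forall k, (t k).1.2 <= X <= (t k).1.2 + (t k).2.2.
  apply: (nested_intervals (x := fun k => (t k).1.2) (w := fun k => (t k).2.2)) => k //.
    by have [_ [] + _] := stepP (t k); rewrite tS /= => ->; have := wb k; lra.
  by have [_ [] + _] := stepP (t k); rewrite tS /= => ->; have := wb k; lra.
have tx k : A < (t k).1.1.
  elim: k => [//|k IH]; apply: (lt_le_trans IH).
  by have [[] + _ _] := stepP (t k); rewrite tS /= => ->; have := wa k; lra.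
have ty k : A < (t k).1.2.
  elim: k => [//|k IH]; apply: (lt_le_trans IH).
  by have [_ [] + _] := stepP (t k); rewrite tS /= => ->; have := wb k; lra.
pose L k := normc (rect_int H V (t k).1.1 ((t k).1.1 + (t k).2.1) (t k).1.2 ((t k).1.2 + (t k).2.2)).
have LE k : L 0 <= 4 ^+ k * L k.
  elim: k => [|k IH]; first by rewrite expr0 mul1r.
  apply: le_trans IH _; have [_ _ +] := stepP (t k) => H1.
  by rewrite exprSr -mulrA ler_wpM2l ?exprn_ge0.
apply: nc_eq0 => e e0; rewrite -/(L 0).
pose c := 4 * (a + b + 1) ^+ 2.
have ab1 : 0 < a + b + 1 by lra.
have c0 : 0 < c by rewrite mulr_gt0 // exprn_gt0.
have [del del0 delP] := holomorphic_cderiv (X +i* Y) hu (divr_gt0 e0 c0).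
have [k kP] : exists k, (a + b) / 2 ^+ k < del.
  exists (Num.bound ((a + b) / del)).
  rewrite ltr_pdivrMr // mulrC -ltr_pdivrMr //.
  apply: lt_trans (archi_boundP _) _; first by rewrite divr_ge0 ?addr_ge0 // ltW.
  by rewrite -natrX ltr_nat ltn_expl.
apply: le_trans (LE k) _.
have wh : (t k).2.1 + (t k).2.2 = (a + b) / 2 ^+ k by rewrite w1 /=; field; rewrite gt_eqF.
have := @rect_int_small X Y _ _ _ _ del (e / c) (tx k) (ty k) (ltW (divr_gt0 e0 c0)) (wa k) (wb k)
  (XP k) (YP k).
rewrite wh => /(_ kP delP) le1.
apply: le_trans (ler_wpM2l _ le1) _; first by rewrite exprn_ge0.
have -> : 4 ^+ k * (4 * (e / c) * ((a + b) / 2 ^+ k) ^+ 2) = (e / c) * (4 * (a + b) ^+ 2).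
  have -> : (4 : R) ^+ k = (2 ^+ k) ^+ 2 by rewrite -exprM mulnC exprM; congr (_ ^+ _); ring.
  by field; rewrite !gt_eqF.
rewrite mulrAC ler_pdivrMr // ler_pM2l // /c ler_pM2l // lerXn2r ?nnegrE ?addr_ge0 //.
by rewrite lerDl.
Qed.

End Goursat.

(** * The complex exponential *)

Section ComplexExp.
Variable R : realType.
Local Notation C := R[i].

Definition cexp (w : C) : C :=
  (expR (cRe w) * cos (cIm w)) +i* (expR (cRe w) * sin (cIm w)).

Lemma eps_of_is_derive (f : R -> R) (x l : R) : is_derive x (1 : R) f l ->
  forall e, 0 < e -> exists2 del : R, 0 < del &
     forall h, `|h| < del -> `|f (x + h) - f x - l * h| <= e * `|h|.
Proof.
move=> [df fl] e e0.
have cl : (fun h => h^-1 *: (f (h *: 1 + x) - f x)) @ 0^' --> (l : R) by rewrite -fl.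
have /cvgrPdist_le /(_ e e0) := cl.
move=> /nbhs_ballP [del /= del0 dP]; exists del => // h hd.
have [->|h0] := eqVneq h 0; first by rewrite addr0 subrr mulr0 subr0 normr0 mulr0.
have /= := dP h; rewrite /ball /= sub0r normrN => /(_ hd h0).
rewrite /GRing.scale /= mulr1 (addrC h x).
have -> : l - h^-1 * (f (x + h) - f x) = - (h^-1 * (f (x + h) - f x - l * h)) by field.
by rewrite normrN normrM normfV ler_pdivrMl ?normr_gt0 // (mulrC _ e).
Qed.

Lemma cexpD v w : cexp (v + w) = cexp v * cexp w.
Proof.
case: v => a b; case: w => c d; rewrite /cexp /= expRD cosD sinD.
by apply/eqP; rewrite eq_complex /=; apply/andP; split; apply/eqP; ring.
Qed.

Lemma cexp0 : cexp 0 = 1.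
Proof. by rewrite /cexp /= expR0 cos0 sin0 mulr0 mulr1. Qed.

Lemma cexp_neq0 w : cexp w != 0.
Proof.
apply/eqP => w0; have /eqP := oner_neq0 C; apply.
by have := cexpD w (- w); rewrite subrr cexp0 w0 mul0r.
Qed.

Lemma cexpN w : cexp (- w) = (cexp w)^-1.
Proof.
by apply: (mulfI (cexp_neq0 w)); rewrite -cexpD subrr cexp0 divff // cexp_neq0.
Qed.

Lemma nc_cexp w : normc (cexp w) = expR (cRe w).
Proof.
case: w => a b; rewrite /cexp /= !exprMn -mulrDr cos2Dsin2 mulr1 sqrtr_sqr.
by rewrite ger0_norm // expR_ge0.
Qed.

Lemma cexp_period (x : R) : cexp (x +i* (2 * pi)) = cexp (x +i* 0).
Proof. by rewrite /cexp /= -(add0r (2 * pi)) mulr_natl cosD2pi sinD2pi. Qed.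

Lemma cexp_is_cderiv0 : is_cderiv cexp 0 1.
Proof.
(* Each of the six error terms below is at most k * normc h. *)
move=> e e0; pose k := Num.min (e / 6) 1.
have k0 : 0 < k by rewrite lt_min ltr01 divr_gt0.
have k1 : k <= 1 by rewrite ge_min lexx orbT.
have ke : k * 6 <= e by rewrite -ler_pdivlMr // ge_min lexx.
have [r r0 rP] := eps_of_is_derive (is_derive_expR (0 : R)) k0.
have [s s0 sP] := eps_of_is_derive (is_derive_sin (0 : R)) k0.
have [c c0 cP] := eps_of_is_derive (is_derive_cos (0 : R)) k0.
exists (Num.min (Num.min r s) (Num.min c (k / 2))).
  by rewrite !lt_min r0 s0 c0 divr_gt0.
move=> h; have xh := Re_le_nc h; have yh := Im_le_nc h; rewrite !lt_min.
move=> /andP[/andP[hr hs] /andP[hc hk]].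
have := rP _ (le_lt_trans xh hr); have := sP _ (le_lt_trans yh hs).
have := cP _ (le_lt_trans yh hc).
move: xh yh; set x := cRe h; set y := cIm h => xh yh.
rewrite !add0r expR0 sin0 cos0 oppr0 mul0r !mul1r !subr0 ?addr0 => C1 S1 E1.
have n0 := normc_ge0 h.
rewrite cexp0; apply: le_trans (nc_le_ReIm _) _.
rewrite !ReB !ImB /cexp /= -/x -/y subr0.
have x2 : `|x| <= k / 2 by apply: le_trans xh (ltW hk).
have E2 : `|expR x - 1| <= k.
  have -> : expR x - 1 = (expR x - 1 - x) + x by ring.
  apply: le_trans (ler_normD _ _) _.
  apply: le_trans (lerD E1 x2) _.
  have : k * `|x| <= 1 * (k / 2) by rewrite ler_pM // ltW.
  lra.
have E3 : `|expR x| <= 2.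
  have -> : expR x = (expR x - 1) + 1 by ring.
  by apply: le_trans (ler_normD _ _) _; rewrite normr1; lra.
have x1 : `|1 + x| <= 2.
  by apply: le_trans (ler_normD _ _) _; rewrite normr1; lra.
have -> : expR x * cos y - 1 - x = (expR x - 1 - x) * cos y + (1 + x) * (cos y - 1) by ring.
have -> : expR x * sin y - y = expR x * (sin y - y) + (expR x - 1) * y by ring.
have cy : `|cos y| <= 1 by rewrite ler_norml cos_geN1 cos_le1.
have B1 : `|(expR x - 1 - x) * cos y| <= k * normc h * 1.
  rewrite normrM ler_pM //; apply: le_trans E1 _; by rewrite ler_wpM2l // ltW.
have B2 : `|(1 + x) * (cos y - 1)| <= 2 * (k * normc h).
  rewrite normrM ler_pM //; apply: le_trans C1 _; by rewrite ler_wpM2l // ltW.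
have B3 : `|expR x * (sin y - y)| <= 2 * (k * normc h).
  rewrite normrM ler_pM //; apply: le_trans S1 _; by rewrite ler_wpM2l // ltW.
have B4 : `|(expR x - 1) * y| <= k * normc h.
  by rewrite normrM ler_pM.
apply: (@le_trans _ _ (k * 6 * normc h)); last by rewrite ler_wpM2r.
apply: le_trans (lerD (ler_normD _ _) (ler_normD _ _)) _.
have := lerD (lerD B1 B2) (lerD B3 B4).
by move=> BB; apply: le_trans BB _; rewrite le_eqVlt; apply/orP; left; apply/eqP; ring.
Qed.

Lemma cexp_is_cderiv w : is_cderiv cexp w (cexp w).
Proof.
have D0 : is_cderiv (fun z => z - w) w 1.
  by have := is_cderivD (is_cderiv_id w) (is_cderiv_cst (- w) w); rewrite addr0.
have D1 : is_cderiv cexp (w - w) 1 by rewrite subrr; exact: cexp_is_cderiv0.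
have := is_cderivM (is_cderiv_cst (cexp w) w) (is_cderiv_comp D0 D1).
rewrite mul0r add0r !mulr1; congr is_cderiv; apply/funext => z.
by rewrite -cexpD subrKC.
Qed.

End ComplexExp.

(** * Cauchy's estimate for the derivative *)

Section Cauchy.
Variable R : realType.
Local Notation C := R[i].

(** With z = cexp w, circles around 0 become vertical segments of length 2 pi, and
    u(w) = (g(z) - g(0)) / z is entire and has period 2 pi i. Goursat's theorem for
    the rectangle between two such segments, whose horizontal sides cancel by
    periodicity, says that the integral of u over the circle does not depend on the
    radius. For radius r it is at most 2 * (2 M / r) * 2 pi; for small radii it is
    close to 2 pi i g'(0). *)
Lemma cauchy_estimate0 (g : C -> C) (r M : R) : holomorphic g -> 0 < r ->
  (forall z, normc z <= r -> normc (g z) <= M) ->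
  normc (cderiv g 0) <= 4 * M / r.
Proof.
move=> hg r0 gM; pose d := cderiv g 0.
have pi2 : (0 : R) < 2 * pi by rewrite mulr_gt0 // pi_gt0.
apply/ler_addgt0Pr => e e0.
have [del del0 delP] := holomorphic_cderiv 0 hg (halfr_gt0 e0).
(* The circle of radius exp a lies where the difference quotient is within e / 2 of d. *)
pose b := ln r; pose a := Num.min b (ln (del / 2)).
have ab : a <= b by rewrite ge_min lexx.
have ea : expR a < del.
  apply: (@le_lt_trans _ _ (del / 2)); last by rewrite ltr_pdivrMr // ltr_pMr ?ltr1n.
  rewrite -[leRHS]lnK ?posrE ?divr_gt0 // ler_expR.
  by rewrite ge_min lexx orbT.
have eb : expR b = r by rewrite lnK.
(* All points of the rectangle have coordinates larger than A, where primitives exist. *)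
pose A := Num.min a 0 - 1.
have [ma m0] : Num.min a 0 <= a /\ Num.min a 0 <= 0 by split; rewrite ge_min lexx ?orbT.
have Aa : A < a by rewrite /A; lra.
have A0 : A < 0 by rewrite /A; lra.
pose u w := (g (cexp w) - g 0) * cexp (- w).
have hu : holomorphic u.
  move=> w; have D1 := is_cderiv_comp (cexp_is_cderiv w) (holomorphic_cderiv (cexp w) hg).
  have DN : is_cderiv (fun z => - z) w (-1).
    have := is_cderivM (is_cderiv_cst (-1) w) (is_cderiv_id w); rewrite mul0r add0r mulr1.
    by congr is_cderiv; apply/funext => z; rewrite mulN1r.
  have D2 := is_cderivM (is_cderivD D1 (is_cderiv_cst (- g 0) w)) (is_cderiv_comp DN (cexp_is_cderiv (- w))).
  by eexists; exact: D2.
have [H HP] := choice (fun y : R => complex_antiderivative (0 +i* y) 1 A hu).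
have [V VP] := choice (fun x : R => complex_antiderivative (x%:C) 'i A hu).
have hE (s t : R) : (0 +i* t) + s%:C * 1 = s +i* t by simpc.
have vE (s t : R) : s%:C + t%:C * 'i = s +i* t by simpc.
have {}HP y t : A < t -> is_rderiv (H y) t (u (t +i* y)).
  by move=> /(HP y); rewrite hE mulr1.
have {}VP x t : A < t -> is_rderiv (V x) t (u (x +i* t) * 'i).
  by move=> /(VP x); rewrite vE.
have ba0 : 0 <= b - a by rewrite subr_ge0.
have := goursat hu HP VP Aa A0 ba0 (ltW pi2).
rewrite /rect_int subrKC add0r => G.
have per t : u (t +i* (2 * pi)) = u (t +i* 0).
  by rewrite /u !cexpN !cexp_period.
have HH : (H 0 b - H (2 * pi) b) - (H 0 a - H (2 * pi) a) = 0.
  apply: nc_eq0 => eps eps0.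
  apply: (@le_trans _ _ (2 * 0 * (b - a))); last by rewrite mulr0 mul0r ltW.
  apply: (@mvt_complex R (fun s => H 0 s - H (2 * pi) s)
    (fun s => u (s +i* 0) - u (s +i* (2 * pi)))) => // s /andP[sa sb].
    by apply: is_rderivB; apply: HP; apply: lt_le_trans sa.
  by rewrite per subrr normc0.
have VV : V b (2 * pi) - V b 0 = V a (2 * pi) - V a 0.
  have E (p q s t v w x y : C) : p - q + (v - w) - (s - t) - (x - y) = 0 ->
      (p - s) - (q - t) = 0 -> v - w = x - y.
    move=> E1 E2; have -> : v - w = (x - y) + (p - q + (v - w) - (s - t) - (x - y)) -
       ((p - s) - (q - t)) by ring.
    by rewrite E1 E2 addr0 subr0.
  exact: E G HH.
have i1 : normc ('i : C) = 1 by rewrite /= expr0n expr1n add0r sqrtr1.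
have M0 : 0 <= M by apply: le_trans (gM 0 _); rewrite ?normc_ge0 // normc0 ltW.
have uE w : normc (u w) = normc (g (cexp w) - g 0) / expR (cRe w).
  by rewrite /u normcM cexpN normcV nc_cexp.
have B1 : normc (V b (2 * pi) - V b 0) <= 2 * (2 * M / r) * (2 * pi).
  rewrite -[2 * pi in leRHS]subr0.
  apply: (@mvt_complex R (V b) (fun t => u (b +i* t) * 'i)) => [|t /andP[t0 _]|t _].
  - exact: ltW.
  - by apply: VP; apply: lt_le_trans A0 t0.
  - rewrite normcM i1 mulr1 uE /= eb ler_pdivrMr // divfK ?gt_eqF //.
    apply: le_trans (ncB _ _) _; rewrite mulr_natl mulr2n lerD //.
      by apply: gM; rewrite nc_cexp /= eb.
    by apply: gM; rewrite normc0 ltW.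
have B2 : normc (V a (2 * pi) - d * (0 + (2 * pi)%:C * 'i) - (V a 0 - d * (0 + (0%:C) * 'i))) <=
    2 * (e / 2) * (2 * pi).
  rewrite -[X in _ <= _ * X]subr0.
  apply: (@mvt_complex R (fun t => V a t - d * (0 + t%:C * 'i))
     (fun t => u (a +i* t) * 'i - d * 'i)) => [|t /andP[t0 _]|t _].
  - exact: ltW.
  - apply: is_rderivB; first by apply: VP; apply: lt_le_trans A0 t0.
    apply: (@is_rderiv_line R (fun z => d * z)).
    by have := is_cderivM (is_cderiv_cst d (0 + t%:C * 'i)) (is_cderiv_id (0 + t%:C * 'i)); rewrite mul0r !add0r mulr1.
  - rewrite -mulrBl normcM i1 mulr1.
    have := delP (cexp (a +i* t)); rewrite nc_cexp /= => /(_ ea).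
    rewrite add0r -/d => H1.
    have -> : u (a +i* t) - d = (g (cexp (a +i* t)) - g 0 - d * cexp (a +i* t)) / cexp (a +i* t).
      by rewrite /u cexpN; field; exact: cexp_neq0.
    by rewrite normcM normcV nc_cexp /= ler_pdivrMr // expR_gt0.
have : normc (d * ((2 * pi)%:C * 'i)) <= 2 * (2 * M / r) * (2 * pi) + 2 * (e / 2) * (2 * pi).
  have -> : d * ((2 * pi)%:C * 'i) = (V b (2 * pi) - V b 0) -
     (V a (2 * pi) - d * (0 + (2 * pi)%:C * 'i) - (V a 0 - d * (0 + (0%:C) * 'i))).
    rewrite VV; ring.
  by apply: le_trans (ncB _ _) _; apply: lerD.
rewrite !normcM i1 mulr1 nc_real gtr0_norm // -mulrDl ler_pM2r //.
move=> le1; apply: le_trans le1 _; rewrite le_eqVlt; apply/orP; left; apply/eqP.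
by field; rewrite gt_eqF.
Qed.

Lemma holomorphic_shift (g : C -> C) a : holomorphic g -> holomorphic (fun z => g (z + a)).
Proof. by move=> hg z; exists (cderiv g (z + a)); apply: is_cderiv_shift; exact: holomorphic_cderiv. Qed.

Lemma cauchy_estimate (g : C -> C) (a : C) (r M : R) : holomorphic g -> 0 < r ->
  (forall z, normc (z - a) <= r -> normc (g z) <= M) ->
  normc (cderiv g a) <= 4 * M / r.
Proof.
move=> hg r0 gM.
have -> : cderiv g a = cderiv (fun z => g (z + a)) 0.
  apply/esym/cderivE/is_cderiv_shift; rewrite add0r; exact: holomorphic_cderiv.
apply: cauchy_estimate0 => //; first exact: holomorphic_shift.
by move=> z zr; apply: gM; rewrite addrK.
Qed.

End Cauchy.

(** * Second order remainders and limits of holomorphic functions *)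

Section UniformLimits.
Variable R : realType.
Local Notation C := R[i].

Definition climit (x : nat -> C) (l : C) := forall e : R, 0 < e ->
  exists N, forall n, (N <= n)%N -> normc (x n - l) <= e.

Lemma climit_uniq x l l' : climit x l -> climit x l' -> l = l'.
Proof.
move=> xl xl'; apply/eqP; rewrite -subr_eq0; apply/eqP/nc_eq0 => e e0.
have [N NP] := xl _ (halfr_gt0 e0); have [N' NP'] := xl' _ (halfr_gt0 e0).
pose k := maxn N N'.
have -> : l - l' = (x k - l') - (x k - l) by ring.
apply: le_trans (ncB _ _) _; rewrite [e]splitr.
by apply: lerD; [apply: NP'|apply: NP]; rewrite leq_max leqnn ?orbT.
Qed.

Lemma climit_cst c : climit (fun=> c) c.
Proof. by move=> e e0; exists 0 => n _; rewrite subrr normc0 ltW. Qed.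

Lemma climitD x y l l' : climit x l -> climit y l' -> climit (fun n => x n + y n) (l + l').
Proof.
move=> xl xl' e e0.
have [N NP] := xl _ (halfr_gt0 e0); have [N' NP'] := xl' _ (halfr_gt0 e0).
exists (maxn N N') => n; rewrite geq_max => /andP[/NP h1 /NP' h2].
have -> : x n + y n - (l + l') = (x n - l) + (y n - l') by ring.
by apply: le_trans (ncD _ _) _; rewrite [e]splitr lerD.
Qed.

Lemma climitZ x l c : climit x l -> climit (fun n => c * x n) (c * l).
Proof.
move=> xl e e0; have c0 : 0 < normc c + 1 by rewrite ltr_wpDl ?normc_ge0.
have [N NP] := xl _ (divr_gt0 e0 c0).
exists N => n /NP h; rewrite -mulrBr normcM.
apply: (@le_trans _ _ ((normc c + 1) * (e / (normc c + 1)))).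
  by apply: ler_pM; rewrite ?normc_ge0 // lerDl.
by rewrite mulrC divfK ?gt_eqF.
Qed.

Lemma climitB x y l l' : climit x l -> climit y l' -> climit (fun n => x n - y n) (l - l').
Proof.
move=> xl yl; have := climitD xl (climitZ (-1) yl).
rewrite mulN1r; congr climit; apply/funext => n; by rewrite mulN1r.
Qed.

Lemma climit_le x l M : (exists N, forall n, (N <= n)%N -> normc (x n) <= M) ->
  climit x l -> normc l <= M.
Proof.
move=> [N NP] xl; apply/ler_addgt0Pr => e /xl [N' NP'].
pose k := maxn N N'.
have -> : l = x k - (x k - l) by ring.
by apply: le_trans (ncB _ _) _; apply: lerD; [apply: NP|apply: NP'];
  rewrite leq_max leqnn ?orbT.
Qed.

Lemma climit_eventually (x y : nat -> C) l N : (forall n, (N <= n)%N -> x n = y n) ->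
  climit x l -> climit y l.
Proof.
move=> xy xl e /xl [N' NP]; exists (maxn N N') => n.
by rewrite geq_max => /andP[/xy <- /NP].
Qed.

(** A rate of convergence, the form in which most limits below are obtained. *)
Lemma climit_bound (x : nat -> C) l (c : R) :
  (forall n, normc (x n - l) <= c / n.+1%:R) -> climit x l.
Proof.
move=> xc e e0.
have c0 : 0 <= c by have := le_trans (normc_ge0 _) (xc 0); rewrite divr1.
exists (Num.bound (c / e)) => n Nn; apply: le_trans (xc n) _.
rewrite ler_pdivrMr // mulrC -ler_pdivrMr //.
apply: ltW; apply: lt_le_trans (archi_boundP _) _; first by rewrite divr_ge0 // ltW.
by rewrite ler_nat (leq_trans Nn).
Qed.

Lemma climit_cauchy (x : nat -> C) :
  (forall e : R, 0 < e -> exists N, forall m n, (N <= m)%N -> (N <= n)%N ->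
     normc (x m - x n) <= e) -> exists l, climit x l.
Proof.
move=> xc.
have cv (pr : C -> R) : (forall x y, pr (x - y) = pr x - pr y) ->
    (forall x, `|pr x| <= normc x) ->
    exists l : R, forall e, 0 < e -> exists N, forall n, (N <= n)%N -> `|pr (x n) - l| <= e.
  move=> prB prle.
  have cx : cvgn (fun n => pr (x n)).
    apply/cauchy_cvgP/cauchy_ballP => e e0.
    have [N NP] := xc _ (halfr_gt0 e0).
    pose B := [set y | exists2 n, (N <= n)%N & y = pr (x n)].
    exists (B, B); first by split; exists N => // n Nn; exists n.
    move=> [_ _] /= [[m Nm ->] [n Nn ->]]; rewrite /ball /= -prB.
    apply: le_lt_trans (prle _) _; apply: le_lt_trans (NP m n Nm Nn) _.
    by rewrite ltr_pdivrMr // ltr_pMr ?ltr1n.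
  exists (limn (fun n => pr (x n))) => e e0.
  have /cvgrPdist_le /(_ e e0) [N _ NP] := cx.
  by exists N => n Nn; rewrite distrC; apply: NP.
have [a aP] := cv _ (@ReB R) (@Re_le_nc R).
have [b bP] := cv _ (@ImB R) (@Im_le_nc R).
exists (a +i* b) => e e0.
have [N NP] := aP _ (halfr_gt0 e0); have [N' NP'] := bP _ (halfr_gt0 e0).
exists (maxn N N') => n; rewrite geq_max => /andP[/NP h1 /NP' h2].
apply: le_trans (nc_le_ReIm _) _; rewrite ReB ImB [e]splitr.
exact: lerD.
Qed.

Lemma holomorphic_increment (g : C -> C) (a t : C) (D : R) : holomorphic g ->
  (forall s : R, 0 <= s <= 1 -> normc (cderiv g (a + s%:C * t)) <= D) ->
  normc (g (a + t) - g a) <= 2 * D * normc t.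
Proof.
move=> hg gD.
have := @mvt_complex R (fun s => g (a + s%:C * t)) (fun s => cderiv g (a + s%:C * t) * t)
  0 1 (D * normc t) ler01.
rewrite mul1r mul0r addr0 subr0 mulr1 mulrA; apply.
  by move=> s _; apply: is_rderiv_line; exact: holomorphic_cderiv.
by move=> s s1; rewrite normcM ler_wpM2r ?normc_ge0 // gD.
Qed.

Lemma holomorphic_comb (g h : C -> C) (c d : C) : holomorphic g -> holomorphic h ->
  holomorphic (fun z => c * g z + d * h z) /\
  forall z, cderiv (fun z => c * g z + d * h z) z = c * cderiv g z + d * cderiv h z.
Proof.
move=> hg hh.
have D z : is_cderiv (fun z => c * g z + d * h z) z (c * cderiv g z + d * cderiv h z).
  have := is_cderivD (is_cderivM (is_cderiv_cst c z) (holomorphic_cderiv z hg)) (is_cderivM (is_cderiv_cst d z) (holomorphic_cderiv z hh)).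
  by rewrite !mul0r !add0r.
by split => z; [eexists; exact: D|exact/cderivE/D].
Qed.

Lemma cderiv_shift (g : C -> C) s z : holomorphic g -> cderiv (fun x => g (x + s)) z = cderiv g (z + s).
Proof. by move=> hg; apply/cderivE/is_cderiv_shift; exact: holomorphic_cderiv. Qed.

(** Cauchy's estimate applied to the increment g(z + s) - g(z), which is O(s) by
    Cauchy's estimate for g'. So g' is locally Lipschitz, although it is not yet
    known to be differentiable. *)
Lemma cderiv_lipschitz (g : C -> C) (a s : C) (r M : R) : holomorphic g -> 0 < r ->
  (forall z, normc (z - a) <= r -> normc (g z) <= M) -> normc s <= r / 4 ->
  normc (cderiv g (a + s) - cderiv g a) <= 256 * M * normc s / r ^+ 2.
Proof.
move=> hg r0 gM sr.
have d1 z : normc (z - a) <= r / 2 -> normc (cderiv g z) <= 8 * M / r.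
  move=> za; have -> : 8 * M / r = 4 * M / (r / 2) by field; rewrite gt_eqF.
  apply: cauchy_estimate => //; first exact: halfr_gt0.
  move=> w wz; apply: gM; have -> : w - a = (w - z) + (z - a) by ring.
  by apply: le_trans (ncD _ _) _; rewrite [leRHS]splitr lerD.
have [hu cu] := holomorphic_comb 1 (-1) (holomorphic_shift s hg) hg.
have -> : cderiv g (a + s) - cderiv g a = cderiv (fun z => 1 * g (z + s) + -1 * g z) a.
  by rewrite cu cderiv_shift // mul1r mulN1r.
have -> : 256 * M * normc s / r ^+ 2 = 4 * (2 * (8 * M / r) * normc s) / (r / 4).
  by field; rewrite gt_eqF.
apply: cauchy_estimate => // [|z za]; first by rewrite divr_gt0.
rewrite mul1r mulN1r; apply: holomorphic_increment => // t /andP[t0 t1].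
apply: d1; have -> : z + t%:C * s - a = (z - a) + t%:C * s by ring.
apply: le_trans (ncD _ _) _; rewrite normcM nc_real ger0_norm //.
have : t * normc s <= 1 * normc s by rewrite ler_wpM2r ?normc_ge0.
lra.
Qed.

(** The constant depends on a bound for g only; this is what survives in limits. *)
Lemma holomorphic_taylor2 (g : C -> C) (a t : C) (r M : R) : holomorphic g -> 0 < r ->
  (forall z, normc (z - a) <= r -> normc (g z) <= M) -> normc t <= r / 4 ->
  normc (g (a + t) - g a - cderiv g a * t) <= 512 * M / r ^+ 2 * normc t ^+ 2.
Proof.
move=> hg r0 gM tr.
have hid : holomorphic (id : C -> C) by move=> z; exists 1; exact: is_cderiv_id.
have [hu cu] := holomorphic_comb 1 (- cderiv g a) hg hid.
have -> : g (a + t) - g a - cderiv g a * t =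
   (1 * g (a + t) + (- cderiv g a) * (a + t)) - (1 * g a + (- cderiv g a) * a) by ring.
have M0 : 0 <= M.
  by apply: le_trans (normc_ge0 _) (gM a _); rewrite subrr normc0 ltW.
have -> : 512 * M / r ^+ 2 * normc t ^+ 2 = 2 * (256 * M * normc t / r ^+ 2) * normc t.
  by field; rewrite gt_eqF.
apply: (holomorphic_increment (g := fun z => 1 * g z + (- cderiv g a) * z)) => // s /andP[s0 s1].
have st : normc (s%:C * t) <= normc t.
  by rewrite normcM nc_real ger0_norm // ler_piMl ?normc_ge0.
rewrite cu (cderivE (@is_cderiv_id R _)) mul1r mulr1.
apply: le_trans (cderiv_lipschitz hg r0 gM (le_trans st tr)) _.
rewrite ler_pM2r ?invr_gt0 ?exprn_gt0 //.
exact: ler_wpM2l (mulr_ge0 (ler0n _ 256) M0) _ _ st.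
Qed.

(** Weierstrass' theorem, for pointwise limits. The second order remainders are
    bounded uniformly in n, so the difference quotients at a small fixed t determine
    the derivatives up to O(t). Hence the derivatives form a Cauchy sequence, and the
    remainder estimate passes to the limit. *)
Lemma holomorphic_limit (g : nat -> C -> C) (f : C -> C) (a : C) (r M : R) :
  (forall n, holomorphic (g n)) -> 0 < r ->
  (forall n z, normc (z - a) <= r -> normc (g n z) <= M) ->
  (forall z, normc (z - a) <= r -> climit (fun n => g n z) (f z)) ->
  exists2 d, is_cderiv f a d & climit (fun n => cderiv (g n) a) d.
Proof.
move=> hg r0 gM gf.
have M0 : 0 <= M.
  by apply: le_trans (normc_ge0 _) (gM 0 a _); rewrite subrr normc0 ltW.
pose K := 512 * M / r ^+ 2 + 1.
have K0 : 0 < K.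
  apply: ltr_wpDl ltr01; apply: divr_ge0 (exprn_ge0 2 (ltW r0)).
  exact: mulr_ge0 (ler0n _ 512) M0.
have T n t : normc t <= r / 4 ->
    normc (g n (a + t) - g n a - cderiv (g n) a * t) <= K * normc t ^+ 2.
  move=> tr; apply: le_trans (holomorphic_taylor2 (hg n) r0 (gM n) tr) _.
  by rewrite ler_wpM2r ?exprn_ge0 ?normc_ge0 // lerDl.
have near0 t : normc t <= r / 4 -> normc (a + t - a) <= r.
  by move=> tr; rewrite addrAC subrr add0r; apply: le_trans tr _; lra.
have [d dP] : exists d, climit (fun n => cderiv (g n) a) d.
  apply: climit_cauchy => e e0.
  (* At this step the second order terms of two functions amount to at most e t / 2. *)
  pose t := Num.min (r / 4) (e / (4 * K)).
  have t0 : 0 < t by rewrite lt_min !divr_gt0 // mulr_gt0.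
  have nt : normc (t%:C : C) = t by rewrite nc_real gtr0_norm.
  have tr : normc (t%:C : C) <= r / 4 by rewrite nt ge_min lexx.
  have te : K * t <= e / 4.
    apply: (@le_trans _ _ (K * (e / (4 * K)))).
      by rewrite ler_wpM2l ?(ltW K0) // ge_min lexx orbT.
    by rewrite le_eqVlt; apply/orP; left; apply/eqP; field; rewrite gt_eqF.
  have et : 0 < e * t / 8 by rewrite !mulr_gt0.
  have [N NP] := gf _ (near0 _ tr) _ et.
  have [| N'' NP''] := gf a _ _ et; first by rewrite subrr normc0 ltW.
  exists (maxn N N'') => m n; rewrite !geq_max => /andP[m1 m2] /andP[n1 n2].
  rewrite -(ler_pM2r t0) -{1}nt -normcM.
  have -> : (cderiv (g m) a - cderiv (g n) a) * t%:C =
    (g n (a + t%:C) - g n a - cderiv (g n) a * t%:C) -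
    (g m (a + t%:C) - g m a - cderiv (g m) a * t%:C) +
    ((g m (a + t%:C) - f (a + t%:C)) - (g n (a + t%:C) - f (a + t%:C))) -
    ((g m a - f a) - (g n a - f a)) by ring.
  apply: le_trans (ncB _ _) _.
  have b1 := le_trans (ncB _ _) (lerD (T n _ tr) (T m _ tr)).
  have b2 := le_trans (ncB _ _) (lerD (NP m m1) (NP n n1)).
  have b3 := le_trans (ncB _ _) (lerD (NP'' m m2) (NP'' n n2)).
  have b4 := le_trans (ncD _ _) (lerD b1 b2).
  apply: le_trans (lerD b4 b3) _; rewrite nt.
  have : K * t ^+ 2 <= e / 4 * t by rewrite expr2 mulrA ler_wpM2r // ltW.
  lra.
exists d => // e e0.
exists (Num.min (r / 4) (e / K)) => [|h]; first by rewrite lt_min !divr_gt0.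
rewrite lt_min => /andP[/ltW hr he].
have L : climit (fun n => g n (a + h) - g n a - h * cderiv (g n) a) (f (a + h) - f a - h * d).
  by apply: climitB (climitZ h dP); apply: climitB; apply: gf; [exact: near0|rewrite subrr normc0 ltW].
rewrite (mulrC d).
apply: le_trans (climit_le _ L) (_ : K * normc h ^+ 2 <= _).
  by exists 0 => n _; rewrite (mulrC h); exact: T.
rewrite expr2 mulrA ler_wpM2r ?normc_ge0 // mulrC -ler_pdivlMr //.
exact: ltW.
Qed.

End UniformLimits.

(** * Entire functions of several variables, along lines *)

Section SeveralVariables.
Variables (R : realType) (n : nat).
Local Notation C := R[i].
Local Notation V := 'rV[C]_n.
Implicit Types (f g : V -> C) (z v w : V) (t : C) (r c : R).

Definition pdisc r z := forall i, normc (z 0 i) <= r.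

(** Holomorphy along all complex lines, together with local boundedness. This is
    equivalent to being entire for functions bounded on polydiscs ([entire_gholo],
    [gholo_entire]), and in this form closure properties reduce to one variable. *)
Definition gholo f := (forall z v, holomorphic (fun t => f (z + t *: v))) /\
  forall r, exists M : R, forall z, pdisc r z -> normc (f z) <= M.

Definition dirD v f : V -> C := fun z => cderiv (fun t => f (z + t *: v)) 0.

Lemma pdisc_ex z : exists2 r, 0 <= r & pdisc r z.
Proof.
exists (\sum_i normc (z 0 i)); first by apply: sumr_ge0 => i _; exact: normc_ge0.
by move=> i; rewrite (bigD1 i) //= lerDl sumr_ge0 // => j _; exact: normc_ge0.
Qed.

Lemma pdisc_line r c d z v t : pdisc r z -> pdisc c v -> normc t <= d ->
  pdisc (r + d * c) (z + t *: v).
Proof.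
move=> zr vc td i; rewrite !mxE; apply: le_trans (ncD _ _) _; apply: lerD => //.
by rewrite normcM ler_pM ?normc_ge0.
Qed.

Lemma gholo_bound f r : gholo f -> exists2 M : R, 0 <= M & forall z, pdisc r z -> normc (f z) <= M.
Proof.
move=> [_ /(_ r) [M MP]]; exists (Num.max M 0); first by rewrite le_max lexx orbT.
by move=> z /MP zM; rewrite le_max zM.
Qed.

Lemma dirD_line f v z t : gholo f -> is_cderiv (fun t => f (z + t *: v)) t (dirD v f (z + t *: v)).
Proof.
move=> [fh _]; pose phi s := f (z + s *: v).
have phiE : (fun s => f (z + t *: v + s *: v)) = (fun s => phi (s + t)).
  by apply/funext => s; rewrite /phi scalerDl addrA addrAC.
rewrite /dirD phiE (cderiv_shift t 0 (fh z v)) add0r.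
exact: holomorphic_cderiv (fh z v).
Qed.

(** Each line is mapped into a bounded part of the space by a disc of radius 1, so
    the one-variable limit theorem applies on it. *)
Lemma gholo_limit (g : nat -> V -> C) f :
  (forall k, gholo (g k)) ->
  (forall r, exists M : R, forall k z, pdisc r z -> normc (g k z) <= M) ->
  (forall z, climit (fun k => g k z) (f z)) ->
  gholo f /\ forall v z, climit (fun k => dirD v (g k) z) (dirD v f z).
Proof.
move=> hg gb gf.
have L z v a : exists2 d, is_cderiv (fun t => f (z + t *: v)) a d &
    climit (fun k => cderiv (fun t => g k (z + t *: v)) a) d.
  have [r r0 zr] := pdisc_ex z; have [c c0 vc] := pdisc_ex v.
  have [M MP] := gb (r + (normc a + 1) * c).
  apply: (@holomorphic_limit R _ _ _ 1 M) => // [k|k s sa].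
    by have [h _] := hg k; exact: h.
  apply: MP; apply: pdisc_line => //; rewrite -(subrK a s).
  by apply: le_trans (ncD _ _) _; rewrite addrC lerD2l.
split; last first.
  move=> v z; have [d dP dl] := L z v 0.
  by rewrite /dirD (cderivE dP).
split=> [z v a|r]; first by have [d dP _] := L z v a; exists d.
have [M MP] := gb r; exists M => z zr.
by apply: climit_le (gf z); exists 0 => k _; exact: MP.
Qed.

(** Uniform in the base point and in the direction. *)
Lemma gholo_taylor2 f r c : gholo f -> exists2 K : R, 0 <= K & forall z v t,
  pdisc r z -> pdisc c v -> normc t <= 1 ->
  normc (f (z + t *: v) - f z - t * dirD v f z) <= K * normc t ^+ 2.
Proof.
move=> fG; have [M M0 MP] := gholo_bound (r + 4 * c) fG.
exists (512 * M / 4 ^+ 2).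
  by apply: divr_ge0 (exprn_ge0 2 (ler0n _ 4)); exact: mulr_ge0 (ler0n _ 512) M0.
move=> z v t zr vc t1.
have := @holomorphic_taylor2 R (fun t => f (z + t *: v)) 0 t 4 M (fG.1 z v).
rewrite add0r scale0r addr0 (mulrC (cderiv _ _)); apply => //.
- by move=> s; rewrite subr0 => s4; apply: MP; exact: pdisc_line.
- by rewrite divff ?pnatr_eq0.
Qed.

Lemma gholo_comb f g (a b : C) : gholo f -> gholo g ->
  gholo (fun z => a * f z + b * g z) /\
  forall v z, dirD v (fun z => a * f z + b * g z) z = a * dirD v f z + b * dirD v g z.
Proof.
move=> fG gG; split; last first.
  by move=> v z; rewrite /dirD (holomorphic_comb a b (fG.1 z v) (gG.1 z v)).2.
split=> [z v|r]; first by have [] := holomorphic_comb a b (fG.1 z v) (gG.1 z v).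
have [M M0 MP] := gholo_bound r fG; have [N N0 NP] := gholo_bound r gG.
exists (normc a * M + normc b * N) => z zr; apply: le_trans (ncD _ _) _.
by rewrite !normcM lerD // ler_wpM2l ?normc_ge0 ?MP ?NP.
Qed.

Lemma gholo_cst (a : C) : gholo (fun=> a).
Proof.
split=> [z v t|r]; first by exists 0; exact: is_cderiv_cst.
by exists (normc a).
Qed.

Lemma dirD_cst (a : C) v z : dirD v (fun=> a) z = 0.
Proof. exact/cderivE/is_cderiv_cst. Qed.

Lemma gholo_mul f g : gholo f -> gholo g -> gholo (fun z => f z * g z) /\
  forall v z, dirD v (fun z => f z * g z) z = dirD v f z * g z + f z * dirD v g z.
Proof.
move=> fG gG; split; last first.
  move=> v z; apply: cderivE; have := is_cderivM (dirD_line v z 0 fG) (dirD_line v z 0 gG).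
  by rewrite scale0r addr0.
split=> [z v t|r]; first by eexists; exact: is_cderivM (dirD_line v z t fG) (dirD_line v z t gG).
have [M M0 MP] := gholo_bound r fG; have [N N0 NP] := gholo_bound r gG.
by exists (M * N) => z zr; rewrite normcM ler_pM ?normc_ge0 ?MP ?NP.
Qed.

Lemma gholo_sum (I : Type) (s : seq I) (F : I -> V -> C) : (forall i, gholo (F i)) ->
  gholo (fun z => \sum_(i <- s) F i z) /\
  forall v z, dirD v (fun z => \sum_(i <- s) F i z) z = \sum_(i <- s) dirD v (F i) z.
Proof.
move=> FG; elim: s => [|i s [IG ID]].
  have -> : (fun z => \sum_(i <- [::]) F i z) = fun=> 0 by apply/funext => z; rewrite big_nil.
  by split=> [|v z]; [exact: gholo_cst|rewrite big_nil dirD_cst].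
have -> : (fun z => \sum_(j <- i :: s) F j z) =
    (fun z => 1 * F i z + 1 * (\sum_(j <- s) F j z)).
  by apply/funext => z; rewrite big_cons !mul1r.
have [G D] := gholo_comb 1 1 (FG i) IG; split=> // v z.
by rewrite D ID !mul1r big_cons.
Qed.

Lemma gholo_linear f (A : V -> V) : gholo f ->
  (forall z t v, A (z + t *: v) = A z + t *: A v) ->
  (forall r, exists r', forall z, pdisc r z -> pdisc r' (A z)) ->
  gholo (fun z => f (A z)).
Proof.
move=> fG Al Ab; split=> [z v|r].
  have -> : (fun t => f (A (z + t *: v))) = (fun t => f (A z + t *: A v)).
    by apply/funext => t; rewrite Al.
  exact: fG.1.
have [r' r'P] := Ab r; have [M MP] := fG.2 r'.
by exists M => z /r'P /MP.
Qed.

Lemma gholo_translate f w : gholo f -> gholo (fun z => f (z + w)).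
Proof.
move=> fG; split=> [z v|r].
  have -> : (fun t => f (z + t *: v + w)) = (fun t => f ((z + w) + t *: v)).
    by apply/funext => t; rewrite addrAC.
  exact: fG.1.
have [c c0 wc] := pdisc_ex w; have [M MP] := fG.2 (r + 1 * c).
exists M => z zr; apply: MP; rewrite -[w]scale1r; apply: pdisc_line => //.
by rewrite normc1.
Qed.

Lemma dirDZ f v z t : gholo f -> dirD (t *: v) f z = t * dirD v f z.
Proof.
move=> fG; apply: cderivE.
have Dm : is_cderiv (fun s : C => s * t) 0 t.
  by have := is_cderivM (is_cderiv_id 0) (is_cderiv_cst t 0); rewrite mul1r mulr0 addr0.
have D2 : is_cderiv (fun s => f (z + s *: v)) (0 * t) (dirD v f z).
  by have := dirD_line v z 0 fG; rewrite mul0r scale0r addr0.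
have -> : (fun s => f (z + s *: (t *: v))) = (fun s => f (z + (s * t) *: v)).
  by apply/funext => s; rewrite scalerA.
by rewrite mulrC; exact: is_cderiv_comp Dm D2.
Qed.

Lemma scaled_sqr_inv (N K : R) : N != 0 -> N * (K * N^-1 ^+ 2) = K / N.
Proof. by move=> N0; field. Qed.

(** A directional derivative is the limit of the difference quotients with step
    1 / (k + 1), which are linear combinations of translates. *)
Lemma gholo_dirD f v : gholo f -> gholo (dirD v f).
Proof.
move=> fG; pose s k : C := (k.+1%:R)^-1.
have s0 k : (k.+1%:R : C) != 0 by rewrite pnatr_eq0.
have ns k : normc (s k) = k.+1%:R^-1 by rewrite normcV nc_nat.
have s1 k : normc (s k) <= 1 by rewrite ns invf_le1 ?ltr0n // ler1n.
(* The difference quotient of step s k. *)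
pose g k z := k.+1%:R * f (z + s k *: v) + (- k.+1%:R) * f z.
have gG k : gholo (g k) by have [] := gholo_comb (k.+1%:R) (- k.+1%:R) (gholo_translate (s k *: v) fG) fG.
have [c c0 vc] := pdisc_ex v.
have gE k z : g k z = dirD v f z + k.+1%:R * (f (z + s k *: v) - f z - s k * dirD v f z).
  rewrite /g !mulrBr [_ * (s k * _)]mulrA mulfV ?s0 // mul1r; ring.
have [] := @gholo_limit g (dirD v f) gG _ _ => // [r|z].
  have [K K0 KP] := gholo_taylor2 r c fG.
  have [M M0 MP] := gholo_bound (r + 1 * c) fG.
  exists (4 * M / 1 + K) => k z zr; rewrite gE; apply: le_trans (ncD _ _) _; apply: lerD.
    apply: cauchy_estimate => // [|t]; first exact: fG.1.
    by rewrite subr0 => t1; apply: MP; exact: pdisc_line.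
  rewrite normcM nc_nat; apply: le_trans (ler_wpM2l _ (KP _ _ _ zr vc (s1 k))) _ => //.
  by rewrite ns scaled_sqr_inv ?pnatr_eq0 // ler_piMr // -ns.
have [r r0 zr] := pdisc_ex z; have [K K0 KP] := gholo_taylor2 r c fG.
apply: (@climit_bound _ _ _ K) => k; rewrite gE addrAC subrr add0r normcM nc_nat.
apply: le_trans (ler_wpM2l _ (KP _ _ _ zr vc (s1 k))) _ => //.
by rewrite ns scaled_sqr_inv ?pnatr_eq0.
Qed.

(** Go from z to z + s (v + w) along v first and along w next. The derivative along w
    at the intermediate point differs from that at z by O(s), since it is itself
    holomorphic along lines. *)
Lemma dirDD f v w z : gholo f -> dirD (v + w) f z = dirD v f z + dirD w f z.
Proof.
move=> fG; apply/eqP; rewrite -subr_eq0; apply/eqP/nc_eq0 => e e0.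
have [r r0 zr] := pdisc_ex z.
have [a a0 va] := pdisc_ex v; have [b b0 wb] := pdisc_ex w.
have vwab : pdisc (a + 1 * b) (v + w).
  by rewrite -[w]scale1r; apply: pdisc_line; rewrite ?normc1.
have [K1 K10 KP1] := gholo_taylor2 r (a + 1 * b) fG.
have [K2 K20 KP2] := gholo_taylor2 r a fG.
have [K3 K30 KP3] := gholo_taylor2 (r + 1 * a) b fG.
have [K4 K40 KP4] := gholo_taylor2 r a (gholo_dirD w fG).
pose D := normc (dirD v (dirD w f) z).
pose K := K1 + K2 + K3 + K4 + D + 1.
have D0 : 0 <= D by exact: normc_ge0.
have K0 : 0 < K by rewrite /K; lra.
(* All error terms below are at most K s^2, hence at most e s. *)
pose s := Num.min 1 (e / K).
have s0 : 0 < s by rewrite lt_min ltr01 divr_gt0.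
have s1 : s <= 1 by rewrite ge_min lexx.
have ns : normc (s%:C : C) = s by rewrite nc_real gtr0_norm.
have sn : normc (s%:C : C) <= 1 by rewrite ns.
rewrite -(ler_pM2r s0) -{1}ns -normcM.
have h1 := KP1 z (v + w) s%:C zr vwab sn.
have h2 := KP2 z v s%:C zr va sn.
have h3 := KP3 (z + s%:C *: v) w s%:C (pdisc_line zr va sn) wb sn.
have h4 := KP4 z v s%:C zr va sn.
rewrite scalerDr addrA in h1.
rewrite ns in h1 h2 h3 h4.
set f1 := f (z + s%:C *: v + s%:C *: w) in h1 h3 *.
set f2 := f (z + s%:C *: v) in h2 h3 *.
set d4 := dirD w f (z + s%:C *: v) in h3 h4 *.
set d5 := dirD v (dirD w f) z in h4 *.
have -> : (dirD (v + w) f z - (dirD v f z + dirD w f z)) * s%:C =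
  (f1 - f2 - s%:C * d4) + (f2 - f z - s%:C * dirD v f z) +
  s%:C * (d4 - dirD w f z - s%:C * d5) + s%:C * (s%:C * d5)
  - (f1 - f z - s%:C * dirD (v + w) f z) by ring.
apply: (@le_trans _ _ (K3 * s ^+ 2 + K2 * s ^+ 2 + s * (K4 * s ^+ 2) + s * (s * D) + K1 * s ^+ 2)).
  apply: le_trans (ncB _ _) _; apply: lerD => //.
  apply: le_trans (ncD _ _) _; apply: lerD; last by rewrite !normcM ns.
  apply: le_trans (ncD _ _) _; apply: lerD; last by rewrite normcM ns ler_wpM2l // ltW.
  by apply: le_trans (ncD _ _) _; apply: lerD.
apply: (@le_trans _ _ (K * s * s)); last first.
  by rewrite ler_pM2r // mulrC -ler_pdivlMr // ge_min lexx orbT.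
have : s * (K4 * s ^+ 2) <= 1 * (K4 * s ^+ 2) by rewrite ler_wpM2r // mulr_ge0 // exprn_ge0 // ltW.
have : 0 <= s * s by rewrite mulr_ge0 // ltW.
rewrite /K expr2; lra.
Qed.

End SeveralVariables.

Lemma differentiable_of_linear (K : numFieldType) (V W : normedModType K)
    (f : V -> W) (df : {linear V -> W}) (x : V) :
  continuous df ->
  (forall e, 0 < e -> exists2 del : K, 0 < del & forall h, `|h| < del ->
     `|f (h + x) - (f x + df h)| <= e * `|h|) ->
  differentiable f x.
Proof.
move=> dfc H.
have E : f \o shift x = cst (f x) + df +o_ 0 id.
  apply/eqaddoP => e e0; have [del del0 dP] := H e e0.
  near=> h; apply: dP; near: h; exact: nbhs0_lt.
have dE := diff_unique dfc E.
by apply/diff_locallyP; rewrite dE.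
Unshelve. all: by end_near. Qed.

(** * Comparison with Frechet differentiability *)

Section Differentiability.
Variables (R : realType) (n : nat).
Local Notation C := R[i].
Local Notation V := 'rV[C]_n.
Implicit Types (f g : V -> C) (z v w : V).

Lemma normcE_abs (x : C) : `|x| = (normc x)%:C.
Proof. by case: x. Qed.

Lemma ltc_real (x y : R) : (x%:C < y%:C) = (x < y).
Proof. exact: ltcR. Qed.

Lemma pos_complex (e : C) : 0 < e -> e = (cRe e)%:C /\ 0 < cRe e.
Proof. by case: e => a b; rewrite ltcE /= => /andP[/eqP -> a0]. Qed.

Lemma normc_gt0 (x : C) : x != 0 -> 0 < normc x.
Proof. by rewrite lt_def normc_ge0 andbT; apply: contra => /eqP/eq0_normc ->. Qed.

Lemma derivable_is_cderiv (f : cfun R n) z v : derivable f z v ->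
  is_cderiv (fun t => f (z + t *: v)) 0 ('D_v f z).
Proof.
move=> /cvgrPdist_le dfv e e0.
have eC : (0 : C) < e%:C by rewrite ltc_real.
have /nbhs_ballP [del /= del0 dP] := dfv _ eC.
have [delE del0'] := pos_complex del0.
exists (cRe del) => // h hd; rewrite scale0r addr0 add0r.
have [->|h0] := eqVneq h 0.
  by rewrite scale0r addr0 subrr mulr0 subr0 normc0 mulr0.
have := dP h; rewrite /ball /= sub0r normrN normcE_abs {1}delE ltc_real => /(_ hd h0).
rewrite normcE_abs lecR -[lim _]/('D_v f z) /=.
have -> : 'D_v f z - h^-1 *: (f (h *: v + z) - f z) =
   - (h^-1 * (f (z + h *: v) - f z - 'D_v f z * h)).
  by rewrite /GRing.scale /= (addrC z); field.
by rewrite ncN normcM normcV => H; rewrite -ler_pdivrMr ?normc_gt0 // mulrC.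
Qed.

Lemma is_cderiv_derive (f : cfun R n) z v (d : C) : is_cderiv (fun t => f (z + t *: v)) 0 d ->
  'D_v f z = d.
Proof.
move=> fd; apply: cvg_lim => //; apply/cvgrPdist_le => e e0.
have [eE e0'] := pos_complex e0.
have [del del0 dP] := fd _ e0'.
have delC : (0 : C) < del%:C by rewrite ltc_real.
near=> h.
have h0 : h != 0 by near: h; exact: nbhs_dnbhs_neq.
have hd : `|h| < del%:C by near: h; exact: dnbhs0_lt.
rewrite normcE_abs ltc_real in hd.
have := dP h hd; rewrite scale0r addr0 add0r => H.
rewrite normcE_abs eE lecR.
have -> : d - h^-1 *: ((f \o shift z) (h *: v) - f z) =
   - (h^-1 * (f (z + h *: v) - f z - d * h)).
  by rewrite /GRing.scale /= (addrC z); field.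
by rewrite ncN normcM normcV mulrC ler_pdivrMr ?normc_gt0.
Unshelve. all: by end_near. Qed.

Lemma entire_gholo (f : cfun R n) : entire f ->
  (forall r, exists M : R, forall z, pdisc r z -> normc (f z) <= M) -> gholo f.
Proof.
move=> fe fb; split=> // z v a.
have := derivable_is_cderiv (diff_derivable (v := v) (fe (z + a *: v))).
set d := 'D_v f _ => H; exists d.
have := @is_cderiv_shift R (fun t => f (z + a *: v + t *: v)) a (- a) d.
rewrite subrr => /(_ H); congr is_cderiv; apply/funext => t.
by rewrite -addrA -scalerDl subrKC.
Qed.

Lemma pderiv_dirD (i : 'I_n) (f : V -> C) : gholo f -> pderiv i f = dirD (delta_mx 0 i) f.
Proof.
move=> fG; apply/funext => z; apply: is_cderiv_derive.
by have := dirD_line (delta_mx 0 i) z 0 fG; rewrite scale0r addr0.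
Qed.

(** The norm of the normed module takes values in the complex numbers; this is the
    same norm as a real number. *)
Definition supn z : R := cRe `|z|.

Lemma supnE z : `|z| = (supn z)%:C.
Proof.
have := normr_ge0 z; rewrite /supn; case: `|z| => a b.
by rewrite lecE /= => /andP[/eqP -> _].
Qed.

Lemma supn_ge0 z : 0 <= supn z.
Proof. by rewrite -lecR -supnE normr_ge0. Qed.

Lemma pdisc_supn z : pdisc (supn z) z.
Proof.
move=> i; rewrite -lecR -normcE_abs -supnE [leRHS]/Num.norm /= mx_normE.
have -> : `|z 0 i| = (`|z 0 i|%:nng)%:num by [].
rewrite num_le; exact: (le_bigmax _ (fun x => `|z x.1 x.2|%:nng) (0, i)).
Qed.

Lemma supnZ (t : C) z : supn (t *: z) = normc t * supn z.
Proof. by apply: complexI; rewrite -supnE normrZ normcE_abs supnE rmorphM. Qed.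

Lemma dirD_sum (f : V -> C) z h : gholo f ->
  dirD h f z = \sum_i h 0 i * dirD (delta_mx 0 i) f z.
Proof.
move=> fG; rewrite {1}(row_sum_delta h).
elim/big_rec2: _ => [|i y1 y2 _ <-]; last by rewrite dirDD // dirDZ.
by apply: cderivE; have := is_cderiv_cst (f z) 0; congr is_cderiv; apply/funext => t; rewrite scaler0 addr0.
Qed.

(** The differential is h |-> dirD h f z, which is linear by [dirDD], and the
    remainder is quadratic by [gholo_taylor2]. *)
Lemma gholo_entire (f : cfun R n) : gholo f -> entire f.
Proof.
move=> fG z.
pose df (h : V) : R[i]^o := \sum_i h 0 i * dirD (delta_mx 0 i) f z.
have dflin : linear df.
  move=> a u v; rewrite /df scaler_sumr -big_split /=; apply: eq_bigr => i _.
  by rewrite !mxE mulrDl /GRing.scale /= mulrA.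
pose L := GRing.isLinear.Build _ _ _ _ df dflin.
pose dfL : {linear V -> R[i]^o} := HB.pack df L.
have [r r0 zr] := pdisc_ex z.
have [K K0 KP] := gholo_taylor2 r 1 fG.
apply: (differentiable_of_linear (df := dfL)).
  move=> h; apply: (@differentiable_continuous _ ('rV[C]_n : normedModType C) (C^o : normedModType C) h df).
  have -> : df = \sum_i (fun h : V => h 0 i *: (dirD (delta_mx 0 i) f z : R[i]^o)).
    by apply/funext => w; rewrite fct_sumE.
  apply: differentiable_sum => i; apply: differentiableZl; exact: differentiable_coord.
  move=> e e0; have [eE e0'] := pos_complex e0.
  pose del := Num.min 1 (cRe e / (K + 1)).
  have del0 : 0 < del by rewrite lt_min ltr01 divr_gt0 // ltr_wpDl.
  exists del%:C => [|h hd]; first by rewrite ltc_real.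
  have {hd} : supn (h : V) < del.
    by have : `|(h : V)| < del%:C by [exact: hd]; rewrite supnE ltc_real.
  rewrite lt_min => /andP[h1 h2].
  have -> : f (h + z) - (f z + dfL h) = f (z + h) - f z - dirD h f z.
    by rewrite dirD_sum // opprD addrA (addrC h).
  suff H : normc (f (z + h) - f z - dirD h f z) <= cRe e * supn h.
    have : `|(f (z + h) - f z - dirD h f z : C)| <= e * `|(h : V)|.
      by rewrite normcE_abs supnE eE -rmorphM lecR.
    exact.
  have [s0|s0] := eqVneq (supn h) 0.
    have h0 : h = 0 by apply/eqP; rewrite -normr_eq0 supnE s0.
    rewrite h0 addr0 subrr dirD_sum // big1 => [|i _]; last by rewrite mxE mul0r.
    by rewrite subrr normc0 mulr_ge0 ?supn_ge0 // ltW.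
  have sp : 0 < supn h by rewrite lt_def s0 supn_ge0.
  pose v := ((supn h)^-1)%:C *: h.
  have hv : h = (supn h)%:C *: v by rewrite /v scalerA -rmorphM mulfV // scale1r.
  have v1 : pdisc 1 v.
    have <- : supn v = 1 by rewrite /v supnZ nc_real gtr0_norm ?invr_gt0 // mulVf.
    exact: pdisc_supn.
  have ns : normc ((supn h)%:C : C) = supn h by rewrite nc_real gtr0_norm.
  have := KP z v (supn h)%:C zr v1; rewrite ns => /(_ (ltW h1)).
  rewrite -dirDZ // -hv => H; apply: le_trans H _.
  rewrite expr2 mulrA ler_wpM2r ?supn_ge0 //.
  apply: (@le_trans _ _ ((K + 1) * supn h)); first by rewrite ler_wpM2r ?supn_ge0 // lerDl.
  by rewrite mulrC -ler_pdivlMr ?ltr_wpDl // ltW.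
Qed.

End Differentiability.

(** * Divided differences *)

Section Shift.
Variables (R : realType) (n : nat).
Local Notation C := R[i].
Local Notation V := 'rV[C]_n.
Local Notation E := (fun i => delta_mx 0 i : V).
Implicit Types (f g : V -> C) (z v w : V) (i : 'I_n) (s t : C) (r M : R).

Definition scale_at i s z : V := \row_j (if j == i then s * z 0 j else z 0 j).

Lemma scale_at_linear i s z t v :
  scale_at i s (z + t *: v) = scale_at i s z + t *: scale_at i s v.
Proof.
apply/rowP => j; rewrite !mxE; case: ifP => _ //.
by rewrite mulrDr mulrCA.
Qed.

Lemma scale_at_pdisc i s r z : normc s <= 1 -> pdisc r z -> pdisc r (scale_at i s z).
Proof.
move=> s1 zr j; rewrite mxE; case: ifP => _; last exact: zr.
by apply: le_trans (zr j); rewrite normcM ler_piMl ?normc_ge0.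
Qed.

Lemma scale_atD i s t z :
  scale_at i (s + t) z = scale_at i s z + t *: (z 0 i *: E i).
Proof.
apply/rowP => j; rewrite !mxE eqxx /=; case: eqP => [->|_] /=.
  by rewrite mulr1 mulrDl.
by rewrite !mulr0 addr0.
Qed.

Lemma scale_at1 i z : scale_at i 1 z = z.
Proof. by apply/rowP => j; rewrite mxE mul1r if_same. Qed.

(** The divided difference of f in the i-th variable with respect to z_i = 0, hence
    the shift of Taylor coefficients in that variable ([shiftfE]). *)
Definition shiftf i f : V -> C := fun z =>
  if z 0 i == 0 then dirD (E i) f z else (f z - f (scale_at i 0 z)) / z 0 i.

Lemma shiftfE i f z : f z = f (scale_at i 0 z) + z 0 i * shiftf i f z.
Proof.
rewrite /shiftf; case: eqP => [zi|/eqP zi]; last by field.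
rewrite zi mul0r addr0; congr f; apply/rowP => j; rewrite mxE.
by case: eqP => // ->; rewrite zi mulr0.
Qed.

(** A Riemann sum for the integral over s in [0, 1] of the i-th partial derivative
    at scale_at i s z; by the fundamental theorem of calculus the integral is
    the divided difference. *)
Definition shift_approx i f (k : nat) : V -> C := fun z =>
  \sum_(j < k.+1) (k.+1%:R)^-1 * dirD (E i) f (scale_at i (j%:R / k.+1%:R) z).

Lemma nc_ratio (j : nat) k : (j <= k)%N -> normc (j%:R / k.+1%:R : C) <= 1.
Proof.
move=> jk; rewrite normcM normcV !nc_nat ler_pdivrMr ?ltr0n // mul1r ler_nat.
exact: leqW.
Qed.

Lemma avg_const (F : numFieldType) (k : nat) (x : F) :
  \sum_(j < k.+1) (k.+1%:R)^-1 * x = x.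
Proof.
rewrite -mulr_suml sumr_const card_ord -[_ *+ _]mulr_natr mulVf ?mul1r //.
Qed.

Lemma nc_avg (k : nat) (F : 'I_k.+1 -> C) M : (forall j, normc (F j) <= M) ->
  normc (\sum_(j < k.+1) (k.+1%:R)^-1 * F j) <= M.
Proof.
move=> FM; apply: le_trans (nc_sum _ _ _) _.
have -> : M = \sum_(j < k.+1) (k.+1%:R)^-1 * M.
  by rewrite avg_const.
by apply: ler_sum => j _; rewrite normcM normcV nc_nat ler_wpM2l // invr_ge0 ler0n.
Qed.

Lemma shift_approx_gholo i f k : gholo f -> gholo (shift_approx i f k).
Proof.
move=> fG; apply: (gholo_sum _ _).1 => j.
have G : gholo (fun z => dirD (E i) f (scale_at i (j%:R / k.+1%:R) z)).
  apply: (gholo_linear (A := scale_at i (j%:R / k.+1%:R))); first exact: gholo_dirD.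
    exact: scale_at_linear.
  move=> r; exists r => z; apply: scale_at_pdisc.
  by apply: nc_ratio; rewrite -ltnS.
exact: (gholo_mul (gholo_cst _ (k.+1%:R)^-1) G).1.
Qed.

(** The increment of f over each of the k + 1 steps equals its linear part up to
    O(k^-2). *)
Lemma shift_approx_lim i f z : gholo f -> climit (fun k => shift_approx i f k z) (shiftf i f z).
Proof.
move=> fG; rewrite /shiftf; case: eqP => [zi|/eqP zi].
  have sz s : scale_at i s z = z.
    by apply/rowP => j; rewrite mxE; case: eqP => // ->; rewrite zi mulr0.
  have -> : (fun k => shift_approx i f k z) = (fun=> dirD (E i) f z).
    apply/funext => k; rewrite /shift_approx.
    under eq_bigr do rewrite sz.
    exact: avg_const.
  exact: climit_cst.
have [r r0 zr] := pdisc_ex z.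
have [c c0 vc] := pdisc_ex (z 0 i *: E i).
have [K K0 KP] := gholo_taylor2 r c fG.
apply: (@climit_bound _ _ _ (K / normc (z 0 i))) => k.
have k0 : (k.+1%:R : C) != 0 by rewrite pnatr_eq0.
have k0' : (k.+1%:R : R) != 0 by rewrite pnatr_eq0.
pose S (j : nat) := scale_at i (j%:R / k.+1%:R) z.
have SS j : S j.+1 = S j + k.+1%:R^-1 *: (z 0 i *: E i).
  by rewrite /S -scale_atD; congr (scale_at i _ z); rewrite -natr1 mulrDl mul1r.
have tel : f z - f (scale_at i 0 z) = \sum_(j < k.+1) (f (S j.+1) - f (S j)).
  rewrite -(big_mkord xpredT (fun j => f (S j.+1) - f (S j))) telescope_sumr //.
  by rewrite /S mul0r mulfV // scale_at1.
have -> : shift_approx i f k z - (f z - f (scale_at i 0 z)) / z 0 i =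
   - (\sum_(j < k.+1) (f (S j.+1) - f (S j) - k.+1%:R^-1 * dirD (z 0 i *: E i) f (S j)))
     / z 0 i.
  rewrite tel [in RHS]sumrB /shift_approx opprB mulrBl; congr (_ - _).
  rewrite mulr_suml; apply: eq_bigr => j _; rewrite dirDZ //.
  by rewrite mulrCA mulrAC mulfV ?mul1r.
rewrite mulNr ncN normcM normcV mulrAC ler_pM2r ?invr_gt0 ?normc_gt0 //.
apply: le_trans (nc_sum _ _ _) _.
have -> : K / k.+1%:R = \sum_(j < k.+1) K * (k.+1%:R^-1) ^+ 2.
  by rewrite sumr_const card_ord -[RHS]mulr_natl scaled_sqr_inv.
have nk : normc ((k.+1%:R)^-1 : C) = (k.+1%:R)^-1 by rewrite normcV nc_nat.
apply: ler_sum => j _; rewrite SS.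
have Sr : pdisc r (S j) by apply: scale_at_pdisc => //; apply: nc_ratio; rewrite -ltnS.
have := KP (S j) _ (k.+1%:R^-1) Sr vc; rewrite nk; apply.
by rewrite invf_le1 ?ltr0n // ler1n.
Qed.

(** The singularity at z_i = 0 is removable because the Riemann sums are entire. *)
Lemma shiftf_gholo i f : gholo f -> gholo (shiftf i f).
Proof.
move=> fG; apply: (gholo_limit (fun k => shift_approx_gholo i k fG) _
  (fun z => shift_approx_lim i z fG)).1 => r.
have [M M0 MP] := gholo_bound r (gholo_dirD (E i) fG).
exists M => k z zr; apply: nc_avg => j; apply: MP; apply: scale_at_pdisc => //.
by apply: nc_ratio; rewrite -ltnS.
Qed.

(** Where |z_i| <= r/2 the divided difference is an average of derivatives, bounded by
    Cauchy's estimate; elsewhere the denominator is at least r/2. *)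
Lemma shiftf_bound i f r M : gholo f -> 0 < r ->
  (forall z, pdisc r z -> normc (f z) <= M) ->
  forall z, pdisc r z -> normc (shiftf i f z) <= M * (8 / r).
Proof.
move=> fG r0 fM z zr.
have M0 : 0 <= M by apply: le_trans (normc_ge0 _) (fM z zr).
have [zi|zi] := leP (normc (z 0 i)) (r / 2).
  apply: climit_le (shift_approx_lim i z fG); exists 0 => k _; apply: nc_avg => j.
  have -> : M * (8 / r) = 4 * M / (r / 2) by field; rewrite gt_eqF.
  set s := _ / _; have s1 : normc s <= 1 by apply: nc_ratio; rewrite -ltnS.
  apply: cauchy_estimate; [exact: fG.1|exact: halfr_gt0|].
  move=> t; rewrite subr0 => tr; apply: fM => l; rewrite !mxE eqxx /=.
  case: eqP => [->|_] /=; last by rewrite mulr0 addr0.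
  rewrite mulr1; apply: le_trans (ncD _ _) _; rewrite [leRHS]splitr lerD //.
  by apply: le_trans zi; rewrite normcM ler_piMl ?normc_ge0.
have zi0 : 0 < normc (z 0 i) by apply: lt_trans zi; exact: halfr_gt0.
rewrite /shiftf; case: eqP => [E0|_]; first by move: zi0; rewrite E0 normc0 ltxx.
rewrite normcM normcV ler_pdivrMr //.
apply: (@le_trans _ _ (M + M)).
  apply: le_trans (ncB _ _) _; apply: lerD; apply: fM => //.
  by apply: scale_at_pdisc; rewrite ?normc0.
have -> : M + M = M * (8 / r) * (r / 4) by field; rewrite gt_eqF.
apply: ler_wpM2l; first by rewrite mulr_ge0 // divr_ge0 // ltW.
by apply: le_trans (ltW zi); lra.
Qed.

Lemma iter_shiftf_gholo i f k : gholo f -> gholo (iter k (shiftf i) f).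
Proof. by move=> fG; elim: k => //= k IH; exact: shiftf_gholo. Qed.

Lemma iter_shiftf_bound i f r M k : gholo f -> 0 < r ->
  (forall z, pdisc r z -> normc (f z) <= M) ->
  forall z, pdisc r z -> normc (iter k (shiftf i) f z) <= M * (8 / r) ^+ k.
Proof.
move=> fG r0 fM; elim: k => [|k IH] z zr; first by rewrite expr0 mulr1; exact: fM.
by rewrite exprSr [M * _]mulrA; exact: (shiftf_bound i (iter_shiftf_gholo i k fG) r0 IH zr).
Qed.

Lemma shiftf_expansion i f z N :
  f z = \sum_(0 <= k < N) iter k (shiftf i) f (scale_at i 0 z) * z 0 i ^+ k
        + z 0 i ^+ N * iter N (shiftf i) f z.
Proof.
elim: N => [|N IH]; first by rewrite big_geq // add0r expr0 mul1r.
rewrite IH (shiftfE i (iter N _ f) z) big_nat_recr //= exprSr.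
by ring.
Qed.

End Shift.

(** * Boxes of multi-indices *)

Section MultiIndexBoxes.
Variable n : nat.
Implicit Types (al be : midx n) (i : 'I_n) (l : seq 'I_n).

Definition midx0 : midx n := [ffun=> 0%N].
Definition add_at i k al : midx n := [ffun j => if j == i then (k + al j)%N else al j].

(** The multi-indices supported in l with entries below N, listed so that sums over
    them split one variable at a time. *)
Fixpoint box_on l N : seq (midx n) :=
  if l is i :: l' then [seq add_at i k al | k <- index_iota 0 N, al <- box_on l' N]
  else [:: midx0].

Lemma mem_box_on l N al : uniq l ->
  reflect (forall i, if i \in l then (al i < N)%N else al i == 0%N) (al \in box_on l N).
Proof.
elim: l al => [|i l IH] al /=.
  move=> _; apply: (iffP idP) => [|H]; first by rewrite inE => /eqP -> i; rewrite ffunE.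
  by rewrite inE; apply/eqP/ffunP => i; rewrite ffunE; exact/eqP/H.
move=> /andP[il ul]; apply: (iffP idP).
  move=> /allpairsP[[k be] /= [kN /(IH _ ul) beP ->]] j; rewrite ffunE inE.
  have := beP j; case: (j =P i) => [->|_] //=.
  rewrite (negbTE il) => /eqP ->; rewrite addn0.
  by move: kN; rewrite mem_index_iota.
move=> H; apply/allpairsP; exists (al i, [ffun j => if j == i then 0%N else al j]).
split => /=.
- by have := H i; rewrite inE eqxx mem_index_iota.
- apply/(IH _ ul) => j; rewrite ffunE; have := H j; rewrite inE.
  by case: (j =P i) => [->|_] //=; rewrite (negbTE il).
- by apply/ffunP => j; rewrite !ffunE; case: (j =P i) => [->|] //; rewrite addn0.
Qed.

Lemma uniq_box_on l N : uniq l -> uniq (box_on l N).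
Proof.
elim: l => [//|i l IH] /= /andP[il ul].
apply: allpairs_uniq; [exact: iota_uniq|exact: IH|].
move=> [k1 a1] [k2 a2] /allpairsP[[k1' a1'] /= [k1N /(mem_box_on _ _ ul) a1P [-> ->]]].
move=> /allpairsP[[k2' a2'] /= [k2N /(mem_box_on _ _ ul) a2P [-> ->]]] H.
have a1i := a1P i; have a2i := a2P i; rewrite (negbTE il) in a1i a2i.
have Hi := congr1 (fun a : midx n => a i) H.
rewrite /= !ffunE eqxx (eqP a1i) (eqP a2i) !addn0 in Hi.
congr pair => //; apply/ffunP => j.
have := congr1 (fun a : midx n => a j) H; rewrite /= !ffunE.
by case: (j =P i) => // ->; rewrite (eqP a1i) (eqP a2i).
Qed.

Definition box N := box_on (enum 'I_n) N.

Lemma uniq_box N : uniq (box N).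
Proof. by apply: uniq_box_on; exact: enum_uniq. Qed.

Lemma mem_box N al : reflect (forall i, (al i < N)%N) (al \in box N).
Proof.
apply: (iffP (mem_box_on _ _ (enum_uniq _))) => H i; have := H i; first by rewrite mem_enum.
by rewrite mem_enum.
Qed.

Lemma mdeg_add_at i k al : mdeg (add_at i k al) = (k + mdeg al)%N.
Proof.
rewrite /mdeg (bigD1 i) //= [in RHS](bigD1 i) //= ffunE eqxx addnA; congr addn.
by apply: eq_bigr => j /negbTE ji; rewrite ffunE ji.
Qed.

Lemma mdeg0 : mdeg midx0 = 0%N.
Proof. by rewrite /mdeg big1 // => i _; rewrite ffunE. Qed.

Lemma sub_box (s : seq (midx n)) : exists N, {subset s <= box N}.
Proof.
exists (\max_(al <- s) \max_i al i).+1 => al als; apply/mem_box => i; rewrite ltnS.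
rewrite (big_rem al als) /=; apply: leq_trans (leq_maxl _ _).
exact: leq_bigmax.
Qed.

Lemma box_le N N' : (N <= N')%N -> {subset box N <= box N'}.
Proof. by move=> le al /mem_box H; apply/mem_box => i; exact: leq_trans le. Qed.

End MultiIndexBoxes.

(** * Unconditional convergence of geometrically dominated series *)

Section GeometricSums.
Variables (R : realType) (n : nat).
Local Notation C := R[i].

Lemma sum_box_on_geo (x : R) (l : seq 'I_n) N :
  \sum_(al <- box_on l N) x ^+ mdeg al = (\sum_(0 <= k < N) x ^+ k) ^+ size l.
Proof.
elim: l => [|i l IH] /=; first by rewrite big_seq1 mdeg0 !expr0.
rewrite big_allpairs_dep /= exprS big_distrl /=; apply: eq_bigr => k _.
rewrite -IH big_distrr /=; apply: eq_bigr => al _.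
by rewrite mdeg_add_at exprD.
Qed.

Lemma geo_le2 N : \sum_(0 <= k < N) (2^-1 : R) ^+ k <= 2.
Proof.
suff -> : \sum_(0 <= k < N) (2^-1 : R) ^+ k = 2 - 2 * 2^-1 ^+ N.
  by rewrite gerBl mulr_ge0 // exprn_ge0.
elim: N => [|N IH]; first by rewrite big_geq // expr0 mulr1 subrr.
by rewrite big_nat_recr //= IH exprS; field.
Qed.

Lemma sum_box_on_le (l : seq 'I_n) N :
  \sum_(al <- box_on l N) (2^-1 : R) ^+ mdeg al <= 2 ^+ size l.
Proof.
rewrite sum_box_on_geo lerXn2r ?nnegrE ?geo_le2 //.
by apply: sumr_ge0 => k _; rewrite exprn_ge0.
Qed.

Lemma sum_subset (I : eqType) (s t : seq I) (F : I -> R) : uniq s -> {subset s <= t} ->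
  (forall x, 0 <= F x) -> \sum_(x <- s) F x <= \sum_(x <- t) F x.
Proof.
move=> us st F0; elim: s t us st => [|x s IH] t /=.
  by move=> _ _; rewrite big_nil sumr_ge0.
move=> /andP[xs us] st; have xt : x \in t by apply: st; rewrite inE eqxx.
rewrite big_cons (big_rem x xt) /= lerD2l; apply: IH => // y ys.
have := st y; rewrite inE ys orbT => /(_ isT) yt.
move: yt; rewrite (perm_mem (perm_to_rem xt)) inE => /orP[/eqP yx|//].
by move: xs; rewrite -yx ys.
Qed.

(** No finite set of indices outside the box carries more than e of the series of all
    2^-|al|. The same N serves for all series dominated by it, which makes the
    convergence of families of series uniform. *)
Definition tail_le (e : R) (N : nat) := forall s : seq (midx n), uniq s ->
  (forall al, al \in s -> al \notin box n N) ->
  \sum_(al <- s) (2^-1 : R) ^+ mdeg al <= e.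

Lemma geo_ge0 (al : midx n) : 0 <= (2^-1 : R) ^+ mdeg al.
Proof. by rewrite exprn_ge0. Qed.

Lemma sum_geo_le (s : seq (midx n)) : uniq s ->
  \sum_(al <- s) (2^-1 : R) ^+ mdeg al <= 2 ^+ n.
Proof.
move=> us; have [N sN] := sub_box s.
apply: le_trans (sum_subset us sN geo_ge0) _.
by apply: le_trans (sum_box_on_le _ _) _; rewrite size_enum_ord.
Qed.

(** The sums over boxes are bounded; take a box whose sum is within e of their
    supremum. *)
Lemma geo_tail (e : R) : 0 < e -> exists N, tail_le e N.
Proof.
move=> e0; pose S N := \sum_(al <- box n N) (2^-1 : R) ^+ mdeg al.
pose L := sup (range S).
have hs : has_sup (range S).
  split; first by exists (S 0); exists 0.
  by exists (2 ^+ n) => _ [N _ <-]; apply: sum_geo_le; exact: uniq_box.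
have [_ [N _ <-] SN] := sup_adherent e0 hs.
exists N => s us sN.
have [N' sub] := sub_box (s ++ box n N).
have ucat : uniq (s ++ box n N).
  rewrite cat_uniq us uniq_box andbT /=; apply/hasPn => al alN.
  by apply/negP => /sN; rewrite alN.
have : S N' <= L by apply: ub_le_sup; [exact: hs.2|exists N'].
have := sum_subset ucat sub geo_ge0; rewrite big_cat /= -/(S N) -/(S N') => h1 h2.
have := le_trans h1 h2; move: SN; rewrite -/L; lra.
Qed.

Lemma tail_sub (e : R) N (s s' : seq (midx n)) (x : midx n -> C) (c : R) :
  0 <= c -> tail_le e N ->
  (forall al, normc (x al) <= c * 2^-1 ^+ mdeg al) ->
  uniq s -> uniq s' -> {subset s <= s'} -> {subset box n N <= s} ->
  normc (\sum_(al <- s') x al - \sum_(al <- s) x al) <= c * e.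
Proof.
move=> c0 tN xc us us' ss' Ns.
have -> : \sum_(al <- s') x al - \sum_(al <- s) x al =
    \sum_(al <- [seq al <- s' | al \notin s]) x al.
  rewrite (bigID (fun al => al \in s)) /= -big_filter -[X in _ + X - _]big_filter.
  rewrite (_ : \sum_(i <- [seq i <- s' | i \in s]) x i = \sum_(al <- s) x al).
    by rewrite addrAC subrr add0r.
  apply: perm_big; apply: uniq_perm => [||al] //; first exact: filter_uniq.
  by rewrite mem_filter; apply/andP/idP => [[]//|als]; split=> //; exact: ss'.
apply: le_trans (nc_sum _ _ _) _.
apply: (@le_trans _ _ (\sum_(al <- [seq al <- s' | al \notin s]) c * 2^-1 ^+ mdeg al)).
  by apply: ler_sum.
rewrite -mulr_sumr ler_wpM2l //; apply: tN; first exact: filter_uniq.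
by move=> al; rewrite mem_filter => /andP[als _]; apply: contra als; exact: Ns.
Qed.

(** The comparison test, with a rate of convergence along the net of finite sets. *)
Lemma midx_summable (x : midx n -> C) (c : R) : 0 <= c ->
  (forall al, normc (x al) <= c * 2^-1 ^+ mdeg al) ->
  exists l, [/\ climit (fun N => \sum_(al <- box n N) x al) l, normc l <= c * 2 ^+ n &
   forall e N s, tail_le e N -> uniq s -> {subset box n N <= s} ->
     normc (\sum_(al <- s) x al - l) <= c * e].
Proof.
move=> c0 xc.
have [l lP] : exists l, climit (fun N => \sum_(al <- box n N) x al) l.
  apply: climit_cauchy => e e0.
  have c1 : 0 < c + 1 by rewrite ltr_wpDl.
  have [N NP] := geo_tail (halfr_gt0 (divr_gt0 e0 c1)).
  exists N.
  have half k : (N <= k)%N -> normc (\sum_(al <- box n k) x al -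
       \sum_(al <- box n N) x al) <= e / 2.
    move=> Nk; have H := tail_sub c0 NP xc (uniq_box n N) (uniq_box n k) (box_le (n := n) Nk)
       (fun _ => id).
    apply: le_trans H _.
    have -> : e / 2 = (c + 1) * (e / (c + 1) / 2) by field; rewrite gt_eqF.
    by rewrite ler_wpM2r ?lerDl // ltW // halfr_gt0 // divr_gt0.
  move=> j k /half hj /half hk; set T := \sum_(al <- box n N) x al in hj hk.
  have -> : \sum_(al <- box n j) x al - \sum_(al <- box n k) x al =
    (\sum_(al <- box n j) x al - T) - (\sum_(al <- box n k) x al - T) by ring.
  by apply: le_trans (ncB _ _) _; rewrite [e]splitr lerD.
exists l; split=> // [|e N s tN us Ns].
  apply: climit_le lP; exists 0 => N _; apply: le_trans (nc_sum _ _ _) _.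
  apply: (@le_trans _ _ (\sum_(al <- box n N) c * 2^-1 ^+ mdeg al)); first exact: ler_sum.
  rewrite -mulr_sumr ler_wpM2l //; apply: sum_geo_le; exact: uniq_box.
have [N' sub] := sub_box s.
rewrite nc_dist.
have L : climit (fun M => \sum_(al <- box n M) x al - \sum_(al <- s) x al)
    (l - \sum_(al <- s) x al) by apply: climitB => //; exact: climit_cst.
apply: climit_le L; exists N' => M N'M.
by apply: (tail_sub c0 tN xc us (uniq_box n M)) => // al /sub; exact: box_le.
Qed.

End GeometricSums.

(** * Taylor expansions *)

Section Taylor.
Variables (R : realType) (n : nat).
Local Notation C := R[i].
Local Notation V := 'rV[C]_n.
Implicit Types (f g : V -> C) (z v w : V) (i : 'I_n) (al be : midx n) (l : seq 'I_n).

Definition monomial al z : C := \prod_i z 0 i ^+ al i.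

Definition shift_along l al f := foldr (fun i g => iter (al i) (shiftf i) g) f l.

(** The Taylor coefficient of index al at 0, as an iterated divided difference. *)
Definition coef al f : C := shift_along (enum 'I_n) al f 0.

Lemma mono0 z : monomial (midx0 n) z = 1.
Proof. by rewrite /monomial big1 // => i _; rewrite ffunE. Qed.

Lemma mono_add_at i k al z : monomial (add_at i k al) z = z 0 i ^+ k * monomial al z.
Proof.
rewrite /monomial (bigD1 i) //= [in RHS](bigD1 i) //= ffunE eqxx exprD mulrA; congr (_ * _).
by apply: eq_bigr => j /negbTE ji; rewrite ffunE ji.
Qed.

Lemma mono_bound al r z : 0 <= r -> pdisc r z -> normc (monomial al z) <= r ^+ mdeg al.
Proof.
move=> r0 zr; rewrite /monomial nc_prod /mdeg (big_morph _ (exprD r) (expr0 r)).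
apply: ler_prod => i _; rewrite ncX exprn_ge0 ?normc_ge0 //=.
by rewrite lerXn2r ?nnegrE ?normc_ge0.
Qed.

Lemma shift_along_gholo l al f : gholo f -> gholo (shift_along l al f).
Proof. by move=> fG; elim: l => //= i l IH; exact: iter_shiftf_gholo. Qed.

Lemma shift_along_bound l al f (r M : R) : gholo f -> 0 < r ->
  (forall z, pdisc r z -> normc (f z) <= M) ->
  forall z, pdisc r z -> normc (shift_along l al f z) <= M * (8 / r) ^+ (\sum_(i <- l) al i).
Proof.
move=> fG r0 fM; elim: l => [|i l IH] z zr.
  by rewrite big_nil expr0 mulr1; exact: fM.
rewrite big_cons addnC exprD [M * _]mulrA.
exact: (iter_shiftf_bound i (al i) (shift_along_gholo l al fG) r0 IH).
Qed.

Lemma coef_bound al f (r M : R) : gholo f -> 0 < r ->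
  (forall z, pdisc r z -> normc (f z) <= M) ->
  normc (coef al f) <= M * (8 / r) ^+ mdeg al.
Proof.
move=> fG r0 fM; have := shift_along_bound (enum 'I_n) al fG r0 fM (z := 0).
rewrite big_enum; apply=> i; by rewrite mxE normc0 ltW.
Qed.

Definition zero_out l z : V := \row_j (if j \in l then 0 else z 0 j).

Lemma shift_along_add_at i k l al f : i \notin l -> shift_along l (add_at i k al) f = shift_along l al f.
Proof.
elim: l => //= j l IH; rewrite inE negb_or => /andP[ij il]; rewrite IH //.
by rewrite ffunE eq_sym (negbTE ij).
Qed.

(** Expand in one variable after the other. On the polydisc of radius 16 rho an
    N-fold divided difference loses a factor (8 / (16 rho))^N, so on the polydisc of
    radius rho the remainder in each variable is at most 2^-N times a geometric series. *)
Lemma shift_along_expansion l f z (rho M : R) N : uniq l -> gholo f -> 0 < rho -> pdisc rho z ->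
  (forall z, pdisc (16 * rho) z -> normc (f z) <= M) ->
  normc (f z - \sum_(al <- box_on l N) shift_along l al f (zero_out l z) * monomial al z)
    <= (size l)%:R * (2 ^+ size l * M * 2^-1 ^+ N).
Proof.
move=> + fG rho0 zr fM.
have r0 : 0 < 16 * rho by rewrite mulr_gt0.
have M0 : 0 <= M.
  apply: le_trans (normc_ge0 _) (fM z _) => i; apply: le_trans (zr i) _.
  by rewrite ler_peMl ?ltW // ltr1n.
elim: l => [|i l IH] /=.
  move=> _; rewrite big_seq1 mono0 mulr1 mul0r.
  have -> : zero_out [::] z = z by apply/rowP => j; rewrite mxE.
  by rewrite subrr normc0.
move=> /andP[il ul]; have {}IH := IH ul.
pose w := zero_out l z.
have wz : scale_at i 0 w = zero_out (i :: l) z.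
  by apply/rowP => j; rewrite !mxE inE; case: (j =P i) => [->|_] //=; rewrite mul0r.
have wi : w 0 i = z 0 i by rewrite mxE (negbTE il).
have wr : pdisc rho w.
  by move=> j; rewrite mxE; case: ifP => _; [rewrite normc0 ltW|exact: zr].
have wr' : pdisc (16 * rho) w.
  by move=> j; apply: le_trans (wr j) _; rewrite ler_peMl ?ltW // ltr1n.
rewrite big_allpairs_dep /= exchange_big /=.
set A := \sum_(al <- box_on l N) shift_along l al f (zero_out l z) * monomial al z in IH *.
set B := (X in f z - X).
have AB : A - B = \sum_(al <- box_on l N) z 0 i ^+ N * iter N (shiftf i) (shift_along l al f) w * monomial al z.
  rewrite /A /B -sumrB; apply: eq_big_seq => al alN.
  rewrite -/w (shiftf_expansion i (shift_along l al f) w N) wi mulrDl addrAC mulr_suml.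
  rewrite (_ : \sum_(0 <= k < N) _ = \sum_(k <- index_iota 0 N)
     iter (add_at i k al i) (shiftf i) (shift_along l (add_at i k al) f) (zero_out (i :: l) z)
     * monomial (add_at i k al) z).
    by rewrite subrr add0r.
  apply: eq_bigr => k _; rewrite shift_along_add_at // mono_add_at ffunE eqxx -wz.
  have /(mem_box_on _ _ ul) /(_ i) := alN; rewrite (negbTE il) => /eqP ->.
  by rewrite addn0 mulrA.
have -> : f z - B = (f z - A) + (A - B) by ring.
apply: le_trans (ncD _ _) _.
have le1 : normc (A - B) <= 2 ^+ size l * M * 2^-1 ^+ N.
  rewrite AB; apply: le_trans (nc_sum _ _ _) _.
  apply: (@le_trans _ _ (\sum_(al <- box_on l N) M * 2^-1 ^+ N * 2^-1 ^+ mdeg al)).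
    rewrite big_seq [leRHS]big_seq; apply: ler_sum => al alN.
    have dE : (\sum_(j <- l) al j)%N = mdeg al.
      rewrite /mdeg [RHS](bigID (fun j => j \in l)) /= [X in (_ + X)%N]big1 ?addn0.
        by rewrite -(@big_uniq _ _ _ _ l).
      by move=> j jl; have /(mem_box_on _ _ ul) /(_ j) := alN; rewrite (negbTE jl) => /eqP.
    have h1 := iter_shiftf_bound i N (shift_along_gholo l al fG) r0 (shift_along_bound l al fG r0 fM) wr'.
    have h2 := mono_bound al (ltW rho0) zr.
    rewrite !normcM ncX.
    apply: (@le_trans _ _ (rho ^+ N * (M * (8 / (16 * rho)) ^+ mdeg al * (8 / (16 * rho)) ^+ N) * rho ^+ mdeg al)).
      apply: ler_pM; rewrite ?mulr_ge0 ?exprn_ge0 ?normc_ge0 //.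
      rewrite dE in h1; apply: ler_pM; rewrite ?exprn_ge0 ?normc_ge0 //.
      by rewrite lerXn2r ?nnegrE ?normc_ge0 // ltW.
    have -> : 8 / (16 * rho) = 2^-1 / rho by field; rewrite gt_eqF.
    rewrite !expr_div_n le_eqVlt; apply/orP; left; apply/eqP.
    by field; rewrite !expf_neq0 ?gt_eqF.
  rewrite -mulr_sumr; apply: le_trans (ler_wpM2l _ (sum_box_on_le R l N)) _.
    by rewrite mulr_ge0 // exprn_ge0.
  by rewrite mulrC mulrA.
apply: le_trans (lerD IH le1) _.
rewrite -natr1 exprS.
have X0 : 0 <= 2 ^+ size l * M * 2^-1 ^+ N by rewrite !mulr_ge0 ?exprn_ge0.
have -> : 2 * 2 ^+ size l * M * 2^-1 ^+ N = 2 * (2 ^+ size l * M * 2^-1 ^+ N) by ring.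
have L0 : (0 : R) <= (size l)%:R by [].
set X := 2 ^+ size l * M * 2^-1 ^+ N in X0 *.
have : (size l)%:R * X <= (size l)%:R * (2 * X) by rewrite ler_wpM2l //; lra.
lra.
Qed.

Lemma taylor_expansion f z : gholo f ->
  climit (fun N => \sum_(al <- box n N) coef al f * monomial al z) (f z).
Proof.
move=> fG; have [r r0 zr] := pdisc_ex z.
have rho0 : 0 < r + 1 by rewrite ltr_wpDl.
have zr' : pdisc (r + 1) z by move=> i; apply: le_trans (zr i) _; rewrite lerDl.
have [M M0 MP] := gholo_bound (16 * (r + 1)) fG.
pose K := n%:R * (2 ^+ n * M).
apply: (@climit_bound _ _ _ K) => N.
have -> : \sum_(al <- box n N) coef al f * monomial al z =
   \sum_(al <- box_on (enum 'I_n) N) shift_along (enum 'I_n) al f (zero_out (enum 'I_n) z) * monomial al z.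
  apply: eq_bigr => al _; rewrite /coef; congr (shift_along _ _ _ _ * _).
  by apply/rowP => j; rewrite !mxE mem_enum.
rewrite nc_dist.
apply: le_trans (shift_along_expansion N (enum_uniq _) fG rho0 zr' MP) _.
rewrite size_enum_ord /K -[leRHS]mulrA ler_wpM2l //.
  rewrite ler_wpM2l ?mulr_ge0 ?exprn_ge0 // exprVn lef_pV2 ?posrE ?exprn_gt0 //.
  by rewrite -natrX ler_nat ltn_expl.
Qed.

End Taylor.

(** * Termwise differentiation *)

Section Derivatives.
Variables (R : realType) (n : nat).
Local Notation C := R[i].
Local Notation V := 'rV[C]_n.
Local Notation E := (fun i => delta_mx 0 i : V).
Implicit Types (f : V -> C) (g : nat -> V -> C) (z v : V) (i : 'I_n) (al ga : midx n).

(** The mode of convergence under which derivatives converge as well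
    ([dirD_converges]): pointwise, with bounds on polydiscs. *)
Definition locally_converges g f := [/\ forall k, gholo (g k),
  forall r : R, exists M : R, forall k z, pdisc r z -> normc (g k z) <= M &
  forall z, climit (fun k => g k z) (f z)].

Lemma dirD_converges g f v : locally_converges g f ->
  locally_converges (fun k => dirD v (g k)) (dirD v f).
Proof.
move=> [gG gM gl]; have [fG dl] := gholo_limit gG gM gl.
split=> [k|r|z]; [exact: gholo_dirD| |exact: dl].
have [c c0 vc] := pdisc_ex v; have [M MP] := gM (r + 1 * c).
exists (4 * M / 1) => k z zr; apply: cauchy_estimate => //; first exact: (gG k).1.
by move=> t; rewrite subr0 => t1; apply: MP; exact: pdisc_line.
Qed.

Definition dirDs (l : seq 'I_n) ga f : V -> C :=
  foldr (fun i h => iter (ga i) (dirD (E i)) h) f l.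

Lemma dirDs_gholo l ga f : gholo f -> gholo (dirDs l ga f).
Proof.
move=> fG; elim: l => //= i l IH.
by elim: (ga i) => //= k; exact: gholo_dirD.
Qed.

Lemma dirDs_converges l ga g f : locally_converges g f ->
  locally_converges (fun k => dirDs l ga (g k)) (dirDs l ga f).
Proof.
move=> gf; elim: l => //= i l IH.
by elim: (ga i) => //= k; exact: dirD_converges.
Qed.

Lemma mderiv_dirDs ga (f : cfun R n) : gholo f -> mderiv ga f = dirDs (enum 'I_n) ga f.
Proof.
move=> fG; rewrite /mderiv /dirDs; elim: (enum 'I_n) => //= i l ->.
have lG := dirDs_gholo l ga fG; rewrite /dirDs in lG.
elim: (ga i) => //= k ->; apply: pderiv_dirD.
by elim: k => //= k; exact: gholo_dirD.
Qed.

Lemma mderiv_gholo ga (f : cfun R n) : gholo f -> gholo (mderiv ga f).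
Proof. by move=> fG; rewrite mderiv_dirDs //; exact: dirDs_gholo. Qed.

Lemma gholo_lincomb (I : Type) (s : seq I) (c : I -> C) (F : I -> V -> C) :
  (forall a, gholo (F a)) -> gholo (fun z => \sum_(a <- s) c a * F a z) /\
  forall v z, dirD v (fun z => \sum_(a <- s) c a * F a z) z =
     \sum_(a <- s) c a * dirD v (F a) z.
Proof.
move=> FG; have cG a := gholo_mul (gholo_cst n (c a)) (FG a).
have [SG SD] := gholo_sum s (fun a => (cG a).1); split=> // v z.
rewrite SD; apply: eq_bigr => a _.
by rewrite (cG a).2 dirD_cst mul0r add0r.
Qed.

Lemma dirDs_lincomb (I : Type) (s : seq I) (c : I -> C) (F : I -> V -> C) l ga :
  (forall a, gholo (F a)) ->
  dirDs l ga (fun z => \sum_(a <- s) c a * F a z) =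
  (fun z => \sum_(a <- s) c a * dirDs l ga (F a) z).
Proof.
move=> FG; elim: l => //= i l ->.
have lG a := dirDs_gholo l ga (FG a).
elim: (ga i) => //= k ->; apply/funext => z.
apply: (gholo_lincomb s c (F := fun a => iter k (dirD (E i)) (dirDs l ga (F a))) _).2.
by move=> a; elim: k => //= k; exact: gholo_dirD.
Qed.

Lemma is_cderiv_exp (k : nat) (a : C) : is_cderiv (fun x => x ^+ k) a (k%:R * a ^+ k.-1).
Proof.
elim: k => [|k IH]; first by rewrite mul0r; under eq_fun do rewrite expr0; exact: is_cderiv_cst.
have -> : (fun x : C => x ^+ k.+1) = (fun x => x * x ^+ k) by apply/funext => x; rewrite exprS.
have -> : k.+1%:R * a ^+ k.+1.-1 = 1 * a ^+ k + a * (k%:R * a ^+ k.-1).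
  rewrite /= -natr1 mulrDl !mul1r addrC; congr (_ + _).
  by case: k {IH} => [|k]; rewrite ?mul0r ?mulr0 // exprS /=; ring.
exact: is_cderivM (is_cderiv_id a) IH.
Qed.

Definition sub_at i (k : nat) al : midx n :=
  [ffun j => if j == i then (al j - k)%N else al j].

Lemma mono_line al i z t : monomial al (z + t *: E i) =
  (z 0 i + t) ^+ al i * \prod_(j | j != i) z 0 j ^+ al j.
Proof.
rewrite /monomial (bigD1 i) //= !mxE !eqxx /= mulr1; congr (_ * _).
by apply: eq_bigr => j /negbTE ji; rewrite !mxE eqxx ji mulr0 addr0.
Qed.

Lemma is_cderiv_mono al z v t : exists d, is_cderiv (fun t => monomial al (z + t *: v)) t d.
Proof.
rewrite /monomial; elim: (index_enum _) => [|i s [d IH]].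
  by exists 0; under eq_fun do rewrite big_nil; exact: is_cderiv_cst.
have D1 := is_cderiv_comp (is_cderivD (is_cderiv_cst (z 0 i) t) (is_cderivM (is_cderiv_id t) (is_cderiv_cst (v 0 i) t)))
  (is_cderiv_exp (al i) _).
have -> : (fun t => \prod_(j <- i :: s) (z + t *: v) 0 j ^+ al j) =
    (fun t => (z 0 i + id t * v 0 i) ^+ al i * \prod_(j <- s) (z + t *: v) 0 j ^+ al j).
  by apply/funext => x; rewrite big_cons !mxE.
eexists; exact: (is_cderivM D1 IH).
Qed.

Lemma mono_gholo al : gholo (monomial al : V -> C).
Proof.
split=> [z v t|r]; first exact: is_cderiv_mono.
exists (Num.max r 0 ^+ mdeg al) => z zr; apply: mono_bound.
  by rewrite le_max lexx orbT.
by move=> i; rewrite le_max zr.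
Qed.

Lemma dirD_mono i al : dirD (E i) (monomial al) = fun z => (al i)%:R * monomial (sub_at i 1 al) z.
Proof.
apply/funext => z; apply: cderivE.
have -> : (fun t => monomial al (z + t *: E i)) =
    (fun t => (z 0 i + t) ^+ al i * \prod_(j | j != i) z 0 j ^+ al j).
  by apply/funext => t; exact: mono_line.
have D : is_cderiv (fun t => z 0 i + t) 0 1 by have := is_cderivD (is_cderiv_cst (z 0 i) 0) (is_cderiv_id 0); rewrite add0r.
have := is_cderivM (is_cderiv_comp D (is_cderiv_exp (al i) _)) (is_cderiv_cst (\prod_(j | j != i) z 0 j ^+ al j) 0).
rewrite /= !addr0 mulr0 addr0 mulr1; congr is_cderiv.
rewrite -[z in RHS]addr0 -(scale0r (E i)) mono_line addr0 ffunE eqxx subn1 mulrA; congr (_ * _).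
by apply: eq_bigr => j /negbTE ji; rewrite ffunE ji.
Qed.

Lemma iter_dirD_mono i k al :
  iter k (dirD (E i)) (monomial al) = fun z => (al i ^_ k)%:R * monomial (sub_at i k al) z.
Proof.
elim: k => [|k IH].
  apply/funext => z; rewrite ffactn0 mul1r; congr (monomial _ z).
  by apply/ffunP => j; rewrite ffunE subn0 if_same.
rewrite [LHS]/= IH; apply/funext => z.
rewrite (gholo_mul (gholo_cst n _) (mono_gholo _)).2 dirD_cst mul0r add0r dirD_mono mulrA -natrM.
rewrite ffunE eqxx ffactnSr; congr (_ * monomial _ z).
by apply/ffunP => j; rewrite !ffunE; case: eqP => // _; rewrite -subnDA addn1.
Qed.

Definition midxB al ga : midx n := [ffun j => (al j - ga j)%N].
Definition mffact al ga : nat := \prod_i (al i ^_ ga i).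

Lemma dirDs_mono l ga al : uniq l -> dirDs l ga (monomial al) = fun z =>
  (\prod_(i <- l) (al i ^_ ga i))%:R *
    monomial ([ffun j => if j \in l then (al j - ga j)%N else al j] : midx n) z.
Proof.
elim: l => [_|i l IH /= /andP[il ul]].
  apply/funext => z; rewrite big_nil mul1r; congr (monomial _ z).
  by apply/ffunP => j; rewrite ffunE.
rewrite IH //; set b := [ffun j => _]; set c := _%:R.
have -> : iter (ga i) (dirD (E i)) (fun z => c * monomial b z) =
    (fun z => c * iter (ga i) (dirD (E i)) (monomial b) z).
  elim: (ga i) => //= k ->; apply/funext => z.
  rewrite (gholo_mul (gholo_cst n c) _).2 ?dirD_cst ?mul0r ?add0r //.
  by elim: k => [|k]; [exact: mono_gholo|exact: gholo_dirD].
rewrite iter_dirD_mono; apply/funext => z.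
rewrite mulrA big_cons /c -natrM mulnC ffunE (negbTE il); congr (_ * monomial _ z).
apply/ffunP => j; rewrite !ffunE inE; case: (j =P i) => [->|_] //=.
by rewrite (negbTE il).
Qed.

Lemma mderiv_mono ga al z :
  mderiv ga (monomial al : cfun R n) z = (mffact al ga)%:R * monomial (midxB al ga) z.
Proof.
rewrite mderiv_dirDs ?dirDs_mono ?enum_uniq //; last exact: mono_gholo.
rewrite big_enum; congr (_ * monomial _ z); apply/ffunP => j; rewrite !ffunE.
by rewrite mem_enum.
Qed.

Lemma taylor_converges f : gholo f ->
  locally_converges (fun N z => \sum_(al <- box n N) coef al f * monomial al z) f.
Proof.
move=> fG; split=> [N|r|z].
- exact: (gholo_lincomb _ _ mono_gholo).1.
- pose rho := Num.max r 1.
  have rho0 : 0 < rho by rewrite lt_max ltr01 orbT.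
  have [M M0 MP] := gholo_bound (16 * rho) fG.
  exists (M * 2 ^+ n) => N z zr.
  have zr' : pdisc rho z by move=> i; rewrite le_max zr.
  apply: le_trans (nc_sum _ _ _) _.
  apply: (@le_trans _ _ (\sum_(al <- box n N) M * 2^-1 ^+ mdeg al)).
    apply: ler_sum => al _; rewrite normcM.
    have h := coef_bound al fG (mulr_gt0 (ltr0n R 16) rho0) MP.
    apply: le_trans (ler_pM _ _ h (mono_bound al (ltW rho0) zr')) _; rewrite ?normc_ge0 //.
    rewrite -mulrA -exprMn; have -> : 8 / (16 * rho) * rho = 2^-1 by field; rewrite gt_eqF.
    by [].
  rewrite -mulr_sumr ler_wpM2l //; apply: sum_geo_le; exact: uniq_box.
- exact: taylor_expansion.
Qed.

(** Termwise differentiation of the Taylor series. The falling factorial vanishes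
    unless ga <= al, so the truncated subtraction in the exponent is harmless. *)
Lemma mderiv_series ga (f : cfun R n) z : gholo f ->
  climit (fun N => \sum_(al <- box n N) coef al f *
      ((mffact al ga)%:R * monomial (midxB al ga) z)) (mderiv ga f z).
Proof.
move=> fG; rewrite mderiv_dirDs //.
have [_ _ /(_ z)] := dirDs_converges (enum 'I_n) ga (taylor_converges fG).
congr climit; apply/funext => N.
rewrite dirDs_lincomb; last exact: mono_gholo.
apply: eq_bigr => al _; rewrite -mderiv_mono mderiv_dirDs //; exact: mono_gholo.
Qed.

End Derivatives.

(** * Regular variation of the growth function *)

Section Growth.
Variable R : realType.
Implicit Types (rho : R) (prho phat : R -> R).

Lemma powR_expR (r p : R) : 0 < r -> r `^ p = expR (p * ln r).
Proof. by move=> r0; rewrite /powR gt_eqF. Qed.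

Lemma prox_derive rho prho (r : R) : proximate_order rho prho -> 0 < r ->
  is_derive r (1 : R) prho (derive1 prho r).
Proof. by move=> [_ pd _ _ _] r0; rewrite derive1E; apply: derivableP; exact: pd. Qed.

(** Near 0 the one-sided derivative gives the bound, away from 0 compactness does. *)
Lemma prox_bounded rho prho (b : R) : proximate_order rho prho ->
  exists2 m : R, 0 <= m & forall r, 0 <= r <= b -> prho r <= m.
Proof.
move=> hp; have [p0 pd pr _ _] := hp.
have [l lP] := (cvg_ex _).1 pr.
move/cvgrPdist_le : lP => /(_ 1 ltr01) /nbhs_ballP [del /= del0 dP].
have near0 h : 0 < h -> h < del -> prho h <= prho 0 + (`|l| + 1) * del.
  move=> h0 hd; have := dP h; rewrite /ball /= sub0r normrN gtr0_norm // => /(_ hd h0).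
  rewrite ler_norml => /andP[+ _].
  move=> le0; have : h^-1 * (prho h - prho 0) <= 1 + l by lra.
  rewrite ler_pdivrMl // => le1.
  have : h * (1 + l) <= (`|l| + 1) * del.
    apply: le_trans (_ : h * (`|l| + 1) <= _).
      by rewrite ler_wpM2l ?(ltW h0) // addrC lerD2r ler_norm.
    by rewrite mulrC ler_wpM2l ?ltW // addr_ge0.
  lra.
pose a := del / 2; have a0 : 0 < a by exact: halfr_gt0.
have ad : a < del by rewrite /a; lra.
pose m1 := prho 0 + (`|l| + 1) * del.
have m10 : prho 0 <= m1 by rewrite lerDl mulr_ge0 ?addr_ge0 // ltW.
have pos0 := p0 0 (lexx 0).
have small r : 0 <= r -> r < del -> prho r <= m1.
  move=> r0 rd; have [->//|rn] := eqVneq r 0.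
  by apply: near0 => //; rewrite lt_def rn r0.
have [ab|ba] := leP a b; last first.
  exists m1; first lra.
  by move=> r /andP[r0 rb]; apply: small => //; lra.
have [] := @EVT_max R prho a b ab.
  apply: derivable_within_continuous => x; rewrite in_itv /= => /andP[ax _].
  by apply: pd; lra.
move=> c _ cP; exists (Num.max m1 (prho c)); first by rewrite le_max; apply/orP; left; lra.
move=> r /andP[r0 rb]; rewrite le_max.
have [ra|ar] := leP r a; first by rewrite small //; lra.
by rewrite cP ?orbT // in_itv /= rb (ltW ar).
Qed.

(** Bounds on balls for functions of finite norm come from here. *)
Lemma growth_bounded rho prho (b : R) : proximate_order rho prho ->
  exists2 A : R, 0 <= A & forall r, 0 <= r <= b -> r `^ prho r <= A.
Proof.
move=> hp; have [m m0 mP] := prox_bounded b hp.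
pose B := Num.max 1 b; have B1 : 1 <= B by rewrite le_max lexx.
exists (B `^ m); first exact: powR_ge0.
move=> r rb; have /andP[r0 rb'] := rb.
have rB : r <= B by rewrite le_max rb' orbT.
apply: le_trans (_ : B `^ prho r <= _); last by apply: ler_powR => //; exact: mP.
apply: ge0_ler_powR => //; rewrite ?nnegrE //; first by have [+ _ _ _ _] := hp; apply.
by rewrite (le_trans ler01).
Qed.

(** The derivative of prho(t) ln t - c ln t with respect to ln t is the expression in
    the hypothesis. The sign sg = 1 or -1 covers both directions. *)
Lemma log_growth_monotone prho (r0 c : R) (y r : R) (sg : R) : 0 < r0 -> r0 <= y -> y <= r ->
  (forall t, r0 <= t -> is_derive t (1 : R) prho (derive1 prho t)) ->
  (forall t, r0 <= t -> 0 <= sg * (derive1 prho t * (t * ln t) + prho t - c)) ->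
  0 <= sg * (prho r * ln r - prho y * ln y - c * (ln r - ln y)).
Proof.
move=> r00 ry yr pd H.
pose f := fun t => sg * (prho t * ln t - c * ln t).
pose df t := sg * (derive1 prho t * ln t + prho t / t - c / t).
have fd t : r0 <= t -> is_derive t (1 : R) f (df t).
  move=> rt; have t0 : 0 < t by apply: lt_le_trans rt.
  have dl := is_derive1_ln t0; have dp := pd t rt.
  have -> : f = sg *: (prho * (@ln R) - c *: (@ln R)).
    by apply/funext => s; rewrite /f !fctE.
  apply: is_derive_eq; rewrite /df /GRing.scale /=; ring.
have [] := @MVT_segment R f df y r yr.
- by move=> x; rewrite in_itv /= => /andP[yx _]; apply: fd; rewrite (le_trans ry) // ltW.
- apply: derivable_within_continuous => x; rewrite in_itv /= => /andP[yx _].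
  by have [] := fd x (le_trans ry yx).
move=> x; rewrite in_itv /= => /andP[yx _] E.
have x0 : 0 < x by apply: lt_le_trans r00 (le_trans ry yx).
have -> : sg * (prho r * ln r - prho y * ln y - c * (ln r - ln y)) = f r - f y.
  by rewrite /f; ring.
rewrite E mulr_ge0 ?subr_ge0 //.
have -> : df x = sg * (derive1 prho x * (x * ln x) + prho x - c) / x.
  by rewrite /df; field; rewrite gt_eqF.
by rewrite divr_ge0 ?(ltW x0) // H // (le_trans ry).
Qed.

(** The derivative of prho(r) ln r with respect to ln r tends to rho, so eventually it
    lies between rho / 2 and 2 rho. *)
Lemma regular_variation rho prho : 0 < rho -> proximate_order rho prho ->
  exists2 r0 : R, 1 <= r0 & forall y r, r0 <= y -> y <= r ->
    (r / y) `^ (rho / 2) * y `^ prho y <= r `^ prho r <=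
      (r / y) `^ (2 * rho) * y `^ prho y.
Proof.
move=> rho0 hp; have [p0 pd _ plim dlim] := hp.
have q0 : 0 < rho / 4 by rewrite divr_gt0.
move/cvgrPdist_le : plim => /(_ _ q0) [M1 [_ M1P]].
move/cvgrPdist_le : dlim => /(_ _ q0) [M2 [_ M2P]].
(* Beyond r0 both limits defining a proximate order are attained up to rho / 4. *)
pose r0 := Num.max 1 (Num.max (M1 + 1) (M2 + 1)).
exists r0; first by rewrite le_max lexx.
have r01 : 1 <= r0 by rewrite le_max lexx.
have r00 : 0 < r0 by rewrite (lt_le_trans ltr01).
have H t : r0 <= t -> rho / 2 <= derive1 prho t * (t * ln t) + prho t <= 2 * rho.
  rewrite !ge_max => /and3P[_ h1 h2].
  have := M1P t _; rewrite /= => /(_ ltac:(lra)); rewrite ler_norml => /andP[a1 a2].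
  have := M2P t _; rewrite /= => /(_ ltac:(lra)); rewrite sub0r normrN ler_norml => /andP[b1 b2].
  by apply/andP; split; lra.
have pd' t : r0 <= t -> is_derive t (1 : R) prho (derive1 prho t).
  by move=> rt; apply: prox_derive hp _; apply: lt_le_trans rt.
move=> y r ry yr.
have y0 : 0 < y by apply: lt_le_trans ry.
have rp : 0 < r by apply: lt_le_trans yr.
have ry0 : 0 < r / y by rewrite divr_gt0.
have lnE : ln (r / y) = ln r - ln y by rewrite lnM ?posrE ?invr_gt0 // lnV ?posrE.
rewrite !powR_expR // -!expRD !ler_expR lnE.
have h1 := @log_growth_monotone prho r0 (rho / 2) y r 1 r00 ry yr pd' _.
have h2 := @log_growth_monotone prho r0 (2 * rho) y r (-1) r00 ry yr pd' _.
apply/andP; split.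
  have : forall t, r0 <= t -> 0 <= 1 * (derive1 prho t * (t * ln t) + prho t - rho / 2).
    by move=> t /H /andP[]; lra.
  by move=> /h1; lra.
have : forall t, r0 <= t -> 0 <= -1 * (derive1 prho t * (t * ln t) + prho t - 2 * rho).
  by move=> t /H /andP[]; lra.
by move=> /h2; lra.
Qed.

(** exp x >= (x / k)^k for every k, and s^(c k) >= s once c k >= 1. *)
Lemma le_exp_powR (eps c : R) : 0 < eps -> 0 < c ->
  exists2 lam : R, 1 <= lam & forall s, 1 <= s -> s <= lam * expR (eps * s `^ c).
Proof.
move=> e0 c0; pose k := (Num.bound c^-1).+1.
have kc : 1 <= k%:R * c.
  rewrite -ler_pdivrMr // mul1r; apply: ltW.
  apply: lt_trans (archi_boundP _) _; first by rewrite invr_ge0 ltW.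
  by rewrite ltr_nat.
have k0 : (0 : R) < k%:R by rewrite ltr0n.
exists (Num.max 1 ((k%:R / eps) ^+ k)); first by rewrite le_max lexx.
move=> s s1; have s0 : 0 < s by apply: lt_le_trans s1.
apply: le_trans (_ : (k%:R / eps) ^+ k * expR (eps * s `^ c) <= _); last first.
  by rewrite ler_wpM2r ?expR_ge0 // le_max lexx orbT.
have sc : 0 <= s `^ c by exact: powR_ge0.
have E1 : eps * s `^ c / k%:R <= expR (eps * s `^ c / k%:R).
  by apply: le_trans (expR_ge1Dx _); rewrite lerDr.
have -> : expR (eps * s `^ c) = expR (eps * s `^ c / k%:R) ^+ k.
  by rewrite -expRM_natl; congr expR; field; rewrite gt_eqF.
rewrite -exprMn; apply: le_trans (_ : (s `^ c) ^+ k <= _).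
  have -> : (s `^ c) ^+ k = s `^ (c * k%:R) by rewrite powRrM powR_mulrn.
  have sE : s `^ 1 = s by rewrite powRr1 // ltW.
  by rewrite -{1}sE; apply: ler_powR => //; rewrite mulrC.
apply: lerXn2r; rewrite ?nnegrE //.
  by rewrite mulr_ge0 ?expR_ge0 // divr_ge0 // ltW.
apply: le_trans (_ : k%:R / eps * (eps * s `^ c / k%:R) <= _).
  by rewrite le_eqVlt; apply/orP; left; apply/eqP; field; rewrite !gt_eqF.
by rewrite ler_wpM2l // divr_ge0 // ltW.
Qed.

End Growth.

(** * The inverse of the normalized growth function *)

Section Normalized.
Variables (R : realType) (rho : R) (prho phat : R -> R).
Hypothesis rho0 : 0 < rho.
Hypothesis hp : proximate_order rho prho.
Hypothesis hn : normalization rho prho phat.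
Local Notation G r := (r `^ prho r).
Local Notation Gh r := (r `^ phat r).

(** The power with exponent 0 makes this 1 for q = 0, where phi takes a junk value. *)
Definition phi_pow (q : nat) : R := phi phat q%:R ^+ q.

Lemma phiP (t : R) : 0 < t -> 0 < phi phat t /\ Gh (phi phat t) = t.
Proof.
move=> t0; have [_ _ _ sur] := hn.
suff : exists r, 0 < r /\ Gh r = t by move=> /(xgetPex 0).
have : [set t | 0 < t] t by [].
by rewrite -sur => -[r r0 <-]; exists r.
Qed.

Lemma Gh_le (r s : R) : 0 < r -> r <= s -> Gh r <= Gh s.
Proof.
have [_ _ inc _] := hn.
move=> r0; rewrite le_eqVlt => /orP[/eqP -> //|rs]; apply: ltW; exact: inc.
Qed.

Lemma phi_le (s t : R) : 0 < s -> s <= t -> phi phat s <= phi phat t.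
Proof.
move=> s0 st; have t0 : 0 < t by apply: lt_le_trans st.
have [a0 aE] := phiP s0; have [b0 bE] := phiP t0.
rewrite leNgt; apply/negP => ba.
have [_ _ inc _] := hn.
by have := inc _ _ b0 ba; rewrite aE bE ltNge st.
Qed.

Lemma phi_pow0 : phi_pow 0 = 1. Proof. by rewrite /phi_pow expr0. Qed.

Lemma phi_pow_gt0 q : 0 < phi_pow q.
Proof.
case: q => [|q]; first by rewrite phi_pow0.
by rewrite exprn_gt0 //; apply: (phiP _).1; rewrite ltr0n.
Qed.

(** phi is nondecreasing. *)
Lemma phi_powM a b : phi_pow a * phi_pow b <= phi_pow (a + b).
Proof.
case: a => [|a]; first by rewrite phi_pow0 mul1r add0n.
case: b => [|b]; first by rewrite phi_pow0 mulr1 addn0.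
have pos k : 0 <= phi phat k.+1%:R by apply/ltW/(phiP _).1; rewrite ltr0n.
rewrite {3}/phi_pow exprD; apply: ler_pM.
- exact/ltW/phi_pow_gt0.
- exact/ltW/phi_pow_gt0.
- apply: lerXn2r; rewrite ?nnegrE ?pos //.
  by apply: phi_le; rewrite ?ltr0n // ler_nat leq_addr.
- apply: lerXn2r; rewrite ?nnegrE ?pos //.
  by apply: phi_le; rewrite ?ltr0n // ler_nat leq_addl.
Qed.

Lemma normalized_regular : exists2 r0 : R, 1 <= r0 &
  (forall r, r0 <= r -> phat r = prho r) /\
  forall y r, r0 <= y -> y <= r ->
    (r / y) `^ (rho / 2) * Gh y <= Gh r <= (r / y) `^ (2 * rho) * Gh y.
Proof.
have [hph [r1 r10 eq1] _ _] := hn.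
have [r0 r01 H] := regular_variation rho0 hph.
exists (Num.max r0 r1); first by rewrite le_max r01.
split=> [r|y r]; rewrite ge_max => /andP[h1 h2]; [exact: eq1|exact: H].
Qed.

(** Let x = phi(q), so that the normalized growth function takes the value q at x.
    For r <= x the claim holds with lam = 1. For r = s x with s >= 1, regular variation
    gives a growth of at least s^(rho / 2) q, and s^q <= l0^q exp(eps s^(rho / 2) q). *)
Lemma pow_le_growth (eps : R) : 0 < eps -> exists2 lam : R, 1 <= lam &
  forall q (r : R), 0 <= r -> r ^+ q <= lam ^+ q * phi_pow q * expR (eps * G r).
Proof.
move=> e0; have [r0 r01 [eqr reg]] := normalized_regular.
have r00 : 0 < r0 by apply: lt_le_trans r01.
have c0 : 0 < rho / 2 by exact: halfr_gt0.
have [l0 l01 l0P] := le_exp_powR e0 c0.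
have p10 : 0 < phi phat 1%:R by apply: (phiP _).1; rewrite ltr0n.
(* For small q the point phi(q) may lie below r0, where regular variation fails; y replaces it there, at the cost of a factor kap. *)
pose kap := Num.max 1 (r0 / phi phat 1%:R).
have k1 : 1 <= kap by rewrite le_max lexx.
exists (l0 * kap); first by rewrite mulr_ege1.
case=> [r _|q r rpos].
  rewrite !expr0 phi_pow0 !mul1r; apply: le_trans (expR_ge1Dx _).
  by rewrite lerDl mulr_ge0 ?powR_ge0 // ltW.
have q0 : (0 : R) < q.+1%:R by rewrite ltr0n.
have [x0 xE] := phiP q0; set x := phi phat _ in x0 xE.
pose y := Num.max x r0.
have y0 : 0 < y by rewrite lt_max x0.
have yr0 : r0 <= y by rewrite le_max lexx orbT.
have Gy : q.+1%:R <= Gh y by rewrite -xE; apply: Gh_le => //; rewrite le_max lexx.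
have px : phi phat 1%:R <= x by apply: phi_le => //; rewrite ler_nat.
have yk : y <= kap * x.
  rewrite ge_max; apply/andP; split; first by rewrite ler_peMl // ltW.
  apply: le_trans (_ : r0 / phi phat 1%:R * x <= _).
    by rewrite mulrAC ler_pdivlMr // ler_wpM2l // ltW.
  by rewrite ler_wpM2r ?(ltW x0) // le_max lexx orbT.
have psiE : phi_pow q.+1 = x ^+ q.+1 by [].
have kx0 : 0 <= kap * x by exact: mulr_ge0 (le_trans ler01 k1) (ltW x0).
have l00 : 0 <= l0 by rewrite (le_trans ler01).
have yq : y ^+ q.+1 <= (kap * x) ^+ q.+1 by apply: lerXn2r; rewrite ?nnegrE ?(ltW y0).
have [ry|yr] := leP r y.
  apply: le_trans (_ : (kap * x) ^+ q.+1 * 1 <= _).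
    by rewrite mulr1; apply: le_trans yq; apply: lerXn2r; rewrite ?nnegrE ?(ltW y0).
  rewrite psiE -exprMn; apply: ler_pM => //; first by rewrite exprn_ge0.
    apply: lerXn2r; rewrite ?nnegrE ?mulr_ge0 ?(le_trans ler01 k1) ?(ltW x0) //.
    by rewrite -mulrA ler_peMl.
  by apply: le_trans (expR_ge1Dx _); rewrite lerDl mulr_ge0 ?powR_ge0 // ltW.
pose s := r / y.
have s1 : 1 <= s by rewrite ler_pdivlMr // mul1r ltW.
have s0 : 0 <= s by rewrite (le_trans ler01).
have rE : r = s * y by rewrite /s divfK // gt_eqF.
have /andP[Gr _] := reg y r yr0 (ltW yr).
have Gq : q.+1%:R * s `^ (rho / 2) <= G r.
  rewrite -(eqr r (le_trans yr0 (ltW yr))); apply: le_trans Gr.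
  by rewrite mulrC ler_wpM2l // powR_ge0.
rewrite {1}rE exprMn psiE.
have -> : (l0 * kap) ^+ q.+1 * x ^+ q.+1 * expR (eps * G r) =
  (l0 ^+ q.+1 * expR (eps * G r)) * (kap * x) ^+ q.+1 by rewrite !exprMn; ring.
apply: ler_pM; rewrite ?exprn_ge0 ?(ltW y0) //.
apply: le_trans (_ : (l0 * expR (eps * s `^ (rho / 2))) ^+ q.+1 <= _).
  apply: lerXn2r; [exact: s0|exact: (mulr_ge0 l00 (expR_ge0 _))|exact: l0P].
rewrite exprMn ler_wpM2l ?exprn_ge0 // -expRM_natl ler_expR.
by rewrite mulrCA ler_pM2l.
Qed.

End Normalized.

(** * The Euclidean norm *)

Section EuclideanNorm.
Variables (R : realType) (n : nat).
Local Notation C := R[i].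
Local Notation V := 'rV[C]_n.
Implicit Types (z : V) (r : R).

Lemma enorm_ge0 z : 0 <= enorm z. Proof. exact: sqrtr_ge0. Qed.

Lemma pdisc_enorm z : pdisc (enorm z) z.
Proof.
move=> i; rewrite -[leLHS]ger0_norm ?normc_ge0 // -sqrtr_sqr ler_wsqrtr //.
by rewrite (bigD1 i) //= lerDl sumr_ge0 // => j _; rewrite exprn_ge0 ?normc_ge0.
Qed.

Lemma enorm_pdisc r z : 0 <= r -> pdisc r z -> enorm z <= n.+1%:R * r.
Proof.
move=> r0 zr; have N0 : 0 <= n.+1%:R * r by rewrite mulr_ge0.
rewrite -[leRHS]ger0_norm // -sqrtr_sqr ler_wsqrtr //.
apply: le_trans (_ : \sum_(i < n) r ^+ 2 <= _).
  by apply: ler_sum => i _; apply: lerXn2r; rewrite ?nnegrE ?normc_ge0.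
rewrite sumr_const card_ord -[leLHS]mulr_natl exprMn ler_wpM2r ?exprn_ge0 //.
by rewrite -natrX ler_nat (leq_trans (leqnSn n)) // leq_pmulr.
Qed.

Lemma mono_enorm (al : midx n) z : normc (monomial al z) <= enorm z ^+ mdeg al.
Proof. exact: mono_bound (enorm_ge0 z) (pdisc_enorm z). Qed.

(** The real form of a bound M for the weighted norm ([wnorm_growthP]). *)
Definition growth_le (prho : R -> R) (eps M : R) (f : V -> C) :=
  forall z, normc (f z) <= M * expR (eps * enorm z `^ prho (enorm z)).

End EuclideanNorm.

(** * Taylor coefficients and derivatives of functions of minimal growth *)

Section GrowthOfEntire.
Variables (R : realType) (n : nat) (rho : R) (prho phat : R -> R).
Hypothesis rho0 : 0 < rho.
Hypothesis hp : proximate_order rho prho.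
Hypothesis hn : normalization rho prho phat.
Local Notation C := R[i].
Local Notation V := 'rV[C]_n.
Local Notation G r := (r `^ prho r).
Local Notation Gh r := (r `^ phat r).
Implicit Types (f : V -> C) (z : V) (al ga : midx n).

(** The growth function agrees with its normalization, which is increasing, beyond
    r1 and is bounded before. *)
Lemma growth_le_normalized : exists2 A : R, 0 <= A & forall r s : R,
  0 <= r -> 0 < s -> r <= s -> G r <= A + Gh s.
Proof.
have [hph [r1 r10 eq1] _ _] := hn.
have [A A0 AP] := growth_bounded r1 hp.
exists A => // r s rp s0 rs.
have [rr1|r1r] := leP r r1.
  apply: le_trans (AP r _) _; first by rewrite rp.
  by rewrite lerDl powR_ge0.
rewrite -(eq1 r (ltW r1r)); apply: le_trans (Gh_le hn _ rs) _.
  exact: lt_trans r1r.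
by rewrite lerDr.
Qed.

Lemma growth_on_pdisc : exists2 A : R, 0 <= A & forall (eps M r : R) f,
  0 < eps -> 0 <= M -> 0 < r -> growth_le prho eps M f ->
  forall z, pdisc r z -> normc (f z) <= M * expR (eps * (A + Gh (n.+1%:R * r))).
Proof.
have [A A0 AP] := growth_le_normalized; exists A => // eps M r f e0 M0 r0 fM z zr.
apply: le_trans (fM z) _; rewrite ler_wpM2l // ler_expR ler_pM2l //.
apply: AP; [exact: enorm_ge0|by rewrite mulr_gt0|].
by apply: enorm_pdisc => //; exact: ltW.
Qed.

(** Cauchy's inequalities on the polydisc of radius S phi(q), where q = |al|. There
    the growth function is at most U (q + const), with U depending on S; the choice
    eps = 1 / U makes the exponential at most const * e^q, and S is chosen large enough
    to turn (8 / S)^q e^q into be^q. *)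
Lemma coef_decay (be : R) : 0 < be -> exists2 eps : R, 0 < eps &
  exists2 K : R, 0 <= K & forall f M, gholo f -> 0 <= M -> growth_le prho eps M f ->
    forall al, normc (coef al f) <= K * M * be ^+ mdeg al / phi_pow phat (mdeg al).
Proof.
move=> be0; have [A A0 AP] := growth_on_pdisc.
have [r0 r01 [_ reg]] := normalized_regular rho0 hn.
have r00 : 0 < r0 by apply: lt_le_trans r01.
pose e := expR (1 : R); have e0 : 0 < e by exact: expR_gt0.
(* The radius is S * phi(q); T accounts for the passage from polydiscs to balls. *)
pose S := Num.max 1 (8 * e / be).
have S1 : 1 <= S by rewrite le_max lexx.
have S0 : 0 < S by apply: lt_le_trans S1.
have Sb : 8 / S <= be / e.
  rewrite ler_pdivrMr // mulrAC ler_pdivlMr // -ler_pdivrMl // mulrC.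
  by rewrite le_max lexx orbT.
pose T := n.+1%:R * S.
have T1 : 1 <= T by rewrite mulr_ege1 // ler1n.
have T0 : 0 < T by apply: lt_le_trans T1.
pose U := T `^ (2 * rho).
have U0 : 0 < U by exact: powR_gt0.
(* The growth on the polydisc is at most A + U * (q + const), so eps * U = 1 leaves exp q. *)
pose eps := U^-1; have eps0 : 0 < eps by rewrite invr_gt0.
exists eps => //.
pose K1 := expR (eps * (A + Gh (n.+1%:R * 1))).
pose K2 := expR (eps * (A + U * Gh r0)).
exists (K1 + K2); first by rewrite addr_ge0 ?expR_ge0.
move=> f M fG M0 fM al.
have fin q X Y : X <= M * Y * (be ^+ q / phi_pow phat q) -> Y <= K1 + K2 ->
    X <= (K1 + K2) * M * be ^+ q / phi_pow phat q.
  move=> h1 h2; apply: le_trans h1 _.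
  have -> : (K1 + K2) * M * be ^+ q / phi_pow phat q = M * (K1 + K2) * (be ^+ q / phi_pow phat q).
    by ring.
  rewrite ler_wpM2r ?ler_wpM2l //.
  apply: divr_ge0; first by rewrite exprn_ge0 // ltW.
  exact/ltW/(phi_pow_gt0 hn).
(* phi(0) is a junk value, so the polydisc of radius 1 is used for q = 0. *)
case q : (mdeg al) => [|m].
  have := coef_bound al fG ltr01 (AP eps M 1 f eps0 M0 ltr01 fM).
  rewrite q expr0 => h; apply: (fin 0%N _ K1).
    by rewrite expr0 phi_pow0 divr1.
  by rewrite lerDl expR_ge0.
have q0 : (0 : R) < m.+1%:R by rewrite ltr0n.
have [x0 xE] := phiP hn q0; set x := phi phat _ in x0 xE.
have Sx0 : 0 < S * x by rewrite mulr_gt0.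
have := coef_bound al fG Sx0 (AP eps M _ f eps0 M0 Sx0 fM).
rewrite q => h.
pose y := Num.max x r0.
have y0 : 0 < y by rewrite lt_max x0.
have yr0 : r0 <= y by rewrite le_max lexx orbT.
have Gy : Gh y <= m.+1%:R + Gh r0.
  rewrite /y; case: (leP x r0) => _; first by rewrite lerDr ltW.
  by rewrite xE lerDl powR_ge0.
have GT : Gh (n.+1%:R * (S * x)) <= U * (m.+1%:R + Gh r0).
  rewrite mulrA -/T; apply: le_trans (_ : Gh (T * y) <= _).
    apply: (Gh_le hn); first by rewrite mulr_gt0.
    by rewrite ler_pM2l // le_max lexx.
  have yT : y <= T * y by rewrite ler_peMl // ltW.
  have /andP[_] := reg y (T * y) yr0 yT.
  rewrite mulfK ?gt_eqF // => h1; apply: le_trans h1 _.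
  by rewrite ler_wpM2l // ltW.
apply: (fin _ _ K2); last by rewrite lerDr expR_ge0.
apply: le_trans h _; rewrite -!mulrA ler_wpM2l //.
have -> : phi_pow phat m.+1 = x ^+ m.+1 by [].
apply: le_trans (_ : (K2 * e ^+ m.+1) * (be / (e * x)) ^+ m.+1 <= _).
  apply: ler_pM; rewrite ?expR_ge0 ?exprn_ge0 ?divr_ge0 ?(ltW Sx0) //.
    rewrite /K2 /e -expRM_natl mulr1 -expRD ler_expR.
    apply: le_trans (_ : eps * (A + U * (m.+1%:R + Gh r0)) <= _).
      by rewrite ler_pM2l // lerD2l.
    rewrite le_eqVlt; apply/orP; left; apply/eqP; rewrite /eps; field.
    by rewrite gt_eqF.
  apply: lerXn2r; rewrite ?nnegrE ?divr_ge0 ?(ltW Sx0) ?(ltW be0) ?mulr_ge0 ?(ltW e0) ?(ltW x0) //.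
  by rewrite !invfM !mulrA ler_wpM2r // invr_ge0 ltW.
rewrite !expr_div_n exprMn le_eqVlt; apply/orP; left; apply/eqP; field.
by rewrite !expf_neq0 ?gt_eqF.
Qed.

Lemma mffact_le al ga : (mffact al ga <= 2 ^ mdeg al * mfact ga)%N.
Proof.
have bin_le a b : ('C(a, b) <= 2 ^ a)%N.
  have [ab|ba] := leqP b a; last by rewrite bin_small.
  have := Pascal 1 1 a; rewrite (_ : 1 + 1 = 2)%N // => ->.
  rewrite (bigD1 (Ordinal (ab : (b < a.+1)%N))) //= !exp1n !muln1.
  exact: leq_addr.
rewrite /mffact /mfact /mdeg expn_sum -big_split /=.
elim/big_ind2: _ => // [x1 x2 y1 y2 h1 h2|i _]; first exact: leq_mul.
by rewrite -bin_ffact leq_mul2r bin_le orbT.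
Qed.

Lemma mffact_neq0 al ga : mffact al ga != 0%N -> forall i, (ga i <= al i)%N.
Proof.
move=> H i; rewrite leqNgt; apply/negP => lt.
by move: H; rewrite /mffact (bigD1 i) //= ffact_small // mul0n.
Qed.

Lemma mdeg_midxB al ga : (forall i, (ga i <= al i)%N) ->
  mdeg al = (mdeg ga + mdeg (midxB al ga))%N.
Proof.
move=> le; rewrite /mdeg -big_split /=; apply: eq_bigr => i _.
by rewrite ffunE subnKC.
Qed.

(** In the differentiated Taylor series, [coef_decay] bounds the coefficient of index al
    by be^|al| / phi_pow |al| and [pow_le_growth] bounds the monomial by
    lam^|al - ga| phi_pow |al - ga| exp(eps V). As phi_pow is supermultiplicative, the
    quotient is at most 1 / phi_pow |ga|. The binomial coefficients cost 2^|al|, and a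
    small be absorbs all geometric factors. *)
Lemma mderiv_growth (eps th : R) : 0 < eps -> 0 < th -> exists2 eps' : R, 0 < eps' &
  exists2 K : R, 0 <= K & forall (f : cfun R n) M, gholo f -> 0 <= M -> growth_le prho eps' M f ->
    forall ga, growth_le prho eps
      (K * M * ((mfact ga)%:R * th ^+ mdeg ga / phi_pow phat (mdeg ga))) (mderiv ga f).
Proof.
move=> e0 th0; have [lam lam1 lamP] := pow_le_growth rho0 hn e0.
have lam0 : 0 < lam by apply: lt_le_trans lam1.
(* With t <= 1 the power t^|al| is at most th^|ga|, since |ga| <= |al|. *)
pose t := Num.min th 1.
have t0 : 0 < t by rewrite lt_min th0 ltr01.
have t1 : t <= 1 by rewrite ge_min lexx orbT.
have tth : t <= th by rewrite ge_min lexx.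
pose be := t / (4 * lam).
have be0 : 0 < be by rewrite divr_gt0 // mulr_gt0.
have [eps' e'0 [K K0 KP]] := coef_decay be0.
exists eps' => //; exists (K * 2 ^+ n); first by rewrite mulr_ge0 ?exprn_ge0.
move=> f M fG M0 fM ga z.
have P0 q : 0 < phi_pow phat q by apply: phi_pow_gt0; exact: hn.
set Ez := expR _.
have E0 : 0 <= Ez by exact: expR_ge0.
pose c := K * M * ((mfact ga)%:R * th ^+ mdeg ga / phi_pow phat (mdeg ga)) * Ez.
have c0 : 0 <= c.
  apply: mulr_ge0 E0; apply: mulr_ge0 (mulr_ge0 K0 M0) _.
  apply: divr_ge0; last exact/ltW/P0.
  by apply: mulr_ge0 => //; exact: exprn_ge0 (ltW th0).
have -> : K * 2 ^+ n * M * ((mfact ga)%:R * th ^+ mdeg ga / phi_pow phat (mdeg ga)) * Ez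
   = c * 2 ^+ n by rewrite /c; ring.
apply: climit_le (mderiv_series ga z fG); exists 0%N => N _.
apply: le_trans (nc_sum _ _ _) _.
apply: le_trans (_ : \sum_(al <- box n N) c * 2^-1 ^+ mdeg al <= _); last first.
  by rewrite -mulr_sumr ler_wpM2l //; apply: sum_geo_le; exact: uniq_box.
apply: ler_sum => al _.
have [->|nz] := eqVneq (mffact al ga) 0%N.
  by rewrite mul0r mulr0 normc0 mulr_ge0 // exprn_ge0.
have dE := mdeg_midxB (mffact_neq0 nz).
set p := mdeg ga in c c0 dE *; set q := mdeg (midxB al ga) in dE.
have h1 := KP f M fG M0 fM al.
have h2 : (mffact al ga)%:R <= 2 ^+ (p + q) * (mfact ga)%:R :> R.
  by rewrite -natrX -natrM ler_nat -dE; exact: mffact_le.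
have h3 : normc (monomial (midxB al ga) z) <= lam ^+ q * phi_pow phat q * Ez.
  by apply: le_trans (mono_enorm _ _) _; apply: lamP; exact: enorm_ge0.
rewrite !normcM nc_nat.
rewrite dE in h1 *.
apply: le_trans (_ : (K * M * be ^+ (p + q) / phi_pow phat (p + q)) *
   ((2 ^+ (p + q) * (mfact ga)%:R) * (lam ^+ q * phi_pow phat q * Ez)) <= _).
  apply: ler_pM; rewrite ?mulr_ge0 ?normc_ge0 //.
  by apply: ler_pM; rewrite ?normc_ge0.
have psiQ : phi_pow phat q / phi_pow phat (p + q) <= (phi_pow phat p)^-1.
  by rewrite ler_pdivrMr // ler_pdivlMl //; exact: (phi_powM hn).
have lq : lam ^+ q <= lam ^+ (p + q) by rewrite ler_weXn2l // leq_addl.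
have tq : t ^+ (p + q) <= th ^+ p.
  rewrite exprD -[leRHS]mulr1; apply: ler_pM; rewrite ?exprn_ge0 ?(ltW t0) //.
    by apply: lerXn2r; rewrite ?nnegrE ?(ltW t0) ?(ltW th0).
  by rewrite exprn_ile1 ?(ltW t0).
have -> : K * M * be ^+ (p + q) / phi_pow phat (p + q) *
   ((2 ^+ (p + q) * (mfact ga)%:R) * (lam ^+ q * phi_pow phat q * Ez)) =
   (K * M * (mfact ga)%:R * Ez) * ((be * 2) ^+ (p + q) * lam ^+ q)
     * (phi_pow phat q / phi_pow phat (p + q)).
  by rewrite [(be * 2) ^+ _]exprMn; ring.
have -> : c * 2^-1 ^+ (p + q) =
   (K * M * (mfact ga)%:R * Ez) * (th ^+ p * 2^-1 ^+ (p + q)) * (phi_pow phat p)^-1.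
  by rewrite /c; ring.
have b20 : 0 <= be * 2 by rewrite mulr_ge0 // ltW.
apply: ler_pM => //.
- by rewrite !mulr_ge0 ?exprn_ge0 ?(ltW lam0).
- by rewrite divr_ge0 // ltW.
- rewrite ler_wpM2l ?mulr_ge0 //.
  apply: le_trans (_ : (be * 2) ^+ (p + q) * lam ^+ (p + q) <= _).
    by rewrite ler_wpM2l // exprn_ge0.
  rewrite -exprMn; have -> : be * 2 * lam = t * 2^-1 by rewrite /be; field; rewrite gt_eqF.
  by rewrite exprMn ler_wpM2r // exprn_ge0.
Qed.

End GrowthOfEntire.

(** * The space of functions of minimal growth *)

Section AzeroTools.
Variables (R : realType) (n : nat).
Local Notation C := R[i].
Local Notation V := 'rV[C]_n.
Implicit Types (prho : R -> R) (f g : cfun R n) (z : V) (sg M : R).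

Lemma wnorm_growthP prho sg M f :
  (wnorm prho sg f <= M%:E)%E <-> growth_le prho sg M f.
Proof.
split=> [le z|fM].
  have := le_trans (le_wnorm prho sg f z) le.
  by rewrite lee_fin mulNr expRN ler_pdivrMr ?expR_gt0.
by apply: wnorm_le => z; rewrite lee_fin mulNr expRN ler_pdivrMr ?expR_gt0.
Qed.

Lemma growth_le_ge0 prho sg M f : growth_le prho sg M f -> 0 <= M.
Proof.
move=> /(_ 0) h; have := le_trans (normc_ge0 _) h.
by rewrite pmulr_lge0 ?expR_gt0.
Qed.

Lemma wnorm_lty prho sg f : (wnorm prho sg f < +oo)%E <->
  exists M, growth_le prho sg M f.
Proof.
split=> [fy|[M /wnorm_growthP le]]; last by apply: le_lt_trans le _; rewrite ltry.
exists (fine (wnorm prho sg f)); apply/wnorm_growthP.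
by rewrite fineK // ge0_fin_numE ?wnorm_ge0.
Qed.

Lemma growth_le_mono prho sg sg' M M' f : sg <= sg' -> 0 <= M -> M <= M' ->
  growth_le prho sg M f -> growth_le prho sg' M' f.
Proof.
move=> ss M0 MM fM z; apply: le_trans (fM z) _; apply: ler_pM; rewrite ?expR_ge0 //.
by rewrite ler_expR ler_wpM2r ?powR_ge0.
Qed.

Lemma growth_bounded_pdisc rho prho sg M f r : proximate_order rho prho -> 0 <= sg ->
  growth_le prho sg M f -> exists M' : R, forall z, pdisc r z -> normc (f z) <= M'.
Proof.
move=> hp sg0 fM.
have [A A0 AP] := growth_bounded (n.+1%:R * Num.max r 0) hp.
exists (M * expR (sg * A)) => z zr; apply: le_trans (fM z) _.
have M0 := growth_le_ge0 fM.
rewrite ler_wpM2l // ler_expR ler_wpM2l // AP // enorm_ge0 /=.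
apply: enorm_pdisc; first by rewrite le_max lexx orbT.
by move=> i; rewrite le_max zr.
Qed.

Lemma Asigma_gholo rho prho sg f : proximate_order rho prho -> 0 < sg ->
  Asigma prho sg f -> gholo f.
Proof.
move=> hp sg0 [fe /wnorm_lty [M fM]]; apply: entire_gholo => // r.
by apply: growth_bounded_pdisc fM => //; [exact: hp|exact: ltW].
Qed.

Lemma Azero_Asigma prho (f : Azero n prho) sg : 0 < sg -> Asigma prho sg f.
Proof. by case: f => f /= /set_mem; apply. Qed.

Lemma Azero_gholo rho prho (f : Azero n prho) : proximate_order rho prho -> gholo f.
Proof. by move=> hp; apply: Asigma_gholo hp ltr01 (Azero_Asigma f ltr01). Qed.

Lemma Azero_growth prho (f : Azero n prho) sg : 0 < sg -> exists M, growth_le prho sg M f.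
Proof. by move=> sg0; apply/wnorm_lty; have [] := Azero_Asigma f sg0. Qed.

(** Functions are turned into elements of the space up to pointwise equality, which
    avoids carrying proofs of membership. *)
Lemma Azero_ex prho f : gholo f -> (forall sg, 0 < sg -> exists M, growth_le prho sg M f) ->
  exists F : Azero n prho, forall z, F z = f z.
Proof.
move=> fG fM; suff H : f \in Azero_pred prho by exists (MkAzero H).
apply/mem_set => sg sg0; split; first exact: gholo_entire.
by apply/wnorm_lty; exact: fM.
Qed.

Lemma Azero_eq prho (f g : Azero n prho) : (forall z, f z = g z) -> f = g.
Proof. by move=> fg; apply: val_inj; apply/funext. Qed.

Lemma Azero_scaleD prho (a : C) (f g : Azero n prho) z : (a *: f + g) z = a * f z + g z.
Proof. by []. Qed.

Lemma Azero_sum prho (I : Type) (s : seq I) (F : I -> Azero n prho) z :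
  (\sum_(i <- s) F i) z = \sum_(i <- s) F i z.
Proof.
by elim: s => [|i s IH]; rewrite ?big_nil // !big_cons -IH.
Qed.

Lemma partial_sumE prho (t : midx n -> Azero n prho) (A : {fset midx n}) z :
  partial_sum t A z = \sum_(al <- A) t al z.
Proof. by rewrite /partial_sum -(big_seq_fsetE _ A xpredT t) Azero_sum. Qed.

End AzeroTools.

(** * Convergence of series in the space of functions of minimal growth *)

Section Convergence.
Variables (R : realType) (n : nat) (prho : R -> R).
Local Notation C := R[i].
Local Notation V := 'rV[C]_n.
Implicit Types (t : midx n -> Azero n prho) (g : Azero n prho) (z : V).

(** Uniform rates along [tail_le] are what convergence of the net of partial sums in
    all norms requires. *)
Lemma Azero_sum_cvg t g :
  (forall sg : R, 0 < sg -> exists2 c : R, 0 <= c & forall e N s, tail_le n e N ->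
     uniq s -> {subset box n N <= s} ->
     growth_le prho sg (c * e) (fun z => \sum_(al <- s) t al z - g z)) ->
  partial_sum t @ totally --> g.
Proof.
move=> H U [[sg del] /= [sg0 del0] sub].
have [c c0 cP] := H _ sg0.
have c1 : 0 < c + 1 by rewrite ltr_wpDl.
have e0 : 0 < del / 2 / (c + 1) by rewrite !divr_gt0.
have [N NP] := geo_tail n e0.
exists [fset al in box n N]%fset => //= B AB; apply: sub; rewrite /Azero_ball /=.
have Bsub : {subset box n N <= B}.
  by move=> al alN; apply: (fsubsetP AB); rewrite inE.
have /wnorm_growthP le := cP _ _ _ NP (fset_uniq B) Bsub.
apply: (@le_lt_trans _ _ ((c * (del / 2 / (c + 1)))%:E)).
  apply: le_trans le; rewrite le_eqVlt; apply/orP; left; apply/eqP.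
  congr wnorm; apply/funext => z.
  by rewrite -partial_sumE.
rewrite lte_fin mulrA ltr_pdivrMr //.
apply: (@le_lt_trans _ _ ((c + 1) * (del / 2))).
  by rewrite ler_wpM2r ?lerDl // ltW // halfr_gt0.
by rewrite mulrC ltr_pM2r // ltr_pdivrMr // ltr_pMr ?ltr1n.
Qed.

Lemma Azero_sum_pointwise t g : partial_sum t @ totally --> g ->
  forall z, climit (fun N => \sum_(al <- box n N) t al z) (g z).
Proof.
move=> tg z e e0; pose E := expR (1 * enorm z `^ prho (enorm z)).
have E0 : 0 < E by exact: expR_gt0.
have eE : 0 < e / E by rewrite divr_gt0.
have [] := tg (Azero_ball g (1, e / E)) _; first by exists (1, e / E).
move=> A _ AP; have [N NP] := sub_box A.
exists N => k Nk.
have AB : [set B | (A `<=` B)%fset] [fset al in box n k]%fset.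
  by apply/fsubsetP => al /NP alN; rewrite inE; exact: box_le alN.
have /= := AP _ AB; rewrite /Azero_ball /= => /ltW /wnorm_growthP /(_ z).
rewrite -/E divfK ?gt_eqF // => le; apply: le_trans le.
rewrite le_eqVlt; apply/orP; left; apply/eqP.
transitivity (normc (partial_sum t [fset al in box n k]%fset z - g z)); last by [].
rewrite partial_sumE; congr (normc (_ - _)).
apply: perm_big; apply: uniq_perm; [exact: uniq_box|exact: fset_uniq|].
by move=> al; rewrite !inE.
Qed.

End Convergence.

(** * Differential operators act continuously *)

Section OperatorPart.
Variables (R : realType) (n : nat) (rho1 rho2 : R).
Variables (prho1 prho2 phat1 : R -> R).
Hypothesis hrho1 : 0 < rho1.
Hypothesis hp1 : proximate_order rho1 prho1.
Hypothesis hp2 : proximate_order rho2 prho2.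
Hypothesis hO : exists C : R, \forall r \near +oo, r `^ prho1 r <= C * r `^ prho2 r.
Hypothesis hn : normalization rho1 prho1 phat1.
Local Notation C := R[i].
Local Notation V := 'rV[C]_n.
Implicit Types (f : cfun R n) (z : V) (a : formal_op R n).

Lemma growth_domination : exists2 c : R, 0 < c & exists2 A : R, 0 <= A &
  forall r, 0 <= r -> r `^ prho1 r <= c * r `^ prho2 r + A.
Proof.
have [c [M [_ MP]]] := hO.
have [A A0 AP] := growth_bounded (M + 1) hp1.
exists (`|c| + 1); first by rewrite ltr_wpDl.
exists A => // r r0; have [rM|Mr] := leP r (M + 1).
  apply: le_trans (AP r _) _; first by rewrite r0.
  by rewrite lerDr mulr_ge0 ?powR_ge0 // addr_ge0.
have := MP r; rewrite /= => /(_ ltac:(lra)) h; apply: le_trans h _.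
apply: le_trans (_ : (`|c| + 1) * r `^ prho2 r <= _); last by rewrite lerDl.
by rewrite ler_wpM2r ?powR_ge0 // (le_trans (ler_norm c)) // lerDl.
Qed.

Lemma GcoefE q : Gcoef rho1 phat1 q =
  phi_pow phat1 q * ((expR 1 * rho1) `^ rho1^-1)^-1 ^+ q.
Proof.
rewrite /Gcoef -/(phi_pow phat1 q) exprVn; congr (_ / _).
by rewrite [q%:R / _]mulrC powRrM powR_mulrn ?powR_ge0.
Qed.

Lemma Dzero_coef_gholo a al : Dzero rho1 phat1 prho2 a -> gholo (a al).
Proof. by move=> [/(_ al) [sg sg0 aA] _]; exact: Asigma_gholo hp2 sg0 aA. Qed.

Definition op_term a f (ga : midx n) : cfun R n := fun z => a ga z * mderiv ga f z.

(** The weight phi_pow |ga| / ga! allowed for the coefficients cancels the factor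
    ga! / phi_pow |ga| from [mderiv_growth]; th is chosen to leave 2^-|ga|. Half of sg is
    spent on the coefficient and half on the derivative. *)
Lemma op_term_growth a : Dzero rho1 phat1 prho2 a -> forall sg : R, 0 < sg ->
  exists2 eps : R, 0 < eps & exists2 K : R, 0 <= K &
  forall f M, gholo f -> 0 <= M -> growth_le prho1 eps M f ->
    forall ga, growth_le prho2 sg (K * M * 2^-1 ^+ mdeg ga) (op_term a f ga).
Proof.
move=> [_ aD] sg sg0.
have [lam [lam0 [Ca [Ca0 CaP]]]] := aD _ (halfr_gt0 sg0).
have [c c0 [A A0 cP]] := growth_domination.
pose kap := ((expR 1 * rho1) `^ rho1^-1)^-1.
have kap0 : 0 < kap by rewrite invr_gt0 powR_gt0 // mulr_gt0 ?expR_gt0.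
pose eps := sg / 2 / c; have eps0 : 0 < eps by rewrite divr_gt0 // halfr_gt0.
(* So that kap * lam * th = 1/2. *)
pose th := 2^-1 / (kap * lam).
have th0 : 0 < th by rewrite divr_gt0 // ?mulr_gt0.
have [eps' e'0 [K K0 KP]] := mderiv_growth n hrho1 hp1 hn eps0 th0.
exists eps' => //; exists (Ca * K * expR (eps * A)).
  by rewrite !mulr_ge0 ?expR_ge0 // ltW.
move=> f M fG M0 fM ga z; rewrite /op_term normcM.
have /wnorm_growthP /(_ z) h1 := CaP ga.
have h2 := KP f M fG M0 fM ga z.
apply: le_trans (ler_pM (normc_ge0 _) (normc_ge0 _) h1 h2) _.
have P0 := phi_pow_gt0 hn (mdeg ga).
have F0 : (0 : R) < (mfact ga)%:R.
  by rewrite ltr0n /mfact; apply: prodn_gt0 => i; exact: fact_gt0.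
rewrite GcoefE -/kap.
set q := mdeg ga in P0 *; set E1 := expR _; set E2 := expR _; set E3 := expR (sg * _).
have thE : kap * lam * th = 2^-1 by rewrite /th; field; rewrite !gt_eqF.
have -> : Ca * (phi_pow phat1 q * kap ^+ q / (mfact ga)%:R) * lam ^+ q * E1 *
   (K * M * ((mfact ga)%:R * th ^+ q / phi_pow phat1 q) * E2) =
   (Ca * K * M * 2^-1 ^+ q) * (E1 * E2).
  by rewrite -thE !exprMn; field; rewrite !gt_eqF.
have -> : Ca * K * expR (eps * A) * M * 2^-1 ^+ q * E3 =
   (Ca * K * M * 2^-1 ^+ q) * (expR (eps * A) * E3) by ring.
apply: ler_wpM2l; first by rewrite !mulr_ge0 ?exprn_ge0 // ltW.
rewrite /E1 /E2 /E3 -!expRD ler_expR.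
have := cP _ (enorm_ge0 z); set G1 := _ `^ prho1 _; set G2 := _ `^ prho2 _ => h.
have : eps * G1 <= eps * (c * G2 + A) by rewrite ler_pM2l.
have -> : eps * (c * G2 + A) = sg / 2 * G2 + eps * A by rewrite /eps; field; rewrite gt_eqF.
lra.
Qed.

(** The sum is taken pointwise. It is entire as a locally bounded limit, and the
    rate of convergence from [midx_summable] carries over to all norms. *)
Lemma op_value_ex a (f : Azero n prho1) : Dzero rho1 phat1 prho2 a ->
  exists g : Azero n prho2, op_sum a f g.
Proof.
move=> aD; have fG := Azero_gholo f hp1.
have B sg : 0 < sg -> exists2 c : R, 0 <= c & forall ga,
    growth_le prho2 sg (c * 2^-1 ^+ mdeg ga) (op_term a f ga).
  move=> sg0; have [eps e0 [K K0 KP]] := op_term_growth aD sg0.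
  have [M fM] := Azero_growth f e0; have M0 := growth_le_ge0 fM.
  by exists (K * M); [rewrite mulr_ge0|exact: KP].
have termG ga : gholo (op_term a f ga).
  exact: (gholo_mul (Dzero_coef_gholo ga aD) (mderiv_gholo ga fG)).1.
have [t tE] : exists t : midx n -> Azero n prho2,
    forall ga z, t ga z = op_term a f ga z.
  have := choice (fun ga => @Azero_ex R n prho2 _ (termG ga) _).
  by case=> [ga sg /B [c c0 cP]|t tP]; [eexists; exact: cP|exists t].
have bnd sg (sg0 : 0 < sg) : exists2 c : R, 0 <= c & forall ga z,
    normc (t ga z) <= c * expR (sg * enorm z `^ prho2 (enorm z)) * 2^-1 ^+ mdeg ga.
  have [c c0 cP] := B _ sg0; exists c => // ga z.
  by rewrite tE mulrAC; exact: cP.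
have lim z : exists l, forall sg : R, 0 < sg -> forall c, 0 <= c ->
   (forall ga, normc (t ga z) <= c * 2^-1 ^+ mdeg ga) ->
   [/\ climit (fun N => \sum_(ga <- box n N) t ga z) l, normc l <= c * 2 ^+ n &
    forall e N s, tail_le n e N -> uniq s -> {subset box n N <= s} ->
     normc (\sum_(ga <- s) t ga z - l) <= c * e].
  have [c c0 cP] := bnd 1 ltr01.
  have cE0 : 0 <= c * expR (1 * enorm z `^ prho2 (enorm z)) by rewrite mulr_ge0 ?expR_ge0.
  have [l [ll _ _]] := midx_summable cE0 (cP^~ z).
  exists l => sg sg0 c' c'0 c'P.
  have [l' [ll' h1 h2]] := midx_summable c'0 c'P.
  by rewrite (climit_uniq ll ll').
have [g0 g0P] := choice lim.
have g0growth sg : 0 < sg -> exists2 c : R, 0 <= c & growth_le prho2 sg (c * 2 ^+ n) g0 /\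
   forall e N s, tail_le n e N -> uniq s -> {subset box n N <= s} ->
     growth_le prho2 sg (c * e) (fun z => \sum_(ga <- s) t ga z - g0 z).
  move=> sg0; have [c c0 cP] := bnd _ sg0; exists c => //.
  have H z := g0P z sg sg0 _ (mulr_ge0 c0 (expR_ge0 _)) (cP^~ z).
  split=> [z|e N s tN us Ns z]; have [_ h1 h2] := H z.
    by rewrite mulrAC.
  by rewrite mulrAC; exact: h2 tN us Ns.
have g0G : gholo g0.
  have tG ga : gholo (t ga) by exact: Azero_gholo hp2.
  apply: (gholo_limit (g := fun N z => \sum_(ga <- box n N) t ga z) _ _ _).1.
  - by move=> N; exact: (gholo_sum _ tG).1.
  - move=> r; have [c c0 cP] := bnd 1 ltr01.
    pose rr := n.+1%:R * Num.max r 0.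
    have [A A0 AP] := growth_bounded rr hp2.
    exists (c * expR A * 2 ^+ n) => N z zr.
    apply: le_trans (nc_sum _ _ _) _.
    apply: le_trans (_ : \sum_(ga <- box n N) c * expR A * 2^-1 ^+ mdeg ga <= _).
      apply: ler_sum => ga _; apply: le_trans (cP ga z) _.
      rewrite ler_wpM2r ?exprn_ge0 // ler_wpM2l // ler_expR mul1r.
      apply: AP; rewrite enorm_ge0 /=; apply: enorm_pdisc; first by rewrite le_max lexx orbT.
      by move=> i; rewrite le_max zr.
    rewrite -mulr_sumr ler_wpM2l ?mulr_ge0 ?expR_ge0 //.
    by apply: sum_geo_le; exact: uniq_box.
  - move=> z; have [c c0 cP] := bnd 1 ltr01.
    by have [] := g0P z 1 ltr01 _ (mulr_ge0 c0 (expR_ge0 _)) (cP^~ z).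
have [g gE] : exists g : Azero n prho2, forall z, g z = g0 z.
  by apply: Azero_ex g0G _ => sg /g0growth [c _ [h _]]; eexists; exact: h.
exists g; exists t => //; apply: Azero_sum_cvg => sg /g0growth [c c0 [_ h]].
exists c => // e N s tN us Ns z; rewrite gE; exact: h tN us Ns z.
Qed.

Lemma op_sum_pointwise a (f : Azero n prho1) (g : Azero n prho2) : op_sum a f g ->
  forall z, climit (fun N => \sum_(ga <- box n N) op_term a f ga z) (g z).
Proof.
move=> [t tE tg] z; have := Azero_sum_pointwise tg z; congr climit.
by apply/funext => N; apply: eq_bigr => ga _; rewrite tE.
Qed.

Lemma op_sum_uniq a (f : Azero n prho1) (g g' : Azero n prho2) :
  op_sum a f g -> op_sum a f g' -> g = g'.
Proof.
move=> h h'; apply: Azero_eq => z.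
exact: climit_uniq (op_sum_pointwise h z) (op_sum_pointwise h' z).
Qed.

Lemma op_sum_growth a sg : Dzero rho1 phat1 prho2 a -> 0 < sg ->
  exists2 eps : R, 0 < eps & exists2 K : R, 0 <= K &
  forall (f : Azero n prho1) (g : Azero n prho2) M, op_sum a f g ->
     growth_le prho1 eps M f -> growth_le prho2 sg (K * M) g.
Proof.
move=> aD sg0; have [eps e0 [K K0 KP]] := op_term_growth aD sg0.
exists eps => //; exists (K * 2 ^+ n); first by rewrite mulr_ge0 ?exprn_ge0.
move=> f g M fg fM z; have M0 := growth_le_ge0 fM; have fG := Azero_gholo f hp1.
apply: climit_le (op_sum_pointwise fg z); exists 0%N => N _.
apply: le_trans (nc_sum _ _ _) _; set E := expR _.
apply: le_trans (_ : \sum_(ga <- box n N) K * M * E * 2^-1 ^+ mdeg ga <= _).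
  by apply: ler_sum => ga _; rewrite [leRHS]mulrAC; exact: KP.
rewrite -mulr_sumr; have -> : K * 2 ^+ n * M * E = K * M * E * 2 ^+ n by ring.
rewrite ler_wpM2l ?mulr_ge0 ?expR_ge0 //.
by apply: sum_geo_le; exact: uniq_box.
Qed.

Lemma mderiv_comb ga (b : C) f (g : cfun R n) : gholo f -> gholo g ->
  mderiv ga (fun z => b * f z + g z) = (fun z => b * mderiv ga f z + mderiv ga g z).
Proof.
move=> fG gG.
pose F (i : bool) : V -> C := if i then f else g.
pose c (i : bool) : C := if i then b else 1.
have FG i : gholo (F i) by case: i.
have E : (fun z => b * f z + g z) = (fun z => \sum_(i <- [:: true; false]) c i * F i z).
  by apply/funext => z; rewrite !big_cons big_nil addr0 /= mul1r.
rewrite E !mderiv_dirDs //; last exact: (gholo_lincomb _ _ FG).1.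
rewrite dirDs_lincomb //; apply/funext => z.
by rewrite !big_cons big_nil addr0 /= mul1r.
Qed.

Lemma op_sum_linear a (b : C) (f f' : Azero n prho1) (g g' h : Azero n prho2) :
  op_sum a f g -> op_sum a f' g' -> op_sum a (b *: f + f') h -> h = b *: g + g'.
Proof.
move=> fg fg' hh; apply: Azero_eq => z; rewrite Azero_scaleD.
apply: climit_uniq (op_sum_pointwise hh z) _.
have := climitD (climitZ b (op_sum_pointwise fg z)) (op_sum_pointwise fg' z).
congr climit; apply/funext => N; rewrite mulr_sumr -big_split; apply: eq_bigr => ga _ /=.
rewrite /op_term (_ : mderiv ga (b *: f + f' : Azero n prho1) =
   (fun z => b * mderiv ga f z + mderiv ga f' z)); first by ring.
rewrite -mderiv_comb //; exact: Azero_gholo hp1.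
Qed.

Theorem operator_continuous a : Dzero rho1 phat1 prho2 a ->
  exists P : {linear Azero n prho1 -> Azero n prho2},
    continuous P /\ forall (f : Azero n prho1) (g : Azero n prho2), op_sum a f g <-> g = P f.
Proof.
move=> aD; have [P PP] := choice (fun f : Azero n prho1 => op_value_ex f aD).
have Plin : linear P by move=> b f f'; exact: op_sum_linear (PP _) (PP _) (PP _).
pose L := GRing.isLinear.Build _ _ _ _ P Plin.
pose PL : {linear Azero n prho1 -> Azero n prho2} := HB.pack P L.
exists PL; split; last first.
  by move=> f g; split=> [fg|->]; [exact: op_sum_uniq fg (PP f)|exact: PP].
move=> f U [[sg del] /= [sg0 del0] sub].
have [eps e0 [K K0 KP]] := op_sum_growth aD sg0.
have K1 : 0 < K + 1 by rewrite ltr_wpDl.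
pose d := del / 2 / (K + 1).
have d0 : 0 < d by rewrite divr_gt0 // halfr_gt0.
exists (eps, d) => //= g; rewrite /Azero_ball /= => /ltW /wnorm_growthP gf.
apply: sub; rewrite /Azero_ball /=.
have := KP _ (P (g - f)) _ (PP (g - f)) gf => /wnorm_growthP le.
have E : P (g - f) = P g - P f by exact: (linearB PL).
rewrite E in le; apply: le_lt_trans le _; rewrite lte_fin /d mulrA ltr_pdivrMr //.
apply: (@le_lt_trans _ _ ((K + 1) * (del / 2))).
  by rewrite ler_wpM2r ?lerDl // ltW // halfr_gt0.
by rewrite mulrC ltr_pM2r // ltr_pdivrMr // ltr_pMr ?ltr1n.
Qed.

End OperatorPart.

(** * The binomial formula for multi-indices *)

Section MultiBinomial.
Variables (R : realType) (n : nat).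
Local Notation C := R[i].
Local Notation V := 'rV[C]_n.
Implicit Types (z w : V) (be ga : midx n).

(** Distributivity of products over sums. *)
Lemma sum_box_on_prod (l : seq 'I_n) N (h : 'I_n -> nat -> C) : uniq l ->
  \sum_(ga <- box_on l N) \prod_(i <- l) h i (ga i) =
  \prod_(i <- l) \sum_(0 <= k < N) h i k.
Proof.
elim: l => [_|i l IH /= /andP[il ul]]; first by rewrite big_seq1 !big_nil.
rewrite big_allpairs_dep big_cons -IH // mulr_suml; apply: eq_bigr => k _.
rewrite mulr_sumr; apply: eq_big_seq => ga gal; rewrite big_cons ffunE eqxx.
have /(mem_box_on _ _ ul) /(_ i) := gal; rewrite (negbTE il) => /eqP ->; rewrite addn0.
congr (_ * _); apply: eq_big_seq => j jl; rewrite ffunE.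
by case: eqP => // ji; move: il; rewrite -ji jl.
Qed.

Definition mbin be ga : nat := \prod_i 'C(be i, ga i).

Lemma mono_add be z w N : (forall i, (be i < N)%N) -> monomial be (z + w) =
  \sum_(ga <- box n N) (mbin be ga)%:R * monomial (midxB be ga) z * monomial ga w.
Proof.
move=> beN.
transitivity (\prod_(i <- enum 'I_n) \sum_(0 <= k < N)
    ('C(be i, k)%:R * z 0 i ^+ (be i - k) * w 0 i ^+ k)).
  rewrite big_enum; apply: eq_bigr => i _; rewrite mxE exprDn.
  rewrite (big_cat_nat _ (n := (be i).+1)) //= [X in _ + X]big_nat_cond.
  rewrite [X in _ + X]big1 ?addr0 => [|k /andP[/andP[bk _] _]]; last first.
    by rewrite bin_small // !mul0r.
  by rewrite big_mkord; apply: eq_bigr => k _; rewrite -mulr_natl mulrA.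
rewrite -sum_box_on_prod ?enum_uniq //; apply: eq_bigr => ga _; rewrite big_enum.
rewrite !big_split /= /mbin natr_prod; congr (_ * _ * _).
by apply: eq_bigr => i _; rewrite ffunE.
Qed.

Lemma mffact_bin be ga : mffact be ga = (mbin be ga * mfact ga)%N.
Proof.
rewrite /mffact /mbin /mfact -big_split; apply: eq_bigr => i _ /=.
by rewrite bin_ffact.
Qed.

Lemma mffact_diag be : mffact be be = mfact be.
Proof. by apply: eq_bigr => i _; rewrite ffactnn. Qed.

Lemma mfact_neq0 be : (mfact be)%:R != 0 :> C.
Proof.
by rewrite pnatr_eq0 -lt0n /mfact; apply: prodn_gt0 => i; exact: fact_gt0.
Qed.

Lemma dirD_translate (f : V -> C) v z :
  dirD v (fun w => f (w - z)) = (fun w => dirD v f (w - z)).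
Proof.
apply/funext => w; have E : (fun t => f (w + t *: v - z)) = (fun t => f (w - z + t *: v)).
  by apply/funext => t; rewrite addrAC.
by rewrite /dirD E.
Qed.

Lemma mderiv_translate ga (f : cfun R n) z : gholo f ->
  mderiv ga (fun w => f (w - z)) = (fun w => mderiv ga f (w - z)).
Proof.
move=> fG; rewrite !mderiv_dirDs //; last exact: gholo_translate.
rewrite /dirDs; elim: (enum 'I_n) => //= i l ->.
by elim: (ga i) => //= k ->; exact: dirD_translate.
Qed.

(** Orders not below be kill the monomial, and lower orders leave a positive power of
    w - z, which vanishes at the centre. *)
Lemma mderiv_mono_center ga be z :
  mderiv ga (fun w => monomial be (w - z)) z = if ga == be then (mfact be)%:R else 0.
Proof.
rewrite mderiv_translate ?mderiv_mono ?subrr; last exact: mono_gholo.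
case: eqP => [->|neq].
  rewrite mffact_diag /monomial big1 ?mulr1 // => i _.
  by rewrite ffunE subnn.
have [->|nz] := eqVneq (mffact be ga) 0%N; first by rewrite mul0r.
have le := mffact_neq0 nz.
have [i lt] : exists i, (ga i < be i)%N.
  apply/existsP; rewrite -[[exists _, _]]negbK negb_exists; apply/negP => /forallP H.
  by apply: neq; apply/ffunP => i; apply/eqP; rewrite eqn_leq le leqNgt H.
rewrite /monomial (bigD1 i) //= mxE ffunE expr0n subn_eq0 leqNgt lt.
by rewrite mul0r mulr0.
Qed.

End MultiBinomial.

(** * Symbols of continuous homomorphisms *)

Section HomomorphismPart.
Variables (R : realType) (n : nat) (rho1 rho2 : R).
Variables (prho1 prho2 phat1 : R -> R).
Hypothesis hrho1 : 0 < rho1.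
Hypothesis hp1 : proximate_order rho1 prho1.
Hypothesis hp2 : proximate_order rho2 prho2.
Hypothesis hO : exists C : R, \forall r \near +oo, r `^ prho1 r <= C * r `^ prho2 r.
Hypothesis hn : normalization rho1 prho1 phat1.
Local Notation C := R[i].
Local Notation V := 'rV[C]_n.
Implicit Types (z w : V) (al be ga : midx n).

Lemma mono_growth (sg : R) : 0 < sg -> exists2 lam : R, 1 <= lam & forall ga z,
  normc (monomial ga z) <=
    lam ^+ mdeg ga * phi_pow phat1 (mdeg ga) * expR (sg * enorm z `^ prho1 (enorm z)).
Proof.
move=> sg0; have [lam lam1 lamP] := pow_le_growth hrho1 hn sg0.
exists lam => // ga z; apply: le_trans (mono_enorm _ _) _.
exact: lamP (enorm_ge0 z).
Qed.

(** |w - z| is at most twice the larger of |w| and |z|, so [pow_le_growth] applies to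
    one of them. The dependence on z is as mild as the dependence on w. *)
Lemma centered_mono_growth (sg : R) : 0 < sg -> exists2 lam : R, 0 < lam & forall ga z,
  growth_le prho1 sg (2 * lam ^+ mdeg ga * phi_pow phat1 (mdeg ga) *
     expR (sg * enorm z `^ prho1 (enorm z))) (fun w => monomial ga (w - z)).
Proof.
move=> sg0; have [lam lam1 lamP] := pow_le_growth hrho1 hn sg0.
have lam0 : 0 < lam by apply: lt_le_trans lam1.
exists (2 * lam); first by rewrite mulr_gt0.
move=> ga z w; set q := mdeg ga.
pose m := Num.max (enorm w) (enorm z).
have m0 : 0 <= m by rewrite le_max enorm_ge0.
have m20 : 0 <= 2 * m by rewrite mulr_ge0.
have wz : pdisc (2 * m) (w - z).
  move=> i; rewrite !mxE; apply: le_trans (ncB _ _) _; rewrite mulr_natl mulr2n.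
  apply: lerD; [apply: le_trans (pdisc_enorm w i) _|apply: le_trans (pdisc_enorm z i) _];
  by rewrite le_max lexx ?orbT.
apply: le_trans (mono_bound ga m20 wz) _; rewrite -/q exprMn.
have P0 : 0 <= phi_pow phat1 q by apply/ltW/(phi_pow_gt0 hn).
have lp0 : 0 <= lam ^+ q * phi_pow phat1 q.
  by apply: mulr_ge0 => //; exact: exprn_ge0 (ltW lam0).
have fin (Ez Ew : R) : enorm z ^+ q <= lam ^+ q * phi_pow phat1 q * Ez ->
    enorm w ^+ q <= lam ^+ q * phi_pow phat1 q * Ew -> 1 <= Ez -> 1 <= Ew ->
    2 ^+ q * m ^+ q <= 2 * (2 * lam) ^+ q * phi_pow phat1 q * Ez * Ew.
  move=> hz hw Ez1 Ew1.
  have Ez0 : 0 <= Ez by exact: le_trans ler01 Ez1.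
  have Ew0 : 0 <= Ew by exact: le_trans ler01 Ew1.
  have mq : m ^+ q <= lam ^+ q * phi_pow phat1 q * (Ez * Ew).
    rewrite /m; case: (leP (enorm w) (enorm z)) => _.
      by apply: le_trans hz _; rewrite ler_wpM2l // ler_peMr.
    by apply: le_trans hw _; rewrite ler_wpM2l // ler_peMl.
  apply: le_trans (_ : 2 ^+ q * (lam ^+ q * phi_pow phat1 q * (Ez * Ew)) <= _).
    by rewrite ler_wpM2l // exprn_ge0.
  have -> : 2 * (2 * lam) ^+ q * phi_pow phat1 q * Ez * Ew =
    2 * (2 ^+ q * (lam ^+ q * phi_pow phat1 q * (Ez * Ew))) by rewrite exprMn; ring.
  rewrite ler_peMl ?ler1n // mulr_ge0 ?exprn_ge0 //.
  by apply: mulr_ge0 => //; exact: mulr_ge0.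
have ge1 (v : V) : 1 <= expR (sg * enorm v `^ prho1 (enorm v)).
  by apply: le_trans (expR_ge1Dx _); rewrite lerDl mulr_ge0 ?powR_ge0 // ltW.
exact: fin (lamP q _ (enorm_ge0 z)) (lamP q _ (enorm_ge0 w)) (ge1 z) (ge1 w).
Qed.

Lemma centered_mono_ex ga z : exists Q : Azero n prho1, forall w, Q w = monomial ga (w - z).
Proof.
apply: (@Azero_ex R n prho1 (fun w => monomial ga (w - z))).
  exact: (gholo_translate (- z) (mono_gholo R ga)).
by move=> sg /centered_mono_growth [lam _ H]; eexists; exact: H.
Qed.

Lemma mono_ex ga : exists Q : Azero n prho1, forall w, Q w = monomial ga w.
Proof.
have [Q QE] := centered_mono_ex ga 0; exists Q => w; by rewrite QE subr0.
Qed.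

Variable F : {linear Azero n prho1 -> Azero n prho2}.
Hypothesis Fc : continuous F.

(** Continuity at 0 gives the bound for one size of f, and homogeneity for all. *)
Lemma continuous_growth (sg : R) : 0 < sg -> exists2 eps : R, 0 < eps &
  exists2 K : R, 0 <= K & forall (f : Azero n prho1) M,
    growth_le prho1 eps M f -> growth_le prho2 sg (K * M) (F f).
Proof.
move=> sg0.
have [] := @Fc 0 (Azero_ball (F 0) (sg, 1)) _; first by exists (sg, 1).
move=> [eps del] [/= e0 d0] sub.
exists eps => //; exists (2 / del); first by rewrite divr_ge0 // ltW.
move=> f M fM; have M0 := growth_le_ge0 fM.
(* The scaling argument needs M > 0; if M = 0 then f = 0. *)
have [M00|Mn] := eqVneq M 0.
  have -> : f = 0.
    apply: Azero_eq => z; apply: eq0_normc; apply/eqP; rewrite eq_le normc_ge0 andbT.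
    by apply: le_trans (fM z) _; rewrite M00 mul0r.
  by rewrite linear0 => z; rewrite M00 mulr0 mul0r [normc _]normc0.
have Mp : 0 < M by rewrite lt_def Mn.
pose b : R := del / (2 * M).
have b0 : 0 < b by rewrite divr_gt0 // mulr_gt0.
have bC : (b%:C : C) != 0.
  by apply/eqP => /(congr1 (@normc R)); rewrite nc_real gtr0_norm // normc0 => /eqP; rewrite gt_eqF.
have nb : normc (b%:C : C) = b by rewrite nc_real gtr0_norm.
have bf : growth_le prho1 eps (del / 2) (b%:C *: f : Azero n prho1).
  move=> z; rewrite [normc _]normcM nb.
  apply: le_trans (ler_wpM2l (ltW b0) (fM z)) _.
  rewrite mulrA ler_wpM2r ?expR_ge0 // le_eqVlt; apply/orP; left; apply/eqP.
  by rewrite /b; field; rewrite gt_eqF.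
have bl : Azero_ball 0 (eps, del) (b%:C *: f).
  rewrite /Azero_ball /= subr0; apply: (@le_lt_trans _ _ (del / 2)%:E).
    exact/wnorm_growthP.
  by rewrite lte_fin ltr_pdivrMr // ltr_pMr ?ltr1n.
have := sub _ bl; rewrite /Azero_ball /= linear0 subr0 linearZ => /ltW /wnorm_growthP h z.
have := h z; rewrite [normc _]normcM nb mul1r => h1.
rewrite -(ler_pM2l b0); apply: le_trans h1 _.
rewrite le_eqVlt; apply/orP; left; apply/eqP; rewrite /b.
by field; rewrite !gt_eqF.
Qed.

Variable Q : midx n -> V -> Azero n prho1.
Hypothesis QE : forall ga z w, Q ga z w = monomial ga (w - z).

(** The value at w = z of the image of w |-> (w - z)^ga, divided by ga!. Here Q ga z
    stands for that function as an element of the space. *)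
Definition symbol : formal_op R n := fun ga z => F (Q ga z) z / (mfact ga)%:R.
Local Notation a := symbol.

(** The binomial formula in powers of z turns the symbol into a finite sum of
    polynomials in z times images of monomials. *)
Lemma symbol_gholo ga : gholo (a ga).
Proof.
have [M ME] := choice mono_ex.
(* A box that contains all multi-indices below ga. *)
pose N := (mdeg ga).+1.
have gaN i : (ga i < N)%N by rewrite ltnS /mdeg (bigD1 i) //= leq_addr.
pose c al z : C := (mbin ga al)%:R * monomial (midxB ga al) (- z).
have cG al : gholo (c al).
  have mG : gholo (fun z : V => monomial (midxB ga al) (- z)).
    apply: (gholo_linear (A := fun z => - z) (mono_gholo R _)) => [z t v|r].
      by rewrite opprD scalerN.
    by exists r => z zr i; rewrite mxE ncN.
  exact: (gholo_mul (gholo_cst n (mbin ga al)%:R) mG).1.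
have -> : a ga = (fun z => (mfact ga)%:R^-1 * \sum_(al <- box n N) c al z * F (M al) z).
  apply/funext => z; rewrite /a mulrC; congr (_ * _).
  have -> : Q ga z = \sum_(al <- box n N) c al z *: M al.
    apply: Azero_eq => w; rewrite QE addrC (mono_add _ _ gaN) Azero_sum.
    by apply: eq_bigr => al _; rewrite -(ME al w).
  rewrite linear_sum Azero_sum; apply: eq_bigr => al _.
  by rewrite linearZ.
have termG al := (gholo_mul (cG al) (Azero_gholo (F (M al)) hp2)).1.
exact: (gholo_mul (gholo_cst n _) (gholo_sum (box n N) termG).1).1.
Qed.

(** F costs a factor exp(sg / 2 * V2), and the bound for (w - z)^ga has a factor
    exp(eps * V1(|z|)), at most const * exp(sg / 2 * V2) for small eps. *)
Lemma symbol_growth (sg : R) : 0 < sg -> exists2 lam : R, 0 < lam &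
  exists2 K : R, 0 < K & forall ga, growth_le prho2 sg
    (K * (Gcoef rho1 phat1 (mdeg ga) / (mfact ga)%:R) * lam ^+ mdeg ga) (a ga).
Proof.
move=> sg0.
have [e1 e10 [K K0 KP]] := continuous_growth (halfr_gt0 sg0).
have [c c0 [A A0 cP]] := growth_domination hp1 hO.
(* Below e1 for the continuity estimate, and small enough to convert V1 into V2. *)
pose eps := Num.min e1 (sg / 2 / c).
have eps0 : 0 < eps by rewrite lt_min e10 !divr_gt0.
have ee1 : eps <= e1 by rewrite ge_min lexx.
have ec : eps * c <= sg / 2 by rewrite -ler_pdivlMr // ge_min lexx orbT.
have [lam lam0 lamP] := centered_mono_growth eps0.
pose kap := ((expR 1 * rho1) `^ rho1^-1)^-1.
have kap0 : 0 < kap by rewrite invr_gt0 powR_gt0 // mulr_gt0 ?expR_gt0.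
exists (lam / kap); first by rewrite divr_gt0.
pose K' := K * 2 * expR (eps * A).
have K'0 : 0 <= K' by rewrite !mulr_ge0 ?expR_ge0.
exists (K' + 1); first by rewrite ltr_wpDl.
move=> ga z; rewrite /a.
set q := mdeg ga.
pose M := 2 * lam ^+ q * phi_pow phat1 q * expR (eps * enorm z `^ prho1 (enorm z)).
have P0 := phi_pow_gt0 hn q.
have M0 : 0 <= M.
  apply: mulr_ge0 (expR_ge0 _); apply: mulr_ge0 (ltW P0).
  by apply: mulr_ge0 => //; exact: exprn_ge0 (ltW lam0).
have QM : growth_le prho1 e1 M (Q ga z).
  apply: (growth_le_mono ee1 M0 (lexx M)) => w; rewrite QE.
  exact: lamP.
have h := KP _ M QM z.
have F0 : (0 : R) < (mfact ga)%:R.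
  by rewrite ltr0n /mfact; apply: prodn_gt0 => i; exact: fact_gt0.
rewrite normcM normcV nc_nat (GcoefE _ _ q) -/kap ler_pdivrMr //.
apply: le_trans h _; rewrite /M.
set E1 := expR _; set E2 := expR _; set E3 := expR (sg * _).
have EE : E1 * E2 <= expR (eps * A) * E3.
  rewrite /E1 /E2 /E3 -!expRD ler_expR.
  have := cP _ (enorm_ge0 z); set G1 := _ `^ prho1 _; set G2 := _ `^ prho2 _ => h1.
  have : eps * G1 <= eps * (c * G2 + A) by rewrite ler_pM2l.
  have : eps * c * G2 <= sg / 2 * G2 by rewrite ler_wpM2r ?powR_ge0.
  lra.
have -> : K * (2 * lam ^+ q * phi_pow phat1 q * E1) * E2 =
   (K * 2 * (lam ^+ q * phi_pow phat1 q)) * (E1 * E2) by ring.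
have lp0 : 0 <= lam ^+ q * phi_pow phat1 q.
  by apply: mulr_ge0 (ltW P0); exact: exprn_ge0 (ltW lam0).
apply: le_trans (_ : K * 2 * (lam ^+ q * phi_pow phat1 q) * (expR (eps * A) * E3) <= _).
  by rewrite ler_wpM2l // mulr_ge0 // mulr_ge0.
have -> : (K' + 1) * (phi_pow phat1 q * kap ^+ q / (mfact ga)%:R) * (lam / kap) ^+ q * E3 *
    (mfact ga)%:R = (K' + 1) * ((lam ^+ q * phi_pow phat1 q) * E3).
  by rewrite expr_div_n; field; rewrite !gt_eqF ?exprn_gt0.
have -> : K * 2 * (lam ^+ q * phi_pow phat1 q) * (expR (eps * A) * E3) =
   K' * ((lam ^+ q * phi_pow phat1 q) * E3) by rewrite /K'; ring.
apply: ler_wpM2r; last by rewrite lerDl.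
exact: mulr_ge0 lp0 (expR_ge0 _).
Qed.

Lemma symbol_Dzero : Dzero rho1 phat1 prho2 a.
Proof.
split=> [ga|sg sg0].
  exists 1 => //; split; first exact: (gholo_entire (symbol_gholo ga)).
  have [lam _ [K _ KP]] := symbol_growth ltr01.
  by apply/wnorm_lty; eexists; exact: KP.
have [lam lam0 [K K0 KP]] := symbol_growth sg0.
exists lam; split=> //; exists K; split=> // ga; apply/wnorm_growthP; exact: KP.
Qed.

(** The Taylor formula of the monomial at z: its derivatives at z, divided by
    factorials, are the coefficients of its expansion in powers of w - z. *)
Lemma symbol_mono (P : {linear Azero n prho1 -> Azero n prho2}) be (M : Azero n prho1) :
  (forall w, M w = monomial be w) ->
  (forall f : Azero n prho1, op_sum a f (P f)) -> P M = F M.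
Proof.
move=> ME PP; apply: Azero_eq => z.
apply: climit_uniq (op_sum_pointwise (PP M) z) _.
apply: (climit_eventually (N := (mdeg be).+1) _ (climit_cst (F M z))) => N degN.
have beN i : (be i < N)%N.
  by apply: leq_trans degN; rewrite ltnS /mdeg (bigD1 i) //= leq_addr.
have Mmono : (M : cfun R n) = monomial be by apply/funext.
have MQ : M = \sum_(ga <- box n N) ((mbin be ga)%:R * monomial (midxB be ga) z) *: Q ga z.
  apply: Azero_eq => w; rewrite ME -(subrKC z w) (mono_add _ _ beN) Azero_sum.
  by apply: eq_bigr => ga _; rewrite subrKC -QE.
have -> : F M z = \sum_(ga <- box n N)
    ((mbin be ga)%:R * monomial (midxB be ga) z) * F (Q ga z) z.
  by rewrite {1}MQ linear_sum Azero_sum; apply: eq_bigr => ga _; rewrite linearZ.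
apply: eq_bigr => ga _; rewrite /op_term Mmono mderiv_mono mffact_bin natrM /a.
by field; exact: mfact_neq0.
Qed.

(** Evaluate the series at w |-> (w - z)^ga and at the point z. *)
Lemma symbol_unique (b : formal_op R n) :
  (forall f : Azero n prho1, op_sum b f (F f)) -> b = a.
Proof.
move=> bF; apply/funext => ga; apply/funext => z.
have Qmono : (Q ga z : cfun R n) = (fun w => monomial ga (w - z)) by apply/funext => w; exact: QE.
have H : F (Q ga z) z = b ga z * (mfact ga)%:R.
  apply: climit_uniq (op_sum_pointwise (bF (Q ga z)) z) _.
  apply: (climit_eventually (N := (mdeg ga).+1) _ (climit_cst _)) => N degN.
  have gaN : ga \in box n N.
    apply/mem_box => i; apply: leq_trans degN.
    by rewrite ltnS /mdeg (bigD1 i) //= leq_addr.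
  rewrite (bigD1_seq ga) ?uniq_box //= big1 ?addr0 => [|de /negbTE dega];
    by rewrite /op_term Qmono mderiv_mono_center ?eqxx // dega mulr0.
by rewrite /a H mulfK // mfact_neq0.
Qed.

End HomomorphismPart.

(** * Density of polynomials *)

Section Density.
Variables (R : realType) (n : nat) (rho1 : R) (prho1 prho2 phat1 : R -> R).
Hypothesis hrho1 : 0 < rho1.
Hypothesis hp1 : proximate_order rho1 prho1.
Hypothesis hn : normalization rho1 prho1 phat1.

(** Polynomials are dense: the decay of the coefficients beats the growth of the
    monomials by 2^-|al|. *)
Lemma taylor_growth (f : Azero n prho1) (sg : R) : 0 < sg -> exists2 c : R, 0 <= c &
  forall e N, tail_le n e N -> growth_le prho1 sg (c * e)
    (fun z => \sum_(al <- box n N) coef al f * monomial al z - f z).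
Proof.
move=> sg0; have [lam lam1 lamP] := mono_growth n hrho1 hn sg0.
have lam0 : 0 < lam by apply: lt_le_trans lam1.
have be0 : 0 < 2^-1 / lam by rewrite divr_gt0.
have [eps e0 [K K0 KP]] := coef_decay n hrho1 hp1 hn be0.
have [M fM] := Azero_growth f e0; have M0 := growth_le_ge0 fM.
have fG := Azero_gholo f hp1.
exists (K * M); first by rewrite mulr_ge0.
move=> e N tN z; set E := expR _.
have E0 : 0 <= E by exact: expR_ge0.
have c0 : 0 <= K * M * E by rewrite !mulr_ge0.
have xc al : normc (coef al f * monomial al z) <= K * M * E * 2^-1 ^+ mdeg al.
  rewrite normcM; set q := mdeg al; have P0 := phi_pow_gt0 hn q.
  apply: le_trans (ler_pM (normc_ge0 _) (normc_ge0 _) (KP _ _ fG M0 fM al) (lamP al z)) _.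
  rewrite -/q -/E le_eqVlt; apply/orP; left; apply/eqP.
  move: (phi_pow phat1 q) P0 => ps P0; have lq : lam ^+ q != 0 by rewrite expf_neq0 // gt_eqF.
  rewrite expr_div_n; field.
  by rewrite lq gt_eqF.
have [l [ll _ H]] := midx_summable c0 xc.
rewrite (climit_uniq (taylor_expansion z fG) ll) mulrAC.
by apply: H tN _ _ => //; exact: uniq_box.
Qed.

Lemma continuous_eq_on_mono (F G : {linear Azero n prho1 -> Azero n prho2}) :
  continuous F -> continuous G ->
  (forall al (M : Azero n prho1), (forall w, M w = monomial al w) -> F M = G M) ->
  forall f, F f = G f.
Proof.
move=> Fc Gc FG f; apply: Azero_eq => z; apply/eqP; rewrite -subr_eq0; apply/eqP.
have [e1 e10 [K1 K10 KP1]] := continuous_growth Fc ltr01.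
have [e2 e20 [K2 K20 KP2]] := continuous_growth Gc ltr01.
pose eps := Num.min e1 e2; have eps0 : 0 < eps by rewrite lt_min e10 e20.
have [c c0 cP] := taylor_growth f eps0.
have [M ME] := choice (fun al : midx n => mono_ex hrho1 hn al).
set E := expR (1 * enorm z `^ prho2 (enorm z)) in KP1 KP2 *.
pose L := (K1 + K2) * c * E + 1.
have L0 : 0 < L by rewrite ltr_wpDl // !mulr_ge0 ?addr_ge0 ?expR_ge0.
apply: nc_eq0 => e e0; have eL : 0 < e / L by rewrite divr_gt0.
have [N tN] := geo_tail n eL.
pose p := \sum_(al <- box n N) coef al f *: M al - f.
have pg : growth_le prho1 eps (c * (e / L)) p.
  move=> w; have := cP _ _ tN w; congr (_ <= _); congr normc.
  have -> : p w = (\sum_(al <- box n N) coef al f *: M al) w - f w by [].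
  rewrite Azero_sum; congr (_ - _); apply: eq_bigr => al _; by rewrite -ME.
have pFG : F p - G p = G f - F f.
  have Fp : F p = \sum_(al <- box n N) F (coef al f *: M al) - F f.
    by rewrite /p linearB linear_sum.
  have Gp : G p = \sum_(al <- box n N) F (coef al f *: M al) - G f.
    rewrite /p linearB linear_sum; congr (_ - _); apply: eq_bigr => al _.
    by rewrite !linearZ (FG al _ (ME al)).
  by rewrite Fp Gp opprB addrC addrA subrK.
have h : F f z - G f z = - (F p z - G p z).
  have -> : F p z - G p z = G f z - F f z.
    exact: (congr1 (fun u : Azero n prho2 => u z) pFG).
  exact: esym (opprB _ _).
rewrite h ncN; apply: le_trans (ncB _ _) _.
have ce0 := growth_le_ge0 pg.
have ee1 : eps <= e1 by rewrite ge_min lexx.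
have ee2 : eps <= e2 by rewrite ge_min lexx orbT.
have h1 := KP1 _ _ (growth_le_mono ee1 ce0 (lexx _) pg) z.
have h2 := KP2 _ _ (growth_le_mono ee2 ce0 (lexx _) pg) z.
apply: le_trans (lerD h1 h2) _; rewrite -/E.
have -> : K1 * (c * (e / L)) * E + K2 * (c * (e / L)) * E = e / L * ((K1 + K2) * c * E) by ring.
apply: le_trans (_ : e / L * L <= _); last by rewrite divfK // gt_eqF.
by rewrite ler_wpM2l ?(ltW eL) // /L lerDl.
Qed.

End Density.

Theorem theorem4p7 (R : realType) (n : nat) (hn : (1 <= n)%N)
  (rho1 rho2 : R) (hrho1 : 0 < rho1) (hrho2 : 0 < rho2)
  (prho1 prho2 : R -> R)
  (hprho1 : proximate_order rho1 prho1)
  (hprho2 : proximate_order rho2 prho2)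
  (hO : exists C : R, \forall r \near +oo, r `^ prho1 r <= C * r `^ prho2 r)
  (phat1 : R -> R) (hphat1 : normalization rho1 prho1 phat1) :
  (forall a : formal_op R n, Dzero rho1 phat1 prho2 a ->
     exists P : {linear Azero n prho1 -> Azero n prho2},
       continuous P /\
       forall (f : Azero n prho1) (g : Azero n prho2),
         op_sum a f g <-> g = P f) /\
  (forall F : {linear Azero n prho1 -> Azero n prho2}, continuous F ->
     exists! a : formal_op R n,
       Dzero rho1 phat1 prho2 a /\
       forall f : Azero n prho1, op_sum a f (F f)).
Proof.
split=> [a aD|F Fc]; first exact: operator_continuous hrho1 hprho1 hprho2 hO hphat1 _ aD.
have [Q QE] := choice (fun p : midx n * 'rV[R[i]]_n =>
  centered_mono_ex hrho1 hphat1 p.1 p.2).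
pose q ga z := Q (ga, z).
have qE ga z w : q ga z w = monomial ga (w - z) by exact: QE.
have aD : Dzero rho1 phat1 prho2 (symbol F q).
  apply: (symbol_Dzero hrho1 hprho1 hprho2 hO hphat1). exact: Fc. exact: qE.
exists (symbol F q); split.
  split=> // f.
  have [P [Pc PP]] := operator_continuous hrho1 hprho1 hprho2 hO hphat1 aD.
  suff -> : F f = P f by apply/PP.
  apply: (continuous_eq_on_mono hrho1 hprho1 hphat1 Fc Pc) => al M ME.
  apply/esym/(symbol_mono qE ME) => h; exact/PP.
by move=> b [_ bF]; apply/esym/(symbol_unique qE bF).
Qed.
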